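(* Let $R$ be a commutative local ring with maximal ideal $(\varepsilon)\neq0$ such that $\varepsilon^2=0$ and with residue field $k=R/(\varepsilon)$ of characteristic $2$. Neeman's and Breuning's $K$-theories of the triangulated category $\mathcal F(R)$ satisfy $$K_0({}^b\mathcal F(R))\cong K_0({}^d\mathcal F(R))\cong K_0({}^v\mathcal F(R))\cong0,\qquad K_1({}^b\mathcal F(R))\cong K_1({}^d\mathcal F(R))\cong0.$$ Moreover, there is a surjective homomorphism $K_1({}^v\mathcal F(R))\twoheadrightarrow k^\times/(k^\times)^2$.
   Context: $\mathcal F(R)$ is the category of finitely generated free $R$-modules, with its unique triangulated structure with identity suspension functor $\Sigma=1_{\mathcal F(R)}$ for which $R\xrightarrow{\varepsilon}R\xrightarrow{\varepsilon}R\xrightarrow{\varepsilon}R$ is a distinguished triangle (existence and uniqueness: Muro–Schwede–Strickland). Stable quadratic modules. Groups are additive, $[x,y]=-x-y+x+y$. A stable quadratic module $C_*$ consists of homomorphisms $C_0^{ab}\otimes C_0^{ab}\xrightarrow{\langle\cdot,\cdot\rangle}C_1\xrightarrow{\partial}C_0$ with $\langle c_0,c_0'\rangle+\langle c_0',c_0\rangle=0$, $\partial\langle c_0,c_0'\rangle=[c_0',c_0]$, $\langle\partial c_1,\partial c_1'\rangle=[c_1',c_1]$; $C_0$ acts on $C_1$ by $c_1^{c_0}=c_1+\langle c_0,\partial c_1\rangle$; $\pi_0C_*=C_0/\partial C_1$, $\pi_1C_*=\ker\partial$. Presentations by generators in degrees $0,1$ and relations have the evident universal property. Triangles in a triangulated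 category $\mathcal T$ (suspension $\Sigma$, chosen zero $0$). A triangle is $X\xrightarrow fY\xrightarrow iC\xrightarrow q\Sigma X$ with consecutive composites (also $(\Sigma f)q$) zero. An octahedral diagram on $X\xrightarrow fY\xrightarrow gZ$ consists of triangles $\Delta_f\colon X\xrightarrow{f}Y\xrightarrow{i^f}C^f\xrightarrow{q^f}\Sigma X$, $\Delta_g\colon Y\xrightarrow{g}Z\xrightarrow{i^g}C^g\xrightarrow{q^g}\Sigma Y$, $\Delta_{gf}\colon X\xrightarrow{gf}Z\xrightarrow{i^{gf}}C^{gf}\xrightarrow{q^{gf}}\Sigma X$, $\widetilde\Delta\colon C^f\xrightarrow{\bar g}C^{gf}\xrightarrow{\bar f}C^g\xrightarrow{(\Sigma i^f)q^g}\Sigma C^f$ with $\bar g i^f=i^{gf}g$, $q^{gf}\bar g=q^f$, $\bar f i^{gf}=i^g$, $q^g\bar f=(\Sigma f)q^{gf}$. It is an (ordinary) octahedron if all four triangles are distinguished; special if moreover $Y\xrightarrow{(g,-i^f)}Z\oplus C^f\xrightarrow{(i^{gf},\bar g)}C^{gf}\xrightarrow{q^g\bar f}\Sigma Y$ and $C^{gf}\xrightarrow{(q^{gf},-\bar f)}\Sigma X\oplus C^g\xrightarrow{(\Sigma f,q^g)}\Sigma Y\xrightarrow{\Sigma(\bar g i^f)}\Sigma C^{gf}$ are distinguished. Contractible triangles are direct sums of triangles $A\xrightarrow1A\to0\to\Sigma A$, $0\to B\xrightarrow1B\to0$, $C\to0\to\Sigma C\xrightarrow1\Sigma C$. A triangle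 is virtual if its sum with some contractible triangle is isomorphic to some $(f',i',q')$ such that there are distinguished triangles $(f'',i',q')$, $(f',i'',q')$, $(f',i',q'')$ on the same objects. A virtual octahedron is an octahedral diagram whose four triangles are virtual. For $\sharp\in\{b,d,v\}$, a $\sharp$-triangle is a distinguished triangle if $\sharp=b,d$ and a virtual triangle if $\sharp=v$; a $\sharp$-octahedron is an ordinary, special, virtual octahedron for $\sharp=b,d,v$. $\mathcal D_*({}^\sharp\mathcal T)$ is presented by generators $[X]$ (degree $0$) for each object, $[h]$ (degree $1$) for each isomorphism $h\colon X\to X'$, $[\Delta]$ (degree $1$) for each $\sharp$-triangle $\Delta=(X\to Y\to C\to\Sigma X)$, and relations: $\partial[h]=-[X']+[X]$; $\partial[\Delta]=-[Y]+[C]+[X]$; $[0]=0$; $[1_X]=0$; $[X\xrightarrow1X\to0\to\Sigma X]=0=[0\to X\xrightarrow1X\to0]$; $[kh]=[k]+[h]$; $[a]+[c]^{[X]}=-[\Delta']+[b]+[\Delta]$ for each isomorphism $(a,b,c)\colon\Delta\to\Delta'$ of $\sharp$-triangles; $[\Delta_g]+[\Delta_f]=[\Delta_{gf}]+[\widetilde\Delta]^{[X]}$ for each $\sharp$-octahedron; $\langle[X],[Y]\rangle=-[\Delta_2]+[\Delta_1]$ with $\Delta_1\colon X\to X\oplus Y\to Y\xrightarrow0\Sigma X$, $\Delta_2\colon Y\to X\oplus Y\to X\xrightarrow0\Sigma Y$. $K_i({}^\sharp\mathcal T)$ is identified with $\pi_i\mathcal D_*({}^\sharp\mathcal T)$,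 $i=0,1$ (Breuning's definition for $\sharp=b$; canonically isomorphic to Neeman's for $\sharp=d,v$). *)

(* Defs.v *)
From HB Require Import structures.
From mathcomp Require Import all_boot all_algebra.
From mathcomp Require Import boolp.

Set Implicit Arguments.
Unset Strict Implicit.
Unset Printing Implicit Defensive.

Import GRing.Theory.

(* Not necessarily abelian, but written additively.  The groups below have a
   generator for every inhabitant of [vectType R], a type which is too large to
   be the carrier of an [eqType], hence of a [groupType]. *)
Record group := Group {
  gcar :> Type;
  gadd : gcar -> gcar -> gcar;
  gzero : gcar;
  gopp : gcar -> gcar;
  gaddA : forall x y z, gadd x (gadd y z) = gadd (gadd x y) z;
  gadd0 : forall x, gadd gzero x = x;
  gaddr0 : forall x, gadd x gzero = x;
  gaddN : forall x, gadd (gopp x) x = gzero;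
  gaddrN : forall x, gadd x (gopp x) = gzero }.

Arguments gzero {_}.

Declare Scope grp_scope.
Delimit Scope grp_scope with grp.
Bind Scope grp_scope with gcar.
Notation "x + y" := (gadd x y) : grp_scope.
Notation "- x" := (gopp x) : grp_scope.
Notation "0" := gzero : grp_scope.
Local Open Scope grp_scope.

Definition gcomm (G : group) (x y : G) : G := - x + - y + x + y.

Record ghom (G H : group) := GHom {
  gfun :> G -> H;
  gfunD : forall x y, gfun (x + y) = gfun x + gfun y }.

Definition trivial_group (G : group) : Prop := forall x : G, x = 0.

Section GroupTheory.
Variable G : group.
Implicit Types x y z : G.

Lemma gaddK x y : x + y + - y = x.
Proof. by rewrite -gaddA gaddrN gaddr0. Qed.
Lemma gaddNK x y : x + - y + y = x.
Proof. by rewrite -gaddA gaddN gaddr0. Qed.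
Lemma gaddI x y z : x + y = x + z -> y = z.
Proof. by move/(congr1 (gadd (- x))); rewrite !gaddA gaddN !gadd0. Qed.
Lemma gopp_eq x y : x + y = 0 -> - x = y.
Proof. by move=> h; apply: (@gaddI x); rewrite gaddrN h. Qed.
Lemma goppD x y : - (x + y) = - y + - x.
Proof. by apply: gopp_eq; rewrite gaddA gaddK gaddrN. Qed.
Lemma goppK x : - - x = x.
Proof. by apply: gopp_eq; rewrite gaddN. Qed.

Lemma gopp0 : - 0 = 0 :> G.
Proof. by apply: gopp_eq; rewrite gadd0. Qed.

End GroupTheory.

Section GroupHom.
Variables (G H : group) (f : ghom G H).

Lemma gfun0 : f 0 = 0.
Proof. by apply: (@gaddI _ (f 0)); rewrite -gfunD !gaddr0. Qed.
Lemma gfunN x : f (- x) = - f x.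
Proof. by apply/esym/gopp_eq; rewrite -gfunD gaddrN gfun0. Qed.

End GroupHom.

Lemma sval_inj (T : Type) (P : T -> Prop) (u v : {x | P x}) :
  sval u = sval v -> u = v.
Proof. by case: u v => [x px] [y py] /=; apply: eq_exist. Qed.

Section Quotient.
Variables (T : Type) (E : T -> T -> Prop).
Hypotheses (E_refl : forall x, E x x) (E_sym : forall x y, E x y -> E y x)
  (E_trans : forall x y z, E x y -> E y z -> E x z).

Definition quot : Type := {P : T -> Prop | exists x, P = E x}.

Definition cls (x : T) : quot := exist _ (E x) (ex_intro _ x erefl).

Definition qrepr (q : quot) : T := sval (cid (svalP q)).

Lemma clsP x y : cls x = cls y <-> E x y.
Proof.
split=> [[->] //|xy]; apply: sval_inj => /=.
apply/funext => z; apply/propext; split; first exact/E_trans/E_sym.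
exact: E_trans.
Qed.

Lemma clsK q : cls (qrepr q) = q.
Proof. by apply: sval_inj; rewrite /qrepr; case: cid => x /= ->. Qed.

Lemma qrepr_cls x : E (qrepr (cls x)) x.
Proof. by apply/clsP/clsK. Qed.

Lemma clsW (P : quot -> Prop) : (forall x, P (cls x)) -> forall q, P q.
Proof. by move=> h q; rewrite -(clsK q). Qed.

Variables (add : T -> T -> T) (zero : T) (opp : T -> T).
Hypotheses
  (E_add : forall x x' y y', E x x' -> E y y' -> E (add x y) (add x' y'))
  (E_opp : forall x x', E x x' -> E (opp x) (opp x'))
  (E_addA : forall x y z, E (add x (add y z)) (add (add x y) z))
  (E_add0 : forall x, E (add zero x) x) (E_addr0 : forall x, E (add x zero) x)
  (E_addN : forall x, E (add (opp x) x) zero)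
  (E_addrN : forall x, E (add x (opp x)) zero).

Let qadd (p q : quot) : quot := cls (add (qrepr p) (qrepr q)).
Let qopp (p : quot) : quot := cls (opp (qrepr p)).

Lemma quot_addE x y : qadd (cls x) (cls y) = cls (add x y).
Proof. by apply/clsP/E_add; apply: qrepr_cls. Qed.
Lemma quot_oppE x : qopp (cls x) = cls (opp x).
Proof. by apply/clsP/E_opp/qrepr_cls. Qed.

Let qaddA p q r : qadd p (qadd q r) = qadd (qadd p q) r.
Proof.
elim/clsW: p => x; elim/clsW: q => y; elim/clsW: r => z.
by rewrite !quot_addE; apply/clsP/E_addA.
Qed.
Let qadd0 p : qadd (cls zero) p = p.
Proof. by elim/clsW: p => x; rewrite quot_addE; apply/clsP/E_add0. Qed.
Let qaddr0 p : qadd p (cls zero) = p.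
Proof. by elim/clsW: p => x; rewrite quot_addE; apply/clsP/E_addr0. Qed.
Let qaddN p : qadd (qopp p) p = cls zero.
Proof. by elim/clsW: p => x; rewrite quot_oppE quot_addE; apply/clsP/E_addN. Qed.
Let qaddrN p : qadd p (qopp p) = cls zero.
Proof. by elim/clsW: p => x; rewrite quot_oppE quot_addE; apply/clsP/E_addrN. Qed.

Definition quot_group : group := Group qaddA qadd0 qaddr0 qaddN qaddrN.

End Quotient.

Record normal_subgroup (G : group) := NormalSubgroup {
  nsub :> G -> Prop;
  nsub0 : nsub 0;
  nsubD : forall x y, nsub x -> nsub y -> nsub (x + y);
  nsubN : forall x, nsub x -> nsub (- x);
  nsubJ : forall x y, nsub x -> nsub (- y + x + y) }.

Section QuotientGroup.
Variables (G : group) (N : normal_subgroup G).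
Implicit Types x y z : G.

Definition coset_rel x y : Prop := N (- x + y).

Lemma coset_rel_refl x : coset_rel x x.
Proof. by rewrite /coset_rel gaddN; apply: nsub0. Qed.
Lemma coset_rel_sym x y : coset_rel x y -> coset_rel y x.
Proof. by move/nsubN; rewrite goppD goppK. Qed.
Lemma coset_rel_trans x y z : coset_rel x y -> coset_rel y z -> coset_rel x z.
Proof. by move=> h1 h2; have := nsubD h1 h2; rewrite gaddA gaddK. Qed.
Lemma coset_rel_add x x' y y' :
  coset_rel x x' -> coset_rel y y' -> coset_rel (x + y) (x' + y').
Proof.
move=> /(nsubJ y) h1 h2; have := nsubD h1 h2; congr (nsub _ _).
by rewrite goppD !gaddA gaddK.
Qed.
Lemma coset_rel_opp x x' : coset_rel x x' -> coset_rel (- x) (- x').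
Proof.
move=> /nsubN /(nsubJ (- x)); congr (nsub _ _).
by rewrite goppD !goppK !gaddA gaddK.
Qed.

Lemma coset_rel_eq x y : x = y -> coset_rel x y.
Proof. by move=> ->; apply: coset_rel_refl. Qed.

Definition quotient_group : group :=
  quot_group coset_rel_refl coset_rel_sym coset_rel_trans
    coset_rel_add coset_rel_opp
    (fun x y z => coset_rel_eq (gaddA x y z))
    (fun x => coset_rel_eq (gadd0 x)) (fun x => coset_rel_eq (gaddr0 x))
    (fun x => coset_rel_eq (gaddN x)) (fun x => coset_rel_eq (gaddrN x)).

End QuotientGroup.

Section UnitsModSquares.
Local Open Scope ring_scope.
Variable k : fieldType.

Record units := Units { uval :> k; _ : uval \is a GRing.unit }.
HB.instance Definition _ := [isSub for uval].

Fact unitsM_subproof (u v : units) : val u * val v \is a GRing.unit.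
Proof. by rewrite unitrM (valP u) (valP v). Qed.

Fact unitsV_subproof (u : units) : (val u)^-1 \is a GRing.unit.
Proof. by rewrite unitrV (valP u). Qed.

Let one : units := Units (unitr1 k).
Let inv (u : units) : units := Units (unitsV_subproof u).
Let mul (u v : units) : units := Units (unitsM_subproof u v).

Let mulA u v w : mul u (mul v w) = mul (mul u v) w.
Proof. exact/val_inj/mulrA. Qed.
Let mul1 u : mul one u = u.
Proof. exact/val_inj/mul1r. Qed.
Let mulr1 u : mul u one = u.
Proof. exact/val_inj/mulr1. Qed.
Let mulV u : mul (inv u) u = one.
Proof. exact/val_inj/mulVr/valP. Qed.
Let mulrV u : mul u (inv u) = one.
Proof. exact/val_inj/mulrV/valP. Qed.

(* Additive notation: a sum here is a product in k, see [is_square]. *)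
Definition units_group : group := Group mulA mul1 mulr1 mulV mulrV.

Definition is_square (u : units_group) : Prop :=
  exists v : units_group, u = (v + v)%grp.

Fact unitsC (u v : units_group) : (u + v = v + u)%grp.
Proof. exact/val_inj/mulrC. Qed.

Fact is_square0 : is_square 0%grp.
Proof. by exists 0%grp; rewrite gadd0. Qed.
Fact is_squareD u v : is_square u -> is_square v -> is_square (u + v)%grp.
Proof.
move=> [a ->] [b ->]; exists (a + b)%grp.
by rewrite -!gaddA; congr gadd; rewrite !gaddA (unitsC a b).
Qed.
Fact is_squareN u : is_square u -> is_square (- u)%grp.
Proof. by move=> [a ->]; exists (- a)%grp; rewrite goppD. Qed.
Fact is_squareJ u v : is_square u -> is_square (- v + u + v)%grp.
Proof. by rewrite unitsC gaddA gaddrN gadd0. Qed.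

Definition squares : normal_subgroup units_group :=
  NormalSubgroup is_square0 is_squareD is_squareN is_squareJ.

Definition units_mod_squares : group := quotient_group squares.

End UnitsModSquares.

(* A biadditive map between groups automatically factors through the
   abelianizations and has commuting values. *)
Record sqmod := SQMod {
  sq0 : group;
  sq1 : group;
  bdry : ghom sq1 sq0;
  brk : sq0 -> sq0 -> sq1;
  brkDl : forall a b c, brk (a + b) c = brk a c + brk b c;
  brkDr : forall a b c, brk a (b + c) = brk a b + brk a c;
  brk_anti : forall a b, brk a b + brk b a = 0;
  bdry_brk : forall a b, bdry (brk a b) = gcomm b a;
  brk_bdry : forall x y, brk (bdry x) (bdry y) = gcomm y x }.

Section HomotopyGroups.
Variable M : sqmod.

Definition im_bdry (a : sq0 M) : Prop := exists x : sq1 M, a = bdry M x.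

Fact im_bdry0 : im_bdry 0.
Proof. by exists 0; rewrite gfun0. Qed.
Fact im_bdryD a b : im_bdry a -> im_bdry b -> im_bdry (a + b).
Proof. by move=> [x ->] [y ->]; exists (x + y); rewrite gfunD. Qed.
Fact im_bdryN a : im_bdry a -> im_bdry (- a).
Proof. by move=> [x ->]; exists (- x); rewrite gfunN. Qed.
Fact im_bdryJ a b : im_bdry a -> im_bdry (- b + a + b).
Proof.
move=> [x ->]; exists (x + brk b (bdry M x)).
by rewrite gfunD bdry_brk /gcomm !gaddA gaddrN gadd0.
Qed.

Definition pi0 : group :=
  quotient_group (NormalSubgroup im_bdry0 im_bdryD im_bdryN im_bdryJ).

Definition ker_bdry : Type := {x : sq1 M | bdry M x = 0}.

Fact ker_addP (x y : ker_bdry) : bdry M (sval x + sval y) = 0.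
Proof. by rewrite gfunD (svalP x) (svalP y) gadd0. Qed.
Fact ker_oppP (x : ker_bdry) : bdry M (- sval x) = 0.
Proof. by rewrite gfunN (svalP x) gopp0. Qed.

Let add (x y : ker_bdry) : ker_bdry := exist _ _ (ker_addP x y).
Let opp (x : ker_bdry) : ker_bdry := exist _ _ (ker_oppP x).
Let zero : ker_bdry := exist _ 0 (gfun0 (bdry M)).

Let addA x y z : add x (add y z) = add (add x y) z.
Proof. exact/sval_inj/gaddA. Qed.
Let add0 x : add zero x = x.
Proof. by apply/sval_inj/gadd0. Qed.
Let addr0 x : add x zero = x.
Proof. by apply/sval_inj/gaddr0. Qed.
Let addN x : add (opp x) x = zero.
Proof. exact/sval_inj/gaddN. Qed.
Let addrN x : add x (opp x) = zero.
Proof. exact/sval_inj/gaddrN. Qed.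

Definition pi1 : group := Group addA add0 addr0 addN addrN.

End HomotopyGroups.

Section Presentation.

Variant degree := D0 | D1.

Variables (gen0 gen1 : Type).

Inductive term : degree -> Type :=
| Gen0 : gen0 -> term D0
| Gen1 : gen1 -> term D1
| Zero : forall i, term i
| Add : forall i, term i -> term i -> term i
| Opp : forall i, term i -> term i
| Bdry : term D1 -> term D0
| Brk : term D0 -> term D0 -> term D1.

End Presentation.

Declare Scope sqm_scope.
Delimit Scope sqm_scope with sqm.
Bind Scope sqm_scope with term.
Notation "0" := (Zero _ _ _) : sqm_scope.
Notation "u + v" := (Add u v) : sqm_scope.
Notation "- u" := (Opp u) : sqm_scope.
Notation "<| a , b |>" := (Brk a b) (format "<| a ,  b |>") : sqm_scope.
Notation "∂ u" := (Bdry u) (at level 35, right associativity) : sqm_scope.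

Arguments Gen0 {gen0 gen1} _.
Arguments Gen1 {gen0 gen1} _.

Section Presented.
Variables (gen0 gen1 : Type).
Local Notation term := (term gen0 gen1).
Variable rel : forall i, term i -> term i -> Prop.

Definition comm_term i (u v : term i) : term i := (- u + - v + u + v)%sqm.

Local Open Scope sqm_scope.

(* The least congruence containing [rel] whose quotient is a stable quadratic
   module. *)
Inductive term_eq : forall i, term i -> term i -> Prop :=
| teq_rel i (u v : term i) : rel u v -> term_eq u v
| teq_refl i (u : term i) : term_eq u u
| teq_sym i (u v : term i) : term_eq u v -> term_eq v u
| teq_trans i (u v w : term i) : term_eq u v -> term_eq v w -> term_eq u w
| teq_Add i (u u' v v' : term i) :
    term_eq u u' -> term_eq v v' -> term_eq (u + v) (u' + v')
| teq_Opp i (u u' : term i) : term_eq u u' -> term_eq (- u) (- u')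
| teq_Bdry (u u' : term D1) : term_eq u u' -> term_eq (∂ u) (∂ u')
| teq_Brk (a a' b b' : term D0) :
    term_eq a a' -> term_eq b b' -> term_eq <|a, b|> <|a', b'|>
| teq_addA i (u v w : term i) : term_eq (u + (v + w)) (u + v + w)
| teq_add0 i (u : term i) : term_eq (0 + u) u
| teq_addr0 i (u : term i) : term_eq (u + 0) u
| teq_addN i (u : term i) : term_eq (- u + u) 0
| teq_addrN i (u : term i) : term_eq (u + - u) 0
| teq_bdryD (u v : term D1) : term_eq (∂ (u + v)) (∂ u + ∂ v)
| teq_brkDl (a b c : term D0) : term_eq <|a + b, c|> (<|a, c|> + <|b, c|>)
| teq_brkDr (a b c : term D0) : term_eq <|a, b + c|> (<|a, b|> + <|a, c|>)
| teq_brk_anti (a b : term D0) : term_eq (<|a, b|> + <|b, a|>) 0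
| teq_bdry_brk (a b : term D0) : term_eq (∂ <|a, b|>) (comm_term b a)
| teq_brk_bdry (u v : term D1) : term_eq <|∂ u, ∂ v|> (comm_term v u).

Definition pres (i : degree) : group :=
  quot_group (@teq_refl i) (@teq_sym i) (@teq_trans i) (@teq_Add i) (@teq_Opp i)
    (@teq_addA i) (@teq_add0 i) (@teq_addr0 i) (@teq_addN i) (@teq_addrN i).

Definition tclass i (u : term i) : pres i := cls (@term_eq i) u.

Local Open Scope grp_scope.

Lemma tclassP i (u v : term i) : tclass u = tclass v <-> term_eq u v.
Proof. apply: clsP; [exact: teq_refl|exact: teq_sym|exact: teq_trans]. Qed.

Lemma qrepr_tclass i (u : term i) : term_eq (qrepr (tclass u)) u.
Proof. apply: qrepr_cls; [exact: teq_refl|exact: teq_sym|exact: teq_trans]. Qed.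

Lemma tclassW i (P : pres i -> Prop) : (forall u, P (tclass u)) -> forall x, P x.
Proof. by move=> h x; rewrite -(clsK x); apply: h. Qed.

Lemma tclassD i (u v : term i) : tclass (u + v)%sqm = tclass u + tclass v.
Proof. by apply/tclassP/teq_Add; apply/teq_sym/qrepr_tclass. Qed.
Lemma tclassN i (u : term i) : tclass (- u)%sqm = - tclass u.
Proof. by apply/tclassP/teq_Opp; apply/teq_sym/qrepr_tclass. Qed.

Lemma tclass_comm i (u v : term i) :
  tclass (comm_term u v) = gcomm (tclass u) (tclass v).
Proof. by rewrite !(tclassD, tclassN). Qed.

Let pbdry (x : pres D1) : pres D0 := tclass (∂ (qrepr x)).
Let pbrk (a b : pres D0) : pres D1 := tclass <|qrepr a, qrepr b|>.

Let pbdryE u : pbdry (tclass u) = tclass (∂ u).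
Proof. by apply/tclassP/teq_Bdry/qrepr_tclass. Qed.

Let pbrkE a b : pbrk (tclass a) (tclass b) = tclass <|a, b|>.
Proof. by apply/tclassP/teq_Brk; apply: qrepr_tclass. Qed.

Let pbdryD x y : pbdry (x + y) = pbdry x + pbdry y.
Proof.
elim/tclassW: x => u; elim/tclassW: y => v.
by rewrite -tclassD !pbdryE -tclassD; apply/tclassP/teq_bdryD.
Qed.

Let pbrkDl a b c : pbrk (a + b) c = pbrk a c + pbrk b c.
Proof.
elim/tclassW: a => a; elim/tclassW: b => b; elim/tclassW: c => c.
by rewrite -tclassD !pbrkE -tclassD; apply/tclassP/teq_brkDl.
Qed.

Let pbrkDr a b c : pbrk a (b + c) = pbrk a b + pbrk a c.
Proof.
elim/tclassW: a => a; elim/tclassW: b => b; elim/tclassW: c => c.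
by rewrite -tclassD !pbrkE -tclassD; apply/tclassP/teq_brkDr.
Qed.

Let pbrk_anti a b : pbrk a b + pbrk b a = 0.
Proof.
elim/tclassW: a => a; elim/tclassW: b => b.
by rewrite !pbrkE -tclassD; apply/tclassP/teq_brk_anti.
Qed.

Let pbdry_brk a b : pbdry (pbrk a b) = gcomm b a.
Proof.
elim/tclassW: a => a; elim/tclassW: b => b.
by rewrite pbrkE pbdryE -tclass_comm; apply/tclassP/teq_bdry_brk.
Qed.

Let pbrk_bdry x y : pbrk (pbdry x) (pbdry y) = gcomm y x.
Proof.
elim/tclassW: x => x; elim/tclassW: y => y.
by rewrite !pbdryE pbrkE -tclass_comm; apply/tclassP/teq_brk_bdry.
Qed.

Definition presented : sqmod :=
  @SQMod (pres D0) (pres D1) (GHom pbdryD) pbrk pbrkDl pbrkDr pbrk_anti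
    pbdry_brk pbrk_bdry.

Lemma presented_bdryE u : bdry presented (tclass u) = tclass (∂ u).
Proof. exact: pbdryE. Qed.

Lemma presented_brkE a b : @brk presented (tclass a) (tclass b) = tclass <|a, b|>.
Proof. exact: pbrkE. Qed.

End Presented.

Section UniversalProperty.
Variables (gen0 gen1 : Type).
Local Notation term := (term gen0 gen1).
Variable rel : forall i, term i -> term i -> Prop.
Variables (M : sqmod) (v0 : gen0 -> sq0 M) (v1 : gen1 -> sq1 M).

Definition sq (i : degree) : group :=
  match i with D0 => sq0 M | D1 => sq1 M end.

Fixpoint eval_term i (u : term i) : sq i :=
  match u in Defs.term _ _ j return sq j with
  | Gen0 x => v0 x
  | Gen1 x => v1 x
  | Zero j => 0
  | Add j a b => eval_term a + eval_term b
  | Opp j a => - eval_term a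
  | Bdry a => bdry M (eval_term a)
  | Brk a b => @brk M (eval_term a) (eval_term b)
  end.

Hypothesis eval_rel : forall i (u v : term i), rel u v -> eval_term u = eval_term v.

Lemma eval_term_eq i (u v : term i) : term_eq rel u v -> eval_term u = eval_term v.
Proof.
elim=> {i u v} /=.
- exact: eval_rel.
- by [].
- by [].
- by move=> i u v w _ -> _ ->.
- by move=> i u u' v v' _ -> _ ->.
- by move=> i u u' _ ->.
- by move=> u u' _ ->.
- by move=> a a' b b' _ -> _ ->.
- by move=> i u v w; apply: gaddA.
- by move=> i u; apply: gadd0.
- by move=> i u; apply: gaddr0.
- by move=> i u; apply: gaddN.
- by move=> i u; apply: gaddrN.
- by move=> u v; apply: gfunD.
- by move=> a b c; apply: brkDl.
- by move=> a b c; apply: brkDr.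
- by move=> a b; apply: brk_anti.
- by move=> a b; apply: bdry_brk.
- by move=> u v; apply: brk_bdry.
Qed.

Let pmap i (x : pres rel i) : sq i := eval_term (qrepr x).

Let pmapE i (u : term i) : pmap (tclass rel u) = eval_term u.
Proof. exact/eval_term_eq/qrepr_tclass. Qed.

Let pmapD i (x y : pres rel i) : pmap (x + y) = pmap x + pmap y.
Proof.
by elim/tclassW: x => u; elim/tclassW: y => v; rewrite -tclassD !pmapE.
Qed.

Definition is_extension (f : forall i, ghom (pres rel i) (sq i)) : Prop :=
  [/\ forall x, f D0 (tclass rel (Gen0 x)) = v0 x,
      forall x, f D1 (tclass rel (Gen1 x)) = v1 x,
      forall x, f D0 (bdry (presented rel) x) = bdry M (f D1 x)
    & forall a b, f D1 (@brk (presented rel) a b) = @brk M (f D0 a) (f D0 b)].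

Lemma presented_universal :
  exists f, is_extension f /\
    forall g, is_extension g -> forall i x, g i x = f i x.
Proof.
exists (fun i => GHom (@pmapD i)); split=> [|g [g0 g1 gb gk] i].
  split.
  - by move=> x; rewrite /= pmapE.
  - by move=> x; rewrite /= pmapE.
  - by elim/tclassW=> u; rewrite presented_bdryE /= !pmapE.
  - by elim/tclassW=> a; elim/tclassW=> b; rewrite presented_brkE /= !pmapE.
elim/tclassW=> u; rewrite /= pmapE.
elim: u => /= [//|//|j|j a IHa b IHb|j a IHa|a IHa|a IHa b IHb].
- exact: gfun0.
- by rewrite tclassD gfunD IHa IHb.
- by rewrite tclassN gfunN IHa.
- by rewrite -IHa -gb presented_bdryE.
- by rewrite -IHa -IHb -gk presented_brkE.
Qed.

End UniversalProperty.

Local Open Scope ring_scope.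

Record addcat := AddCat {
  obj :> Type;
  hom : obj -> obj -> zmodType;
  idm : forall X, hom X X;
  cmp : forall X Y Z, hom Y Z -> hom X Y -> hom X Z;
  cmpA : forall X Y Z W (h : hom Z W) (g : hom Y Z) (f : hom X Y),
    cmp h (cmp g f) = cmp (cmp h g) f;
  cmp1m : forall X Y (f : hom X Y), cmp (idm Y) f = f;
  cmpm1 : forall X Y (f : hom X Y), cmp f (idm X) = f;
  cmpDl : forall X Y Z (g g' : hom Y Z) (f : hom X Y),
    cmp (g + g') f = cmp g f + cmp g' f;
  cmpDr : forall X Y Z (g : hom Y Z) (f f' : hom X Y),
    cmp g (f + f') = cmp g f + cmp g f';
  zob : obj;
  idm_zob : idm zob = 0;
  dsum : obj -> obj -> obj;
  in1 : forall X Y, hom X (dsum X Y);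
  in2 : forall X Y, hom Y (dsum X Y);
  pr1 : forall X Y, hom (dsum X Y) X;
  pr2 : forall X Y, hom (dsum X Y) Y;
  pr1_in1 : forall X Y, cmp (pr1 X Y) (in1 X Y) = idm X;
  pr2_in2 : forall X Y, cmp (pr2 X Y) (in2 X Y) = idm Y;
  pr1_in2 : forall X Y, cmp (pr1 X Y) (in2 X Y) = 0;
  pr2_in1 : forall X Y, cmp (pr2 X Y) (in1 X Y) = 0;
  in_pr : forall X Y,
    cmp (in1 X Y) (pr1 X Y) + cmp (in2 X Y) (pr2 X Y) = idm (dsum X Y) }.

Arguments idm {a} X.
Arguments zob {a}.
Arguments in1 {a X Y}.
Arguments in2 {a X Y}.
Arguments pr1 {a X Y}.
Arguments pr2 {a X Y}.

Declare Scope cat_scope.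
Delimit Scope cat_scope with cat.
Notation "g ∘ f" := (cmp g f) (at level 40, left associativity) : cat_scope.
Notation "X ⊕ Y" := (dsum X Y) (at level 50, left associativity) : cat_scope.
Local Open Scope cat_scope.

Definition is_iso (C : addcat) (X Y : C) (f : hom X Y) : Prop :=
  exists g : hom Y X, g ∘ f = idm X /\ f ∘ g = idm Y.

Definition to_sum (C : addcat) (W X Y : C) (u : hom W X) (v : hom W Y) :
  hom W (X ⊕ Y) := in1 ∘ u + in2 ∘ v.

Definition of_sum (C : addcat) (X Y Z : C) (u : hom X Z) (v : hom Y Z) :
  hom (X ⊕ Y) Z := u ∘ pr1 + v ∘ pr2.

Record suspcat := SuspCat {
  base :> addcat;
  susp : base -> base;
  smap : forall X Y : base, hom X Y -> hom (susp X) (susp Y);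
  smap1 : forall X : base, smap (idm X) = idm (susp X);
  smapM : forall (X Y Z : base) (g : hom Y Z) (f : hom X Y),
    smap (g ∘ f) = smap g ∘ smap f;
  smapD : forall (X Y : base) (f g : hom X Y), smap (f + g) = smap f + smap g;
  smap_bij : forall X Y : base, bijective (@smap X Y);
  susp_surj : forall Y : base, exists X : base,
    exists f : hom (susp X) Y, is_iso f }.

Notation Σ := (@susp _).

Section Triangles.
Variable C : suspcat.

(* Composites are not required to vanish; see [is_triangle]. *)
Record tri := Tri {
  tX : C; tY : C; tC : C;
  tf : hom tX tY; ti : hom tY tC; tq : hom tC (Σ tX) }.

Definition is_triangle (T : tri) : Prop :=
  [/\ ti T ∘ tf T = 0, tq T ∘ ti T = 0 & smap (tf T) ∘ tq T = 0].

Definition tri_mor (T T' : tri) (a : hom (tX T) (tX T'))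
    (b : hom (tY T) (tY T')) (c : hom (tC T) (tC T')) : Prop :=
  [/\ b ∘ tf T = tf T' ∘ a, c ∘ ti T = ti T' ∘ b
    & smap a ∘ tq T = tq T' ∘ c].

Definition tri_iso (T T' : tri) : Prop :=
  exists a b c, [/\ @tri_mor T T' a b c, is_iso a, is_iso b & is_iso c].

Definition hom_sum (X Y X' Y' : C) (f : hom X Y) (g : hom X' Y') :
  hom (X ⊕ X') (Y ⊕ Y') := to_sum (f ∘ pr1) (g ∘ pr2).

(* The last map uses the canonical isomorphism from ΣX ⊕ ΣX' to Σ(X ⊕ X'). *)
Definition tri_sum (T T' : tri) : tri :=
  Tri (hom_sum (tf T) (tf T')) (hom_sum (ti T) (ti T'))
      (of_sum (smap in1) (smap in2) ∘ hom_sum (tq T) (tq T')).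

Inductive contractible : tri -> Prop :=
| contr1 (A : C) : contractible (Tri (idm A) (0 : hom A zob) 0)
| contr2 (B : C) : contractible (Tri (0 : hom zob B) (idm B) 0)
| contr3 (A : C) :
    contractible (Tri (0 : hom A zob) (0 : hom zob (Σ A)) (idm (Σ A)))
| contr_sum (T T' : tri) :
    contractible T -> contractible T' -> contractible (tri_sum T T').

(* [oF], [oG], [oH] are the third objects of the triangles on f, g, gf. *)
Record octdata := OctData {
  oX : C; oY : C; oZ : C; oF : C; oG : C; oH : C;
  o_f : hom oX oY; o_g : hom oY oZ;
  oif : hom oY oF; oqf : hom oF (Σ oX);
  oig : hom oZ oG; oqg : hom oG (Σ oY);
  oih : hom oZ oH; oqh : hom oH (Σ oX);
  ogbar : hom oF oH; ofbar : hom oH oG }.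

Section Octahedron.
Variable O : octdata.

Definition tri_f : tri := Tri (o_f O) (oif O) (oqf O).
Definition tri_g : tri := Tri (o_g O) (oig O) (oqg O).
Definition tri_gf : tri := Tri (o_g O ∘ o_f O) (oih O) (oqh O).
Definition tri_tilde : tri := Tri (ogbar O) (ofbar O) (smap (oif O) ∘ oqg O).

Definition octahedral_diagram : Prop :=
  [/\ is_triangle tri_f, is_triangle tri_g, is_triangle tri_gf
    & is_triangle tri_tilde]
  /\ [/\ ogbar O ∘ oif O = oih O ∘ o_g O, oqh O ∘ ogbar O = oqf O,
         ofbar O ∘ oih O = oig O & oqg O ∘ ofbar O = smap (o_f O) ∘ oqh O].

Definition tri_special1 : tri :=
  Tri (to_sum (o_g O) (- oif O)) (of_sum (oih O) (ogbar O)) (oqg O ∘ ofbar O).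

Definition tri_special2 : tri :=
  Tri (to_sum (oqh O) (- ofbar O)) (of_sum (smap (o_f O)) (oqg O))
      (smap (ogbar O ∘ oif O)).

End Octahedron.

Section Distinguished.
Variable dist : tri -> Prop.

Definition octahedron (O : octdata) : Prop :=
  octahedral_diagram O
  /\ [/\ dist (tri_f O), dist (tri_g O), dist (tri_gf O) & dist (tri_tilde O)].

Definition special_octahedron (O : octdata) : Prop :=
  [/\ octahedron O, dist (tri_special1 O) & dist (tri_special2 O)].

Definition virtual (T : tri) : Prop :=
  is_triangle T /\
  exists (K : tri) (X Y Z : C) (f : hom X Y) (i : hom Y Z) (q : hom Z (Σ X)),
    [/\ contractible K, tri_iso (tri_sum T K) (Tri f i q),
        exists f', dist (Tri f' i q), exists i', dist (Tri f i' q)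
      & exists q', dist (Tri f i q')].

Definition virtual_octahedron (O : octdata) : Prop :=
  octahedral_diagram O
  /\ [/\ virtual (tri_f O), virtual (tri_g O), virtual (tri_gf O)
       & virtual (tri_tilde O)].

Record triangulated : Prop := Triangulated {
  tr_iso : forall T T', tri_iso T T' -> dist T -> dist T';
  tr_id : forall X : C, dist (Tri (idm X) (0 : hom X zob) 0);
  tr_ext : forall (X Y : C) (f : hom X Y),
    exists (Z : C) (i : hom Y Z) (q : hom Z (Σ X)), dist (Tri f i q);
  tr_rot : forall (X Y Z : C) (f : hom X Y) (i : hom Y Z) (q : hom Z (Σ X)),
    dist (Tri f i q) <-> dist (Tri i q (- smap f));
  tr_mor : forall (T T' : tri) (a : hom (tX T) (tX T')) (b : hom (tY T) (tY T')),
    dist T -> dist T' -> b ∘ tf T = tf T' ∘ a -> exists c, tri_mor a b c;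
  tr_oct : forall (X Y Z F G H : C) (f : hom X Y) (g : hom Y Z)
      (i_f : hom Y F) (q_f : hom F (Σ X)) (i_g : hom Z G) (q_g : hom G (Σ Y))
      (i_gf : hom Z H) (q_gf : hom H (Σ X)),
    dist (Tri f i_f q_f) -> dist (Tri g i_g q_g) -> dist (Tri (g ∘ f) i_gf q_gf) ->
    exists (gbar : hom F H) (fbar : hom H G),
      octahedron (OctData f g i_f q_f i_g q_g i_gf q_gf gbar fbar) }.

(* Kb: Breuning's K-theory; Kd, Kv: Neeman's K-theories of distinguished and of
   virtual triangles. *)
Variant flavour := Kb | Kd | Kv.

Definition sharp_triangle (s : flavour) : tri -> Prop :=
  match s with Kb | Kd => dist | Kv => virtual end.

Definition sharp_octahedron (s : flavour) : octdata -> Prop :=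
  match s with
  | Kb => octahedron | Kd => special_octahedron | Kv => virtual_octahedron
  end.

Section DStar.
Variable s : flavour.

Variant dgen1 : Type :=
| GenIso (X X' : C) (h : hom X X') of is_iso h
| GenTri (T : tri) of sharp_triangle s T.

Local Notation term := (term C dgen1).
Local Notation "[[ X ]]" := (@Gen0 C dgen1 X) (format "[[ X ]]").

Definition iso_term (X X' : C) (h : hom X X') (hh : is_iso h) : term D1 :=
  Gen1 (GenIso hh).
Definition tri_term (T : tri) (hT : sharp_triangle s T) : term D1 :=
  Gen1 (GenTri hT).

(* The action c^a of degree 0 on degree 1. *)
Definition act_term (c : term D1) (a : term D0) : term D1 :=
  (c + <|a, ∂ c|>)%sqm.

Local Open Scope sqm_scope.

Inductive dstar_rel : forall i, term i -> term i -> Prop :=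
| drel_bdry_iso (X X' : C) (h : hom X X') (hh : is_iso h) :
    dstar_rel (∂ (iso_term hh)) (- [[X']] + [[X]])
| drel_bdry_tri (T : tri) (hT : sharp_triangle s T) :
    dstar_rel (∂ (tri_term hT)) (- [[tY T]] + [[tC T]] + [[tX T]])
| drel_zob : dstar_rel [[zob]] 0
| drel_id (X : C) (h1 : is_iso (idm X)) : dstar_rel (iso_term h1) 0
| drel_tri1 (X : C)
    (hT : sharp_triangle s (Tri (idm X) (0%R : hom X zob) 0%R)) :
    dstar_rel (tri_term hT) 0
| drel_tri2 (X : C)
    (hT : sharp_triangle s (Tri (0%R : hom zob X) (idm X) 0%R)) :
    dstar_rel (tri_term hT) 0
| drel_cmp (X Y Z : C) (k : hom Y Z) (h : hom X Y)
    (hk : is_iso k) (hh : is_iso h) (hkh : is_iso (k ∘ h)%cat) :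
    dstar_rel (iso_term hkh) (iso_term hk + iso_term hh)
| drel_tri_iso (T T' : tri) (hT : sharp_triangle s T) (hT' : sharp_triangle s T')
    (a : hom (tX T) (tX T')) (b : hom (tY T) (tY T')) (c : hom (tC T) (tC T'))
    (ha : is_iso a) (hb : is_iso b) (hc : is_iso c) :
    tri_mor a b c ->
    dstar_rel (iso_term ha + act_term (iso_term hc) [[tX T]])
              (- tri_term hT' + iso_term hb + tri_term hT)
| drel_oct (O : octdata)
    (hf : sharp_triangle s (tri_f O)) (hg : sharp_triangle s (tri_g O))
    (hgf : sharp_triangle s (tri_gf O)) (ht : sharp_triangle s (tri_tilde O)) :
    sharp_octahedron s O ->
    dstar_rel (tri_term hg + tri_term hf)
              (tri_term hgf + act_term (tri_term ht) [[oX O]])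
| drel_brk (X Y : C)
    (h1 : sharp_triangle s (Tri (in1 : hom X (X ⊕ Y)) pr2 0%R))
    (h2 : sharp_triangle s (Tri (in2 : hom Y (X ⊕ Y)) pr1 0%R)) :
    dstar_rel <|[[X]], [[Y]]|> (- tri_term h2 + tri_term h1).

Definition dstar : sqmod := presented dstar_rel.

Definition K0 : group := pi0 dstar.
Definition K1 : group := pi1 dstar.

End DStar.
End Distinguished.
End Triangles.

Section FreeModules.
Variable R : comNzRingType.
Implicit Types U V W : vectType R.
Local Open Scope lfun_scope.

Definition pair0 U V (u : U) : U * V := (u, 0).
Definition pair0r U V (v : V) : U * V := (0, v).

Fact pair0_linear U V : linear (@pair0 U V).
Proof. by move=> a u v; congr pair; rewrite /= scaler0 addr0. Qed.
HB.instance Definition _ U V :=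
  GRing.isLinear.Build R U (U * V)%type _ (@pair0 U V) (@pair0_linear U V).

Fact pair0r_linear U V : linear (@pair0r U V).
Proof. by move=> a u v; congr pair; rewrite /= scaler0 addr0. Qed.
HB.instance Definition _ U V :=
  GRing.isLinear.Build R V (U * V)%type _ (@pair0r U V) (@pair0r_linear U V).

Definition fst_lfun U V : 'Hom((U * V)%type, U) := linfun fst.
Definition snd_lfun U V : 'Hom((U * V)%type, V) := linfun snd.
Definition inl_lfun U V : 'Hom(U, (U * V)%type) := linfun (@pair0 U V).
Definition inr_lfun U V : 'Hom(V, (U * V)%type) := linfun (@pair0r U V).

Fact id_lfun_rV0 : \1 = 0 :> 'End('rV[R]_0).
Proof. by apply/lfunP => u; apply/matrixP => i []. Qed.

Fact fst_inl U V : fst_lfun U V \o inl_lfun U V = \1.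
Proof. by apply/lfunP => u; rewrite !lfunE /= !lfunE. Qed.
Fact snd_inr U V : snd_lfun U V \o inr_lfun U V = \1.
Proof. by apply/lfunP => u; rewrite !lfunE /= !lfunE. Qed.
Fact fst_inr U V : fst_lfun U V \o inr_lfun U V = 0.
Proof. by apply/lfunP => u; rewrite !lfunE /= !lfunE. Qed.
Fact snd_inl U V : snd_lfun U V \o inl_lfun U V = 0.
Proof. by apply/lfunP => u; rewrite !lfunE /= !lfunE. Qed.
Fact inl_fst_inr_snd U V :
  (inl_lfun U V \o fst_lfun U V) + (inr_lfun U V \o snd_lfun U V) = \1.
Proof.
apply/lfunP => -[u v]; do !rewrite lfunE /=.
by congr pair; rewrite /= ?addr0 ?add0r.
Qed.

(* A [vectType R] over a ring is a finitely generated free module. *)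
Definition free_modules : addcat := @AddCat (vectType R)
  (fun U V => 'Hom(U, V)) (fun U => \1) (fun U V W g f => g \o f)
  (fun U V W X h g f => comp_lfunA h g f)
  (fun U V f => comp_lfun1l f) (fun U V f => comp_lfun1r f)
  (fun U V W g g' f => comp_lfunDl g g' f)
  (fun U V W g f f' => comp_lfunDr g f f')
  'rV[R]_0 id_lfun_rV0 (fun U V => (U * V)%type)
  inl_lfun inr_lfun fst_lfun snd_lfun fst_inl snd_inr fst_inr snd_inl
  inl_fst_inr_snd.

Fact free_susp_surj (U : free_modules) :
  exists V : free_modules, exists f : hom V U, is_iso f.
Proof. by exists U, (idm U), (idm U); rewrite !cmp1m. Qed.

Definition free_modules_susp : suspcat := @SuspCat free_modules
  id (fun U V f => f) (fun U => erefl) (fun U V W g f => erefl)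
  (fun U V f g => erefl) (fun U V => Bijective (fun f => erefl) (fun f => erefl))
  free_susp_surj.

Definition mul_end (a : R) : 'End(R^o) := a *: \1.

Definition mul_triangle (a : R) : tri free_modules_susp :=
  @Tri free_modules_susp R^o R^o R^o (mul_end a) (mul_end a) (mul_end a).

(* In [idealr_closed], ideals are proper. *)
Definition maximal_ideal (I : {pred R}) : Prop :=
  idealr_closed I /\
  forall J : {pred R}, idealr_closed J -> {subset I <= J} -> I =i J.

Definition local_with_maximal_ideal (I : {pred R}) : Prop :=
  maximal_ideal I /\ forall J : {pred R}, maximal_ideal J -> J =i I.

Definition principal_ideal (a : R) : {pred R} :=
  [pred x | `[< exists b : R, x = b * a >] ].

End FreeModules.

(* Main.v *)
From HB Require Import structures.
From mathcomp Require Import all_boot all_algebra.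
From mathcomp Require Import boolp.
Require Import Defs.

Set Implicit Arguments.
Unset Strict Implicit.
Unset Printing Implicit Defensive.

Import GRing.Theory VectorInternalTheory.
Local Open Scope ring_scope.
Local Open Scope cat_scope.

(** The two halves of the theorem are independent.

    Vanishing.  Multiplication by eps is a distinguished triangle (eps, eps, eps)
    on every object X, and the boundary of its class [eps_cl X] is the generator
    of X.  So every object is a boundary, whence K_0 = 0 for the three flavours.
    An isomorphism h : X -> X' is an isomorphism of these triangles, and the
    relation that it yields says that the class of h is
    - eps_cl X' + eps_cl X.  Suppose that, likewise, the class of every
    distinguished triangle X -> Y -> C -> X is its Euler class
    - eps_cl Y + eps_cl C + eps_cl X.  Then sending the generator of X to
    eps_cl X defines a left inverse of the boundary map, and K_1 = 0
    ([K1_trivial]).  The difference of the two classes, [defect], lies in the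
    kernel of the boundary, hence is central; it is invariant under isomorphism
    and additive on octahedra.  Three families of octahedra, [oct_add], [oct_eps]
    and [oct_rot], show that the triangles of defect zero contain the split ones
    and are stable under rotation and under the addition of a triangle
    0 -> B -> B -> 0.  Up to a change of bases every map is a sum of an identity,
    of eps and of 0 ([smith_ind]), and a distinguished triangle is determined by
    its first map ([cone_unique]), so these are all the distinguished triangles.
    The three families consist of special octahedra: the same argument therefore
    serves both flavours of distinguished triangles.

    Surjection.  Forgetting the grading, a virtual triangle is a free module T
    with an endomorphism d such that ker d = im d.  In a suitable basis, d is the
    sum of a disk (u, v) |-> (0, u) and of eps D, with D invertible modulo eps.
    The reduction of D is the Bockstein operator on the homology of d modulo eps,
    so its determinant in the units of k depends on (T, d) only ([hdet_uniq]).
    In an extension of differential modules this determinant is multiplicative up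
    to a square ([hdet_cone]): the image of the connecting homomorphism in
    homology contributes to both ends.  Given an octahedral diagram, the cones of
    the morphisms from the triangle on f to that on gf, and from the triangle on
    g to the fourth one, become equal once a disk is removed from each: both are
    the differential module of the first of the two triangles in the definition
    of a special octahedron.  Hence the square class of the determinant is
    additive on virtual octahedra ([octahedron_hdet]), and it defines a
    homomorphism on K_1.  It is onto because (eps, eps, w eps) is a virtual
    triangle with determinant w ([K1_virtual]). *)

(** * The residue field *)

Section ResidueField.
Variables (R : comNzRingType) (eps : R) (k : fieldType) (res : {rmorphism R -> k}).
Hypotheses (eps_neq0 : eps != 0) (eps_sqr : eps ^+ 2 = 0).
Hypothesis res_surj : forall y : k, exists x : R, res x = y.
Hypothesis res_ker : forall x : R, (res x == 0) = (x \in principal_ideal eps).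
Hypothesis k_char2 : 2%N \in [pchar k].

Lemma eps_eps : eps * eps = 0.
Proof. by rewrite -expr2. Qed.

Lemma res0P x : reflect (exists b, x = b * eps) (res x == 0).
Proof. by rewrite res_ker; apply: asboolP. Qed.

Lemma res_eps : res eps = 0.
Proof. by apply/eqP/res0P; exists 1; rewrite mul1r. Qed.

(** The inverse modulo eps is corrected by 1 - b eps, as eps squares to zero. *)
Lemma res_neq0_inv x : res x != 0 -> exists y, x * y = 1.
Proof.
move=> x0; have [y ry] := res_surj (res x)^-1.
have /eqP/res0P[b bE] : res (x * y - 1) = 0.
  by rewrite rmorphB rmorphM rmorph1 ry divff // subrr.
exists (y * (1 - b * eps)); rewrite mulrA.
have -> : x * y = 1 + b * eps by rewrite -bE addrC subrK.
by rewrite mulrDl mul1r mulrBr mulr1 -mulrA (mulrCA eps) eps_eps !mulr0 subr0 subrK.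
Qed.

(** The annihilator of eps is (eps), an element outside (eps) being invertible.
    So division by eps is well defined modulo eps ([eps_mx_eq]). *)
Lemma eps_mul_eq0 x : eps * x = 0 -> res x = 0.
Proof.
move=> ex; apply/eqP; apply: contraT => /res_neq0_inv[y xy].
by move: eps_neq0; rewrite -(mulr1 eps) -xy mulrA ex mul0r eqxx.
Qed.

Lemma char2_add (x : k) : x + x = 0.
Proof. by rewrite -mulr2n -mulr_natr (pcharf0 k_char2) mulr0. Qed.

Lemma char2_opp (x : k) : - x = x.
Proof. by apply/eqP; rewrite -subr_eq0 -opprD char2_add oppr0. Qed.

(** 2 lies in (eps) because the residue characteristic is 2.  So signs disappear
    in front of eps, although R itself may have characteristic 4. *)
Lemma eps_add : eps + eps = 0.
Proof.
have /eqP/res0P[b bE] : res (1 + 1) = 0 by rewrite rmorphD rmorph1 char2_add.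
by rewrite -(mulr1 eps) -mulrDr bE mulrCA eps_eps mulr0.
Qed.

Lemma eps_opp : - eps = eps.
Proof. by apply/eqP; rewrite -subr_eq0 -opprD eps_add oppr0. Qed.

Section EpsModule.
Variable V : lmodType R.
Implicit Types x y : V.

Lemma eps_scale2 x : eps *: (eps *: x) = 0.
Proof. by rewrite scalerA eps_eps scale0r. Qed.

Lemma eps_scaleN x : - (eps *: x) = eps *: x.
Proof. by rewrite -scaleNr eps_opp. Qed.

Lemma eps_scaleD x : eps *: x + eps *: x = 0.
Proof. by rewrite -scalerDl eps_add scale0r. Qed.

End EpsModule.

Local Notation "A ^r" := (map_mx res A) (at level 2, format "A ^r").

Lemma lift_mx m n (A : 'M[k]_(m, n)) : exists B : 'M[R]_(m, n), B^r = A.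
Proof.
have [s sE] : exists s : k -> R, cancel s res.
  by exists (fun y => sval (cid (res_surj y))) => y; case: cid.
by exists (map_mx s A); apply/matrixP => i j; rewrite !mxE.
Qed.

Lemma res_mx0 m n (A : 'M[R]_(m, n)) : A^r = 0 -> exists B, A = eps *: B.
Proof.
move=> A0.
have h i j : exists b, A i j = b * eps.
  by apply/res0P; move/matrixP/(_ i j): A0; rewrite !mxE => ->.
exists (\matrix_(i, j) sval (cid (h i j))); apply/matrixP => i j.
by rewrite !mxE mulrC; case: cid.
Qed.

Lemma eps_mx_eq m n (A B : 'M[R]_(m, n)) : eps *: A = eps *: B -> A^r = B^r.
Proof.
move=> AB; apply/eqP; rewrite -subr_eq0 -map_mxB; apply/eqP/matrixP => i j.
rewrite mxE [RHS]mxE; apply: eps_mul_eq0; move/matrixP/(_ i j): AB.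
by rewrite !mxE mulrBr => ->; rewrite subrr.
Qed.

Lemma res_mx_eps m n (A : 'M[R]_(m, n)) : (eps *: A)^r = 0.
Proof. by rewrite map_mxZ /= res_eps scale0r. Qed.

Lemma eps_mx_res m n (A B : 'M[R]_(m, n)) : A^r = B^r -> eps *: A = eps *: B.
Proof.
move=> AB; apply/eqP; rewrite -subr_eq0 -scalerBr.
have [C ->] : exists C, A - B = eps *: C by apply: res_mx0; rewrite map_mxB AB subrr.
by rewrite eps_scale2.
Qed.

Lemma res_unitmx_inv n (A : 'M[R]_n) :
  A^r \in unitmx -> exists B, A *m B = 1%:M /\ B *m A = 1%:M.
Proof.
rewrite unitmxE det_map_mx unitfE => /res_neq0_inv[y dy].
exists (y *: \adj A); rewrite -scalemxAl -scalemxAr mul_mx_adj mul_adj_mx.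
by rewrite scale_scalar_mx mulrC dy.
Qed.

Definition inv_mx n (L L' : 'M[R]_n) : Prop := L *m L' = 1%:M /\ L' *m L = 1%:M.

(** Smith normal form as an induction principle: since (eps) is annihilated by
    eps, Gaussian elimination over k, lifted to R, is applied once to the matrix
    and once more to the block that is divisible by eps. *)
Lemma smith_ind (P : forall m n, 'M[R]_(m, n) -> Prop) :
  (forall m n (L L' : 'M[R]_m) (U U' : 'M[R]_n) F,
     inv_mx L L' -> inv_mx U U' -> P m n F -> P m n (L *m F *m U)) ->
  (forall r s m n, P (r + (s + m))%N (r + (s + n))%N
     (block_mx 1%:M 0 0 (eps *: pid_mx s))) ->
  forall m n F, P m n F.
Proof.
move=> Peq Pbase.
have inv1 n : inv_mx 1%:M (1%:M : 'M[R]_n) by split; rewrite mulmx1.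
have invD m n (L L' : 'M[R]_m) (U U' : 'M[R]_n) :
    inv_mx L L' -> inv_mx U U' -> inv_mx (block_mx L 0 0 U) (block_mx L' 0 0 U').
  move=> [LL' L'L] [UU' U'U].
  by split; rewrite mulmx_block !mul0mx !mulmx0 !addr0 !add0r ?LL' ?L'L ?UU' ?U'U
     -scalar_mx_block.
have Pred r m n (Z : 'M[R]_(m, n)) : P (r + m)%N (r + n)%N (block_mx 1%:M 0 0 (eps *: Z)).
  have [s sE] : exists s, \rank Z^r = s by eexists.
  have [sm sn] : (s <= m)%N /\ (s <= n)%N by rewrite -sE rank_leq_row rank_leq_col.
  have [m2 mE] : exists m2, m = (s + m2)%N by exists (m - s)%N; rewrite subnKC.
  have [n2 nE] : exists n2, n = (s + n2)%N by exists (n - s)%N; rewrite subnKC.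
  subst m n; have := mulmx_ebase Z^r; rewrite sE.
  have := row_ebase_unit Z^r; have := col_ebase_unit Z^r.
  have [L <-] := lift_mx (col_ebase Z^r).
  have [U <-] := lift_mx (row_ebase Z^r).
  move=> /res_unitmx_inv[L' Linv].
  move=> /res_unitmx_inv[U' Uinv] ZE.
  have -> : eps *: Z = L *m (eps *: pid_mx s) *m U.
    rewrite -scalemxAr -scalemxAl; apply: eps_mx_res.
    by rewrite !map_mxM map_pid_mx -ZE.
  have -> : block_mx (1%:M : 'M[R]_r) 0 0 (L *m (eps *: pid_mx s) *m U) =
     block_mx 1%:M 0 0 L *m block_mx 1%:M 0 0 (eps *: pid_mx s) *m
     block_mx (1%:M : 'M[R]_r) 0 0 U.
    by rewrite !mulmx_block !(mul0mx, mulmx0, addr0, add0r, mul1mx, mulmx1).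
  apply: Peq (Pbase _ _ _ _); [exact: invD (inv1 r) Linv|exact: invD (inv1 r) Uinv].
move=> m n F; have [r rE] : exists r, \rank F^r = r by eexists.
have [rm rn] : (r <= m)%N /\ (r <= n)%N by rewrite -rE rank_leq_row rank_leq_col.
have [m1 mE] : exists m1, m = (r + m1)%N by exists (m - r)%N; rewrite subnKC.
have [n1 nE] : exists n1, n = (r + n1)%N by exists (n - r)%N; rewrite subnKC.
subst m n; have := mulmx_ebase F^r; rewrite rE.
have := row_ebase_unit F^r; have := col_ebase_unit F^r.
have [L <-] := lift_mx (col_ebase F^r).
have [U <-] := lift_mx (row_ebase F^r).
move=> /res_unitmx_inv[L' Linv].
move=> /res_unitmx_inv[U' Uinv] FE.
pose F1 := L' *m F *m U'.
have -> : F = L *m F1 *m U.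
  by rewrite /F1 !mulmxA Linv.1 mul1mx -mulmxA Uinv.2 mulmx1.
apply: (Peq _ _ _ _ _ _ _ Linv Uinv).
have : F1^r = pid_mx r.
  rewrite /F1 !map_mxM -FE !mulmxA -map_mxM Linv.2 map_mx1 mul1mx.
  by rewrite -mulmxA -map_mxM Uinv.1 map_mx1 mulmx1.
rewrite -[F1]submxK pid_mx_block map_block_mx.
move: (ulsubmx F1) (ursubmx F1) (dlsubmx F1) (drsubmx F1) => p X Y Z.
move=> /eq_block_mx[p1 /res_mx0[X' ->] /res_mx0[Y' ->]
  /res_mx0[Z' ->]].
have [p' pinv] : exists p', inv_mx p p'.
  by apply: res_unitmx_inv; rewrite p1 unitmx1.
(* The blocks next to p are eliminated; this changes the last block by a multiple
   of eps * eps only. *)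
have -> : block_mx p (eps *: X') (eps *: Y') (eps *: Z') =
   (block_mx 1%:M 0 (eps *: Y' *m p') 1%:M *m block_mx p 0 0 1%:M) *m
   block_mx 1%:M 0 0 (eps *: Z') *m block_mx 1%:M (p' *m (eps *: X')) 0 1%:M.
  rewrite !mulmx_block !(mul0mx, mulmx0, addr0, add0r, mul1mx, mulmx1).
  rewrite mulmxA pinv.1 mul1mx -!(mulmxA _ p' p) pinv.2 mulmx1.
  rewrite -!scalemxAr -!scalemxAl.
  by rewrite eps_scale2 add0r.
apply: (Peq _ _ _ (block_mx p' 0 0 1%:M *m block_mx 1%:M 0 (- (eps *: Y' *m p')) 1%:M)
   _ (block_mx 1%:M (- (p' *m (eps *: X'))) 0 1%:M)); last exact: Pred.
  set x := eps *: Y' *m p'; set D := block_mx p _ _ _; set D' := block_mx p' _ _ _.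
  have [DD' D'D] : inv_mx D D' by apply: invD.
  have N1 : block_mx 1%:M 0 x 1%:M *m block_mx 1%:M 0 (- x) (1%:M : 'M[R]_m1) = 1%:M.
    by rewrite mulmx_block !(mul0mx, mulmx0, addr0, add0r, mul1mx, mulmx1) subrr -scalar_mx_block.
  have N2 : block_mx 1%:M 0 (- x) 1%:M *m block_mx 1%:M 0 x (1%:M : 'M[R]_m1) = 1%:M.
    by rewrite mulmx_block !(mul0mx, mulmx0, addr0, add0r, mul1mx, mulmx1) addNr -scalar_mx_block.
  split; first by rewrite mulmxA -(mulmxA _ D) DD' mulmx1.
  by rewrite mulmxA -(mulmxA D') N2 mulmx1.
by split; rewrite mulmx_block !(mul0mx, mulmx0, addr0, add0r, mul1mx, mulmx1)
  ?subrr ?addNr -scalar_mx_block.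
Qed.

(** * Differential modules and their homology determinant *)

(** Bundles a proof of linearity, for functions defined inside a proof. *)
Definition lin (V W : lmodType R) (f : V -> W) (fP : linear f) : {linear V -> W} :=
  HB.pack f (GRing.isLinear.Build R V W *:%R f fP).

Definition dm_iso (T T' : lmodType R) (d : T -> T) (d' : T' -> T') : Prop :=
  exists (g : {linear T -> T'}) (g' : T' -> T),
    [/\ cancel g g', cancel g' g & forall x, g (d x) = d' (g x)].

Lemma dm_iso_sym (T T' : lmodType R) (d : T -> T) (d' : T' -> T') :
  dm_iso d d' -> dm_iso d' d.
Proof.
move=> [g [g' [gK g'K gd]]]; exists (lin (can2_linear gK g'K)), g; split=> //.
by move=> x; rewrite -{1}(g'K x) -gd /= gK.
Qed.

Lemma dm_iso_trans (T T' T'' : lmodType R) (d : T -> T) (d' : T' -> T')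
    (d'' : T'' -> T'') : dm_iso d d' -> dm_iso d' d'' -> dm_iso d d''.
Proof.
move=> [g [g' [gK g'K gd]]] [h [h' [hK h'K hd]]].
exists (h \o g : {linear _ -> _}), (g' \o h'); split; first exact: can_comp.
  exact: can_comp.
by move=> x /=; rewrite gd hd.
Qed.

(** The sum of the disk on U, an acyclic summand, and of the minimal part, on
    which the differential is divisible by eps.  U is an arbitrary module:
    disks are carried along without the choice of a basis. *)
Definition normal_form (U : lmodType R) h (D : 'M[R]_h) (t : U * U * 'rV[R]_h) :
    U * U * 'rV[R]_h := (0, t.1.1, eps *: (t.2 *m D)).

(** The homology determinant of d is m.  A relation rather than a function: its
    uniqueness is [hdet_uniq], its existence for exact d is [exact_hdet]. *)
Definition has_hdet (T : lmodType R) (d : T -> T) (m : k) : Prop :=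
  m != 0 /\ exists (U : lmodType R) (h : nat) (D : 'M[R]_h),
    dm_iso d (@normal_form U h D) /\ res (\det D) = m.

Lemma hdet_iso (T T' : lmodType R) (d : T -> T) (d' : T' -> T') m :
  dm_iso d d' -> has_hdet d' m -> has_hdet d m.
Proof.
move=> dd' [m0 [U [h [D [iso Dm]]]]]; split=> //; exists U, h, D; split=> //.
exact: dm_iso_trans iso.
Qed.

Section NormalFormMap.
Variables (U U' : lmodType R) (h h' : nat) (D : 'M[R]_h) (D' : 'M[R]_h').
Variable g : {linear (U * U * 'rV[R]_h)%type -> (U' * U' * 'rV[R]_h')%type}.
Hypothesis gd : forall t, g (normal_form D t) = normal_form D' (g t).

Fact hpart_linear : linear (fun w => (g (0, 0, w)).2).
Proof.
move=> a v w.
have -> : (0, 0, a *: v + w) = a *: (0, 0, v) + (0, 0, w) :> U * U * 'rV_h.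
  by congr (_, _, _); rewrite /= scaler0 addr0.
by rewrite linearP.
Qed.

(** The map induced by g on the homology modulo eps, where the disks vanish. *)
Definition hpart : 'M[R]_(h, h') := lin1_mx (lin hpart_linear).

Lemma hpartE w : w *m hpart = (g (0, 0, w)).2.
Proof. by rewrite mul_rV_lin1. Qed.

(** Commutation of g with the differentials, read off on the minimal parts, is
    eps times this identity. *)
Lemma nf_hpart : (D *m hpart)^r = (hpart *m D')^r.
Proof.
apply: eps_mx_eq; apply/row_matrixP => i; rewrite !rowE -!scalemxAr !mulmxA.
have := congr1 snd (gd (0, 0, delta_mx 0 i)).
rewrite /normal_form /= -hpartE -scalemxAl => ->; congr (_ *: (_ *m _)).
by rewrite hpartE.
Qed.

(** This component is the second disk component of g d = d g, which is divisible
    by eps because d is so on the minimal part. *)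
Lemma nf_map_source w : exists x, (g (0, 0, w)).1.1 = eps *: x.
Proof.
exists (g (0, 0, w *m D)).1.2.
have := congr1 (fun t => t.1.2) (gd (0, 0, w)); rewrite /normal_form /= => <-.
have -> : (0, 0, eps *: (w *m D)) = eps *: (0, 0, w *m D) :> U * U * 'rV_h.
  by congr (_, _, _); rewrite /= scaler0.
by rewrite linearZ.
Qed.

Lemma nf_map_target y : exists z, (g (0, y, 0)).2 = eps *: z.
Proof.
have -> : (0, y, 0) = normal_form D (y, 0, 0) by rewrite /normal_form /= mul0mx scaler0.
by rewrite gd; eexists.
Qed.

End NormalFormMap.

(** Functoriality of [hpart] for mutually inverse maps: what g sends outside the
    minimal part comes back as a multiple of eps. *)
Lemma nf_hpart_mul (U U' : lmodType R) h h' (D : 'M[R]_h) (D' : 'M[R]_h')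
    (g : {linear (U * U * 'rV[R]_h)%type -> (U' * U' * 'rV[R]_h')%type})
    (g' : {linear (U' * U' * 'rV[R]_h')%type -> (U * U * 'rV[R]_h)%type}) :
  (forall t, g (normal_form D t) = normal_form D' (g t)) ->
  (forall t, g' (normal_form D' t) = normal_form D (g' t)) -> cancel g g' ->
  (hpart g)^r *m (hpart g')^r = 1%:M.
Proof.
move=> gd gd' gK; rewrite -map_mxM -(map_mx1 res).
apply: eps_mx_eq; apply/row_matrixP => i; rewrite !rowE -!scalemxAr mulmx1.
rewrite mulmxA; set w := delta_mx 0 i; rewrite hpartE hpartE.
have [x xE] := nf_map_source gd w; have [z zE] := nf_map_target gd' (g (0, 0, w)).1.2.
have -> : (0, 0, (g (0, 0, w)).2) =
    g (0, 0, w) - eps *: (x, 0, 0) - (0, (g (0, 0, w)).1.2, 0).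
  case: (g _) xE => -[u v] w' /= ->.
  by congr (_, _, _); rewrite /= ?scaler0 ?subr0 ?subrr.
rewrite !raddfB /= gK zE [g' (eps *: _)]linearZ /=.
by rewrite !eps_scale2 !subr0.

Qed.

(** The map induced on homology modulo eps by an isomorphism of normal forms
    conjugates one matrix D into the other. *)
Lemma hdet_uniq (T : lmodType R) (d : T -> T) m m' :
  has_hdet d m -> has_hdet d m' -> m = m'.
Proof.
move=> [m0 [U [h [D [iD <-]]]]] [m'0 [U' [h' [D' [iD' <-]]]]].
have [g [g' [gK g'K gd]]] := dm_iso_trans (dm_iso_sym iD) iD'.
(* [g'] is only a function; it is linear as the inverse of [g]. *)
pose g1 := lin (can2_linear gK g'K).
have g'd t : g1 (normal_form D' t) = normal_form D (g1 t) by rewrite /= -{1}(g'K t) -gd gK.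
have GG' := nf_hpart_mul gd g'd gK.
have G'G := nf_hpart_mul g'd gd g'K.
have hh' : h = h' by apply/eqP; rewrite eqn_leq (mulmx1_min GG') (mulmx1_min G'G).
subst h'.
have := congr1 determinant (nf_hpart gd).
rewrite !map_mxM !det_mulmx -!det_map_mx mulrC; apply: mulfI.
have := congr1 determinant GG'; rewrite det_mulmx det1 => /eqP.
by apply: contraTneq => ->; rewrite mul0r eq_sym oner_eq0.
Qed.

(** The sign of the determinant is lost in characteristic 2. *)
Lemma hdet_opp (T : lmodType R) (d : T -> T) m :
  has_hdet d m -> has_hdet (fun t => - d t) m.
Proof.
move=> [m0 [U [h [D [[g [g' [gK g'K gd]]] Dm]]]]]; split=> //.
exists U, h, (- D).
have sP : linear (fun t : U * U * 'rV[R]_h => (t.1.1, - t.1.2, t.2)).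
  by move=> c x y; congr (_, _, _); rewrite /= opprD scalerN.
split; last by rewrite -scaleN1r detZ rmorphM rmorphXn rmorphN1 char2_opp expr1n mul1r.
exists (lin sP \o g : {linear _ -> _}), (fun t => g' (t.1.1, - t.1.2, t.2)).
split=> [t|t|t] /=; first by rewrite opprK -!surjective_pairing gK.
  by rewrite g'K /= opprK -!surjective_pairing.
by rewrite linearN gd /normal_form /= oppr0 opprK mulmxN scalerN.
Qed.

Definition add_disk (U V : lmodType R) (e : V -> V) (t : U * U * V) : U * U * V :=
  (0, t.1.1, e t.2).

Lemma hdet_add_disk (U V : lmodType R) (e : V -> V) m :
  has_hdet e m -> has_hdet (@add_disk U V e) m.
Proof.
move=> [m0 [W [h [D [[g [g' [gK g'K gd]]] Dm]]]]]; split=> //.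
exists (U * W)%type, h, D; split=> //.
pose f (t : U * U * V) : (U * W) * (U * W) * 'rV[R]_h :=
  ((t.1.1, (g t.2).1.1), (t.1.2, (g t.2).1.2), (g t.2).2).
have fP : linear f by move=> c x y; rewrite /f /= linearP.
exists (lin fP), (fun t => (t.1.1.1, t.1.2.1, g' (t.1.1.2, t.1.2.2, t.2))).
split=> [[[u w] v]|[[[u w] [u' w']] x]|[[u w] v]] //=.
- by rewrite -!surjective_pairing gK.
- by rewrite /f /= g'K.
- by rewrite /f /= gd.
Qed.

(** * Splitting off disks *)

Section SplitOff.
Variables (T U V : lmodType R) (d : {linear T -> T}) (a : {linear U -> T})
  (b : {linear T -> U}) (j : {linear V -> T}) (p : {linear T -> V}).
Hypotheses (dd : forall t, d (d t) = 0) (bda : forall u, b (d (a u)) = u)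
  (ba : forall u, b (a u) = 0) (bj : forall v, b (j v) = 0)
  (pa : forall u, p (a u) = 0) (pj : forall v, p (j v) = v)
  (ker_b : forall t, b t = 0 -> exists u, t = a u + j (p t)).

(** The differential that remains on V after the elimination of the pivot: for a
    coordinate pivot this is the Schur complement. *)
Definition schur (v : V) : V := p (d (j v - a (b (d (j v))))).

(** Elimination of an invertible entry of d.  The pivot is the entry of d from the
    summand a(U) to the complement of ker b; a(U) and d a(U) span a disk, whose
    complement ker b :&: ker (b d) is a submodule stable under d that projects
    isomorphically onto V. *)
Lemma split_off : dm_iso d (@add_disk U V schur).
Proof.
apply: dm_iso_sym.
pose f (t : U * U * V) := a t.1.1 + d (a t.1.2) + (j t.2 - a (b (d (j t.2)))).
have fP : linear f.
  move=> c x y; rewrite /f /= !linearP /= !scalerDr.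
  by rewrite [RHS]addrACA; congr (_ + _); rewrite addrACA.
have f' t : b t = 0 -> t = j (p t) - a (b (d (j (p t)))) + a (b (d t)).
  move=> /ker_b[u tE]; rewrite {1}tE.
  have -> : b (d t) = u + b (d (j (p t))) by rewrite {1}tE !linearD bda.
  by rewrite linearD [a u + a _]addrC addrA addrNK addrC.
exists (lin fP), (fun t => (b (d t), b t, p (t - d (a (b t))))); split.
- case=> [[u w] v]; rewrite /=; set t := f _.
  have bt : b t = w by rewrite !linearD !linearN /= !ba bda bj subrr add0r addr0.
  congr (_, _, _); first by rewrite /t /f /= !linearD !linearN /= dd !bda linear0 addr0 subrr addr0.
    exact: bt.
  rewrite bt /t /f /= addrAC addrK.
  by rewrite !linearD linearN /= !pa pj oppr0 addr0 add0r.
- move=> t; rewrite /= /f /=; set s := t - _.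
  have bs : b s = 0 by rewrite linearB bda subrr.
  have ds : d s = d t by rewrite linearB dd subr0.
  (* [f'] recovers s from its projection, as b s = 0. *)
  have := f' s bs; rewrite ds addrC addrA => sE.
  by rewrite addrAC addrA -sE addrNK.
- case=> [[u w] v]; rewrite /= /f /= /schur; set s := j v - _.
  have bs : b (d s) = 0 by rewrite linearB linearB bda subrr.
  clearbody s; rewrite !linearD /= dd addr0 linear0 add0r.
  by rewrite [in LHS]/= [X in _ = _ + X](f' _ bs) dd !linear0 addr0.
Qed.

Lemma hdet_split_off m : has_hdet schur m -> has_hdet d m.
Proof. by move=> v; apply: (hdet_iso split_off); apply: hdet_add_disk. Qed.

End SplitOff.

(** * Multiplicativity in extensions, up to squares *)

(** Extension of two minimal differential modules by an arbitrary map F. *)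
Definition red_ext h1 h2 (D1 : 'M[R]_h1) (D2 : 'M[R]_h2) (F : 'M[R]_(h1, h2))
    (t : 'rV[R]_h1 * 'rV[R]_h2) : 'rV[R]_h1 * 'rV[R]_h2 :=
  (eps *: (t.1 *m D1), t.1 *m F + eps *: (t.2 *m D2)).

Fact red_ext_linear h1 h2 (D1 : 'M[R]_h1) (D2 : 'M[R]_h2) F :
  linear (red_ext D1 D2 F).
Proof.
move=> c x y; congr (_, _) => /=.
  by rewrite mulmxDl -scalemxAl scalerDr !scalerA mulrC.
by rewrite !mulmxDl -!scalemxAl !scalerDr !scalerA (mulrC eps) addrACA.
Qed.

Lemma red_ext_sq h1 h2 (D1 : 'M[R]_h1) (D2 : 'M[R]_h2) F t :
  (D1 *m F)^r = (F *m D2)^r -> red_ext D1 D2 F (red_ext D1 D2 F t) = 0.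
Proof.
move=> DF; congr (_, _) => /=; first by rewrite -scalemxAl eps_scale2.
rewrite mulmxDl -!scalemxAl scalerDr eps_scale2 addr0 -!mulmxA.
by rewrite scalemxAr (eps_mx_res DF) -scalemxAr eps_scaleD.
Qed.

Lemma hdet_red_ext0 h1 h2 (D1 : 'M[R]_h1) (D2 : 'M[R]_h2) F :
  res (\det D1) != 0 -> res (\det D2) != 0 ->
  has_hdet (red_ext D1 D2 (eps *: F)) (res (\det D1) * res (\det D2)).
Proof.
move=> d1 d2; split; first by rewrite mulf_neq0.
exists 'rV[R]_0, (h1 + h2)%N, (block_mx D1 F 0 D2).
split; last by rewrite det_ublock rmorphM.
have gP : linear (fun t : 'rV_h1 * 'rV_h2 =>
    (0, 0, row_mx t.1 t.2) : 'rV[R]_0 * 'rV[R]_0 * 'rV[R]_(h1 + h2)).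
  move=> c x y; congr (_, _, _) => /=; rewrite ?scaler0 ?addr0 //.
  by rewrite scale_row_mx add_row_mx.
exists (lin gP), (fun t => (lsubmx t.2, rsubmx t.2)); split.
- by move=> [x y]; rewrite /= row_mxKl row_mxKr.
- by move=> [[x y] z]; congr (_, _, _); rewrite /= ?hsubmxK //; apply/rowP => -[].
- move=> [x y]; congr (_, _, _) => /=.
  rewrite mul_row_block mulmx0 addr0 scale_row_mx; congr row_mx.
  by rewrite scalerDr -scalemxAr.
Qed.

(** The identity block of F is a pivot.  As d squares to zero, the reductions of D1
    and D2 commute with F: they are block triangular with a common corner A, which
    is the action on the image of the connecting homomorphism.  Eliminating the
    pivot removes this corner from both, and det D1 det D2 loses (det A)^2. *)
Lemma hdet_red_ext_pid r s1 s2 (D1 : 'M[R]_(r + s1)) (D2 : 'M[R]_(r + s2)) F :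
  F^r = pid_mx r -> (D1 *m F)^r = (F *m D2)^r ->
  res (\det D1) != 0 -> res (\det D2) != 0 ->
  exists c m, [/\ c != 0, m * c ^+ 2 = res (\det D1) * res (\det D2)
    & has_hdet (red_ext D1 D2 F) m].
Proof.
move=> Fpid DF d1 d2; have sqz := @red_ext_sq _ _ D1 D2 F ^~ DF.
move: DF d1 d2 sqz; rewrite -!det_map_mx !map_mxM Fpid pid_mx_block.
move: Fpid; rewrite -[D1]submxK -[D2]submxK -[F]submxK pid_mx_block.
move: (ulsubmx D1) (ursubmx D1) (dlsubmx D1) (drsubmx D1) => A1 B1 C1 E1.
move: (ulsubmx D2) (ursubmx D2) (dlsubmx D2) (drsubmx D2) => A2 B2 C2 E2.
move: (ulsubmx F) (ursubmx F) (dlsubmx F) (drsubmx F) => P X Y Z.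
rewrite !map_block_mx !mulmx_block !mulmx0 !mul0mx !mulmx1 !mul1mx !addr0.
move=> /eq_block_mx[P1 /res_mx0[X' ->] /res_mx0[Y' ->] /res_mx0[Z' ->]].
move=> /eq_block_mx[A12 B20 C10 _]; rewrite -B20 C10 det_ublock det_lblock A12.
rewrite !mulf_eq0 !negb_or => /andP[cn0 e1] /andP[_ e2] sqz.
have [P' [PP' P'P]] : exists P', P *m P' = 1%:M /\ P' *m P = 1%:M.
  by apply: res_unitmx_inv; rewrite P1 unitmx1.
exists (\det A2^r), (res (\det E1) * res (\det E2)); split=> //.
  by rewrite -!det_map_mx [RHS]mulrACA -expr2 mulrC.
pose D1' := block_mx A1 B1 C1 E1; pose D2' := block_mx A2 B2 C2 E2.
pose F' := block_mx P (eps *: X') (eps *: Y') (eps *: Z').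
have aP : linear (fun u : 'rV[R]_r => (row_mx u 0, 0) : 'rV[R]_(r + s1) * 'rV[R]_(r + s2)).
  move=> c x y; congr (_, _) => /=; last by rewrite scaler0 addr0.
  by rewrite scale_row_mx add_row_mx scaler0 addr0.
have bP : linear (fun t : 'rV[R]_(r + s1) * 'rV[R]_(r + s2) => lsubmx t.2 *m P').
  by move=> c x y /=; rewrite linearP mulmxDl -scalemxAl.
have jP : linear (fun v : 'rV[R]_s1 * 'rV[R]_s2 =>
    (row_mx 0 v.1, row_mx 0 v.2) : 'rV[R]_(r + s1) * 'rV[R]_(r + s2)).
  by move=> c x y; congr (_, _) => /=; rewrite scale_row_mx add_row_mx scaler0 addr0.
have pP : linear (fun t : 'rV[R]_(r + s1) * 'rV[R]_(r + s2) => (rsubmx t.1, rsubmx t.2)).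
  by move=> c x y; congr (_, _) => /=; rewrite linearP.
pose d := lin (red_ext_linear D1' D2' F').
(* The correction in the Schur complement passes through two blocks divisible by
   eps, hence vanishes. *)
have dval v : schur d (lin aP) (lin bP) (lin jP) (lin pP) v = red_ext E1 E2 (eps *: Z') v.
  pose x := v.1 *m Y' + v.2 *m C2.
  have bE : lsubmx (d (lin jP v)).2 = eps *: x.
    rewrite /= /red_ext /= !mul_row_block !mul0mx !add0r scale_row_mx add_row_mx.
    by rewrite row_mxKl -scalemxAr -scalerDr.
  rewrite /schur linearB linearB /= bE.
  rewrite /red_ext /= !mul_row_block !mul0mx !add0r !addr0 !scale_row_mx.
  rewrite scaler0 addr0 add_row_mx !row_mxKr.
  congr (_, _) => /=; rewrite -!scalemxAl -?scalemxAr !eps_scale2 subr0 //.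
have vE : has_hdet (schur d (lin aP) (lin bP) (lin jP) (lin pP)) (res (\det E1) * res (\det E2)).
  by rewrite (funext dval); apply: hdet_red_ext0; rewrite -det_map_mx.
apply: hdet_split_off vE => [t|u|u|v|u|v|[t1 t2]] /=.
- exact: sqz.
- by rewrite /red_ext /= mul_row_block !mul0mx scaler0 !addr0 row_mxKl -mulmxA PP' mulmx1.
- by rewrite linear0 mul0mx.
- by rewrite row_mxKl mul0mx.
- by rewrite row_mxKr linear0.
- by rewrite !row_mxKr -surjective_pairing.
move=> /(congr1 (mulmx^~ P)); rewrite -mulmxA P'P mulmx1 mul0mx => t0.
exists (lsubmx t1); congr (_, _) => /=; last by rewrite -t0 add0r hsubmxK.
by rewrite add_row_mx addr0 add0r hsubmxK.
Qed.


Lemma hdet_red_ext h1 h2 (D1 : 'M[R]_h1) (D2 : 'M[R]_h2) F :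
  (D1 *m F)^r = (F *m D2)^r -> res (\det D1) != 0 -> res (\det D2) != 0 ->
  exists c m, [/\ c != 0, m * c ^+ 2 = res (\det D1) * res (\det D2)
    & has_hdet (red_ext D1 D2 F) m].
Proof.
have [r rE] : exists r, \rank F^r = r by eexists.
have [r1 r2] : (r <= h1)%N /\ (r <= h2)%N by rewrite -rE rank_leq_row rank_leq_col.
have [s1 s1E] : exists s, h1 = (r + s)%N by exists (h1 - r)%N; rewrite subnKC.
have [s2 s2E] : exists s, h2 = (r + s)%N by exists (h2 - r)%N; rewrite subnKC.
subst h1 h2 => DF d1 d2; have := mulmx_ebase F^r; rewrite rE.
have := row_ebase_unit F^r; have := col_ebase_unit F^r.
have [L <-] := lift_mx (col_ebase F^r); have [U <-] := lift_mx (row_ebase F^r).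
move=> /res_unitmx_inv[L' [LL' L'L]] /res_unitmx_inv[U' [UU' U'U]] FE.
pose D1' := L' *m D1 *m L; pose D2' := U *m D2 *m U'; pose F' := L' *m F *m U'.
have detD1 : \det D1' = \det D1.
  by rewrite !det_mulmx mulrAC -det_mulmx L'L det1 mul1r.
have detD2 : \det D2' = \det D2.
  by rewrite !det_mulmx mulrAC -det_mulmx UU' det1 mul1r.
have DF' : (D1' *m F')^r = (F' *m D2')^r.
  have -> : D1' *m F' = L' *m (D1 *m F) *m U'.
    by rewrite /D1' /F' !mulmxA -(mulmxA _ L) LL' mulmx1.
  have -> : F' *m D2' = L' *m (F *m D2) *m U'.
    by rewrite /D2' /F' !mulmxA -(mulmxA _ U') U'U mulmx1.
  by rewrite !(map_mxM _ _ U') !(map_mxM _ L') DF.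
have F'pid : F'^r = pid_mx r.
  rewrite /F' !map_mxM -FE !mulmxA -map_mxM L'L map_mx1 mul1mx.
  by rewrite -mulmxA -map_mxM UU' map_mx1 mulmx1.
have [||c [m [c0 mc v]]] := hdet_red_ext_pid F'pid DF'; rewrite ?detD1 ?detD2 //.
exists c, m; split=> //; first by rewrite mc detD1 detD2.
apply: hdet_iso v.
have gP : linear (fun t : 'rV[R]_(r + s1) * 'rV[R]_(r + s2) => (t.1 *m L, t.2 *m U')).
  by move=> a x y; congr (_, _) => /=; rewrite mulmxDl -scalemxAl.
exists (lin gP), (fun t => (t.1 *m L', t.2 *m U)); split.
- by move=> [x y]; rewrite /= -!mulmxA LL' U'U !mulmx1.
- by move=> [x y]; rewrite /= -!mulmxA L'L UU' !mulmx1.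
move=> [x y]; rewrite /red_ext /= /D1' /D2' /F' !mulmxA.
rewrite -!(mulmxA _ L L') LL' -(mulmxA _ U' U) U'U !mulmx1.
by rewrite mulmxDl -!scalemxAl.
Qed.

(** The extension of d1 by d2 along f.  The first differential carries no sign: f is
    to anticommute with the differentials. *)
Definition cone (T1 T2 : lmodType R) (d1 : T1 -> T1) (d2 : T2 -> T2) (f : T1 -> T2)
  (t : T1 * T2) : T1 * T2 := (d1 t.1, f t.1 + d2 t.2).

Fact cone_linear (T1 T2 : lmodType R) (d1 : {linear T1 -> T1})
  (d2 : {linear T2 -> T2}) (f : {linear T1 -> T2}) : linear (cone d1 d2 f).
Proof.
move=> c x y; congr (_, _) => /=; rewrite !linearP //=.
by rewrite scalerDr addrACA.
Qed.

Fact nf_linear (U : lmodType R) h (D : 'M[R]_h) : linear (@normal_form U h D).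
Proof.
move=> c x y; congr (_, _, _) => /=; first by rewrite scaler0 addr0.
by rewrite mulmxDl -scalemxAl scalerDr !scalerA mulrC.
Qed.

Lemma nf_sq (U : lmodType R) h (D : 'M[R]_h) t : @normal_form U h D (normal_form D t) = 0.
Proof. by congr (_, _, _); rewrite /= -scalemxAl eps_scale2. Qed.

Lemma cone_sq (T1 T2 : lmodType R) (d1 : T1 -> T1) (d2 : {linear T2 -> T2})
    (f : T1 -> T2) t :
  (forall x, d1 (d1 x) = 0) -> (forall x, d2 (d2 x) = 0) ->
  (forall x, f (d1 x) + d2 (f x) = 0) -> cone d1 d2 f (cone d1 d2 f t) = 0.
Proof.
by move=> q1 q2 fd; congr (_, _); rewrite /= ?q1 // linearD /= q2 addr0 fd.
Qed.

Section ConeNormalForm.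
Variables (U1 U2 : lmodType R) (h1 h2 : nat) (D1 : 'M[R]_h1) (D2 : 'M[R]_h2).
Local Notation H1 := 'rV[R]_h1.
Local Notation H2 := 'rV[R]_h2.
Local Notation T1 := (U1 * U1 * H1)%type.
Local Notation T2 := (U2 * U2 * H2)%type.
Variable f : {linear T1 -> T2}.
Hypothesis fd : forall t, f (normal_form D1 t) + normal_form D2 (f t) = 0.
Hypotheses (d1 : res (\det D1) != 0) (d2 : res (\det D2) != 0).

Let N1 := lin (@nf_linear U1 h1 D1).
Let N2 := lin (@nf_linear U2 h2 D2).

Fact inH_linear (U : lmodType R) h : linear (fun w : 'rV[R]_h => (0, 0, w) : U * U * 'rV[R]_h).
Proof. by move=> c x y; congr (_, _, _); rewrite /= scaler0 addr0. Qed.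

Let fH : {linear H1 -> T2} := f \o lin (@inH_linear U1 h1).

Fact red_linear h (D : 'M[R]_h) : linear (fun w : 'rV[R]_h => eps *: (w *m D)).
Proof. by move=> c x y; rewrite mulmxDl -scalemxAl scalerDr !scalerA mulrC. Qed.

Let d' : {linear (H1 * T2)%type -> (H1 * T2)%type} :=
  lin (cone_linear (lin (red_linear D1)) N2 fH).

Let d'd' t : d' (d' t) = 0.
Proof.
apply: cone_sq => [x|x|x]; first by rewrite /= -scalemxAl eps_scale2.
  exact: nf_sq.
have := fd (0, 0, x); rewrite /normal_form /= /N2 /=.
by congr (f (_, _, _) + _ = _).
Qed.

(** The disk of the second summand is split off; it receives f but maps nowhere
    else, so that no correction appears. *)
Lemma hdet_half_cone m : has_hdet (red_ext D1 D2 (hpart f)) m -> has_hdet d' m.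
Proof.
have aP : linear (fun u : U2 => (0, (u, 0, 0)) : H1 * T2).
  by move=> c x y; congr (_, (_, _, _)); rewrite /= scaler0 addr0.
have bP : linear (fun t : H1 * T2 => t.2.1.2) by [].
have jP : linear (fun v : H1 * H2 => (v.1, (0, 0, v.2)) : H1 * T2).
  by move=> c x y; congr (_, (_, _, _)); rewrite /= scaler0 addr0.
have pP : linear (fun t : H1 * T2 => (t.1, t.2.2)) by [].
move=> v; apply: (@hdet_split_off _ _ _ d' (lin aP) (lin bP) (lin jP) (lin pP)).
- exact: d'd'.
- by move=> u; rewrite /= linear0 add0r.
- by [].
- by [].
- by [].
- by case.
- case=> [x [[u w] y]] /= ->; exists u; congr (_, (_, _, _)); rewrite /= ?add0r ?addr0 //.
- have -> // : schur d' (lin aP) (lin bP) (lin jP) (lin pP) = red_ext D1 D2 (hpart f).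
  apply/funext => -[x y]; rewrite /schur !linearB /= /cone /normal_form /=.
  by congr (_, _); rewrite /= ?mul0mx ?scaler0 ?oppr0 ?addr0 ?linear0 ?add0r ?addr0
    ?subr0 // hpartE.
Qed.

(** The disk of d1 is a quotient and that of d2 a submodule, so both can be split
    off, which leaves an extension of minimal modules. *)
Lemma hdet_cone_nf : exists c m,
  [/\ c != 0, m * c ^+ 2 = res (\det D1) * res (\det D2)
    & has_hdet (cone (@normal_form U1 h1 D1) (@normal_form U2 h2 D2) f) m].
Proof.
have DF : (D1 *m hpart f)^r = (hpart f *m D2)^r.
  apply: eps_mx_eq; apply/row_matrixP => i; rewrite !rowE -!scalemxAr !mulmxA.
  have := congr1 snd (fd (0, 0, delta_mx 0 i)); rewrite /normal_form /= -hpartE -scalemxAl.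
  by move/(canRL (addrK _)) => ->; rewrite add0r -(hpartE f) eps_scaleN.
have [c [m [c0 mc v]]] := hdet_red_ext DF d1 d2.
exists c, m; split=> //; pose d := lin (cone_linear N1 N2 f).
have aP : linear (fun u : U1 => ((u, 0, 0), 0) : T1 * T2).
  by move=> a x y; congr (_, _, _, _); rewrite /= scaler0 addr0.
have bP : linear (fun t : T1 * T2 => t.1.1.2) by [].
have jP : linear (fun v : H1 * T2 => ((0, 0, v.1), v.2) : T1 * T2).
  by move=> a x y; congr (_, _, _, _); rewrite /= scaler0 addr0.
have pP : linear (fun t : T1 * T2 => (t.1.2, t.2)) by [].
apply: (@hdet_split_off _ _ _ d (lin aP) (lin bP) (lin jP) (lin pP)).
- by move=> t; apply: cone_sq => //; apply: nf_sq.
- by [].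
- by [].
- by [].
- by move=> u.
- by case.
- case=> [[[u w] y] t] /= ->; exists u; congr (_, _, _, _); rewrite /= ?add0r ?addr0 //.
- have -> : schur d (lin aP) (lin bP) (lin jP) (lin pP) = d'.
    apply/funext => -[x y]; rewrite /schur !linearB /=.
    have f0 : f (0, 0, 0) = 0 by exact: linear0.
    by rewrite /cone /normal_form /= f0 !mul0mx !scaler0 add0r; apply: subr0.
  exact: hdet_half_cone v.
Qed.

End ConeNormalForm.

(** The homology determinant of a cone is the product of those of its ends, up to
    a nonzero square. *)
Lemma hdet_cone (T1 T2 : lmodType R) (d1 : {linear T1 -> T1}) (d2 : {linear T2 -> T2})
    (f : {linear T1 -> T2}) m1 m2 :
  (forall x, f (d1 x) + d2 (f x) = 0) -> has_hdet d1 m1 -> has_hdet d2 m2 ->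
  exists c m, [/\ c != 0, m * c ^+ 2 = m1 * m2 & has_hdet (cone d1 d2 f) m].
Proof.
move=> fd [m10 [U1 [h1 [D1 [[g1 [g1' [g1K g1'K gd1]]] D1m]]]]].
move=> [m20 [U2 [h2 [D2 [[g2 [g2' [g2K g2'K gd2]]] D2m]]]]].
pose g1i := lin (can2_linear g1K g1'K).
pose F : {linear _ -> _} := g2 \o (f \o g1i).
have Fd t : F (normal_form D1 t) + normal_form D2 (F t) = 0.
  have gE : g1' (normal_form D1 t) = d1 (g1' t) by rewrite -{1}(g1'K t) -gd1 g1K.
  by rewrite /F /= gE -gd2 -linearD fd linear0.
subst m1 m2; have [c [m [c0 mc v]]] := hdet_cone_nf Fd m10 m20.
exists c, m; split=> //; apply: hdet_iso v.
have gP : linear (fun t : T1 * T2 => (g1 t.1, g2 t.2)).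
  by move=> a x y; rewrite /= !linearP.
exists (lin gP), (fun t => (g1' t.1, g2' t.2)); split=> [[x y]|[x y]|[x y]] /=.
- by rewrite g1K g2K.
- by rewrite g1'K g2'K.
by rewrite /cone /= gd1 linearD gd2 /F /= g1K.
Qed.

(** * Normal forms of exact differential modules *)

Definition exact_dm (T : lmodType R) (d : T -> T) : Prop :=
  (forall t, d (d t) = 0) /\ forall t, d t = 0 -> exists s, t = d s.

Lemma exact_dm_iso (T T' : lmodType R) (d : T -> T) (d' : T' -> T') :
  dm_iso d d' -> exact_dm d -> exact_dm d'.
Proof.
move=> [g [g' [gK g'K gd]]] [dd ex]; split=> [t|t].
  by rewrite -(g'K t) -!gd dd linear0.
rewrite -(g'K t) -gd => dt0; have [|s sE] := ex (g' t).
  by rewrite -(gK (d _)) dt0 -(linear0 g) gK.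
by exists (g s); rewrite sE gd.
Qed.

Lemma exact_add_disk (U V : lmodType R) (e : V -> V) :
  exact_dm (@add_disk U V e) -> exact_dm e.
Proof.
move=> [dd ex]; split=> v; first by have /(congr1 snd) := dd (0, 0, v).
move=> ev; have [|s /(congr1 snd) /= ->] := ex (0, 0, v).
  by rewrite /add_disk /= ev.
by exists s.2.
Qed.

Fact schur_linear (T U V : lmodType R) (d : {linear T -> T}) (a : {linear U -> T})
  (b : {linear T -> U}) (j : {linear V -> T}) (p : {linear T -> V}) :
  linear (schur d a b j p).
Proof.
pose f v := j v - a (b (d (j v))).
have fP : linear f by move=> c x y; rewrite /f !linearP /= scalerDr addrACA.
by move=> c x y; rewrite /schur -!/(f _) fP !linearP.
Qed.

Section Pivot.
Variables (n : nat) (d : {linear 'rV[R]_n.+2 -> 'rV[R]_n.+2}).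
Variables (i : 'I_n.+2) (l : 'I_n.+1) (y : R).
Let j := lift i l.
Hypothesis Aij : d (delta_mx 0 i) 0 j * y = 1.
Hypothesis d_exact : exact_dm d.

Let a (u : R^o) : 'rV[R]_n.+2 := u *: delta_mx 0 i.
Let b (t : 'rV[R]_n.+2) : R^o := t 0 j * y.
Let s (v : 'rV[R]_n) : 'rV[R]_n.+2 :=
  \row_q oapp (v 0) 0 (obind (unlift l) (unlift i q)).
Let p (t : 'rV[R]_n.+2) : 'rV[R]_n := \row_q t 0 (lift i (lift l q)).

Let aP : linear a. Proof. by move=> c x z; rewrite /a scalerDl scalerA. Qed.
Let bP : linear b. Proof. by move=> c x z; rewrite /b !mxE mulrDl -mulrA. Qed.
Let sP : linear s.
Proof.
move=> c x z; apply/rowP => q; rewrite !mxE; case: obind => [o|] /=.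
  by rewrite !mxE.
by rewrite mulr0 addr0.
Qed.
Let pP : linear p. Proof. by move=> c x z; apply/rowP => q; rewrite !mxE. Qed.

(** A unit entry of d off the diagonal is a pivot in the sense of [split_off]; its
    row and its column are removed from the basis. *)
Lemma pivot : exists e : {linear 'rV[R]_n -> 'rV[R]_n},
  exact_dm e /\ forall m, has_hdet e m -> has_hdet d m.
Proof.
have h1 u : b (d (a u)) = u by rewrite /b linearZ mxE -mulrA Aij mulr1.
have h2 u : b (a u) = 0.
  by rewrite /b !mxE /= eq_sym (negPf (neq_lift i l)) mulr0 mul0r.
have h3 v : b (s v) = 0 by rewrite /b mxE liftK /= unlift_none mul0r.
have h4 u : p (a u) = 0.
  by apply/rowP => q; rewrite !mxE /= eq_sym (negPf (neq_lift i _)) mulr0.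
have h5 v : p (s v) = v by apply/rowP => q; rewrite !mxE liftK /= liftK.
have h6 t : b t = 0 -> exists u, t = a u + s (p t).
  move=> bt; exists (t 0 i); apply/rowP => q; rewrite !mxE /=.
  case: (unliftP i q) => [o|] -> /=; last by rewrite eqxx mulr1 addr0.
  rewrite eq_sym (negPf (neq_lift i _)) mulr0 add0r.
  case: (unliftP l o) => [o'|] -> /=; first by rewrite mxE.
  by rewrite -[LHS]mulr1 -Aij mulrCA [X in _ * X]bt mulr0.
exists (lin (schur_linear d (lin aP) (lin bP) (lin sP) (lin pP))); split.
  apply: (@exact_add_disk R^o); apply: exact_dm_iso d_exact.
  by apply: split_off => //; case: d_exact.
by move=> m; apply: hdet_split_off => //; case: d_exact.
Qed.

End Pivot.

(** By induction on the rank.  If d is not zero modulo eps then some entry off the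
    diagonal is a unit, since a diagonal matrix of square zero over a field is
    zero.  If d = eps D, exactness makes D injective modulo eps. *)
Lemma exact_hdet n (d : {linear 'rV[R]_n -> 'rV[R]_n}) :
  exact_dm d -> exists m, has_hdet d m.
Proof.
elim/ltn_ind: n d => n IHn d dex; pose A := lin1_mx d.
have dE x : d x = x *m A by rewrite mul_rV_lin1.
case: (eqVneq A^r 0) => [/res_mx0[D AD]|A0].
  exists (res (\det D)); split.
    apply/negP; rewrite -det_map_mx => /det0P[v v0 vD].
    have [w wv] := lift_mx v; have [z zE] : exists z, w *m D = eps *: z.
      by apply: res_mx0; rewrite map_mxM wv.
    have [|t tE] := dex.2 w; first by rewrite dE AD -scalemxAr zE eps_scale2.
    by move: v0; rewrite -wv tE dE AD -scalemxAr res_mx_eps eqxx.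
  exists 'rV[R]_0, n, D; split=> //.
  have gP : linear (fun x : 'rV[R]_n => (0, 0, x) : 'rV[R]_0 * 'rV[R]_0 * 'rV[R]_n).
    by move=> c x y; congr (_, _, _); rewrite /= scaler0 addr0.
  exists (lin gP), snd; split=> // [[[x y] z]|x] /=.
    by congr (_, _, _); apply/rowP => -[].
  by rewrite dE AD /normal_form /= scalemxAr.
have [i [j [ij Aij]]] : exists i j, i != j /\ A^r i j != 0.
  apply: contrapT => none.
  (* Otherwise A is diagonal modulo eps, with entries of square zero. *)
  have diag i j : i != j -> A^r i j = 0.
    by move=> ij; apply/eqP; apply: contraT => Aij; case: none; exists i, j.
  case/eqP: A0; apply/matrixP => i j; rewrite [RHS]mxE.
  case: (eqVneq i j) => [<-|/diag //].
  have AA : A^r *m A^r = 0.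
    rewrite -map_mxM; have -> : A *m A = 0.
      by apply/row_matrixP => q; rewrite !rowE mulmxA -!dE dex.1 mulmx0.
    exact: map_mx0.
  move/matrixP/(_ i i): AA; rewrite mxE (bigD1 i) //= big1 => [|q qi].
    by rewrite addr0 [RHS]mxE => /eqP; rewrite mulf_eq0 orbb => /eqP.
  by rewrite diag ?mul0r // eq_sym.
case: n d A dE dex i j ij Aij {A0} IHn => [|[|n]] d A dE dex i j ij Aij IHn.
- by case: (i).
- by rewrite (ord1 i) (ord1 j) in ij.
case: (unliftP i j) ij Aij => [l ->|->]; last by rewrite eqxx.
rewrite mxE => _ /res_neq0_inv[y Aij]; have [|e [eex eval]] := @pivot n d i l y _ dex.
  by rewrite dE -rowE mxE.
have [m v] := IHn n (leqW (leqnn _)) e eex.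
by exists m; apply: eval.
Qed.

End ResidueField.

(** * Additive and triangulated categories *)

Section AddCat.
Variable C : addcat.

Lemma cmp0m (X Y Z : C) (f : hom X Y) : (0 : hom Y Z) ∘ f = 0.
Proof. by apply: (@addrI _ (0 ∘ f)); rewrite -cmpDl !addr0. Qed.
Lemma cmpm0 (X Y Z : C) (g : hom Y Z) : g ∘ (0 : hom X Y) = 0.
Proof. by apply: (@addrI _ (g ∘ 0)); rewrite -cmpDr !addr0. Qed.
Lemma cmpNm (X Y Z : C) (g : hom Y Z) (f : hom X Y) : (- g) ∘ f = - (g ∘ f).
Proof. by apply: (@addrI _ (g ∘ f)); rewrite -cmpDl !subrr cmp0m. Qed.
Lemma cmpmN (X Y Z : C) (g : hom Y Z) (f : hom X Y) : g ∘ (- f) = - (g ∘ f).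
Proof. by apply: (@addrI _ (g ∘ f)); rewrite -cmpDr !subrr cmpm0. Qed.

Lemma pr1_in1m (W X Y : C) (f : hom W X) : (pr1 : hom (X ⊕ Y) X) ∘ (in1 ∘ f) = f.
Proof. by rewrite cmpA pr1_in1 cmp1m. Qed.
Lemma pr2_in2m (W X Y : C) (f : hom W Y) : (pr2 : hom (X ⊕ Y) Y) ∘ (in2 ∘ f) = f.
Proof. by rewrite cmpA pr2_in2 cmp1m. Qed.
Lemma pr1_in2m (W X Y : C) (f : hom W Y) : (pr1 : hom (X ⊕ Y) X) ∘ (in2 ∘ f) = 0.
Proof. by rewrite cmpA pr1_in2 cmp0m. Qed.
Lemma pr2_in1m (W X Y : C) (f : hom W X) : (pr2 : hom (X ⊕ Y) Y) ∘ (in1 ∘ f) = 0.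
Proof. by rewrite cmpA pr2_in1 cmp0m. Qed.

(** Normalizes composites of structure maps of biproducts. *)
Definition biprodE := (cmpDl, cmpDr, cmpNm, cmpmN, cmp0m, cmpm0, cmp1m, cmpm1,
  pr1_in1, pr2_in2, pr1_in2, pr2_in1, pr1_in1m, pr2_in2m, pr1_in2m, pr2_in1m,
  addr0, add0r, oppr0).

Lemma of_sum_ext (X Y Z : C) (f g : hom (X ⊕ Y) Z) :
  f ∘ in1 = g ∘ in1 -> f ∘ in2 = g ∘ in2 -> f = g.
Proof.
by move=> h1 h2; rewrite -(cmpm1 f) -(cmpm1 g) -in_pr !cmpDr !cmpA h1 h2.
Qed.

Lemma is_iso_id (X : C) : is_iso (idm X).
Proof. by exists (idm X); rewrite !cmp1m. Qed.

Lemma zob_hom (X Y : C) (f g : hom X Y) : idm X = 0 -> f = g.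
Proof. by move=> X0; rewrite -(cmpm1 f) -(cmpm1 g) X0 !cmpm0. Qed.

Lemma is_iso0 (X Y : C) (f : hom X Y) : idm X = 0 -> idm Y = 0 -> is_iso f.
Proof. by move=> X0 Y0; exists 0; split; apply: zob_hom. Qed.

Lemma is_iso_unipotent (X : C) (u : hom X X) :
  (u - idm X) ∘ (u - idm X) = 0 -> is_iso u.
Proof.
move=> ee; have uE : u = (u - idm X) + idm X by rewrite subrK.
rewrite uE; move: (u - idm X) ee => e ee; exists (idm X - e).
by rewrite !biprodE ee !(oppr0, addr0, add0r) addrA [e + _]addrC addrK.
Qed.

Lemma is_iso_two_sided (X Y : C) (c : hom X Y) (c' : hom Y X) :
  is_iso (c' ∘ c) -> is_iso (c ∘ c') -> is_iso c.
Proof.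
move=> [g [gl _]] [h [_ hr]]; exists (g ∘ c'); split; first by rewrite -cmpA.
have -> : g ∘ c' = c' ∘ h; last by rewrite cmpA.
by rewrite -(cmpm1 (g ∘ c')) -hr -!cmpA (cmpA c' c) (cmpA g) gl cmp1m.
Qed.

End AddCat.

Ltac biprod := rewrite /hom_sum /of_sum /to_sum
  ?(cmpDl, cmpDr, cmpNm, cmpmN) -?cmpA ?biprodE.

Lemma iso_square_inv (C : addcat) (X X' Y Y' : C) (f : hom X Y) (f' : hom X' Y')
    (a : hom X X') (a' : hom X' X) (b : hom Y Y') (b' : hom Y' Y) :
  a ∘ a' = idm X' -> b' ∘ b = idm Y -> b ∘ f = f' ∘ a -> b' ∘ f' = f ∘ a'.
Proof.
by move=> aa bb e; rewrite -(cmpm1 f') -aa (cmpA f') -e !cmpA bb cmp1m.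
Qed.

Section TriIso.
Variable C : suspcat.
Implicit Types T : tri C.

Lemma tri_iso_refl T : tri_iso T T.
Proof.
exists (idm _), (idm _), (idm _); split; try exact: is_iso_id.
by split; rewrite ?smap1 ?cmp1m ?cmpm1.
Qed.

Lemma tri_iso_sym T T' : tri_iso T T' -> tri_iso T' T.
Proof.
move=> [a [b [c [[e1 e2 e3] [a' [a1 a2]] [b' [b1 b2]] [c' [c1 c2]]]]]].
exists a', b', c'; split; [split| by exists a | by exists b | by exists c].
- exact: iso_square_inv e1.
- exact: iso_square_inv e2.
- by apply: iso_square_inv e3; rewrite // -smapM a1 smap1.
Qed.

End TriIso.

Section Triangulated.
Variables (C : suspcat) (dist : tri C -> Prop).
Hypothesis dist_tr : triangulated dist.

Lemma smap0 (X Y : C) : smap (0 : hom X Y) = 0.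
Proof. by apply: (@addrI _ (smap 0)); rewrite -smapD !addr0. Qed.

Lemma smap_inj (X Y : C) : injective (@smap C X Y).
Proof. exact: bij_inj (smap_bij _ _). Qed.

Lemma id_susp_zob : idm (Σ (zob : C)) = 0.
Proof. by rewrite -smap1 idm_zob smap0. Qed.

(** By rotation from the triangle on the identity; the cone of an identity is
    zob in one case and its suspension in the other. *)
Lemma dist_zob_id (W : C) : dist (Tri (0 : hom zob W) (idm W) 0).
Proof.
apply/(tr_rot dist_tr); apply: (tr_iso dist_tr _ (tr_id dist_tr W)).
exists (idm W), (idm W), 0; split; try exact: is_iso_id; last first.
  by apply: is_iso0; rewrite ?idm_zob ?id_susp_zob.
by split; rewrite /= !biprodE ?smap0 ?oppr0.
Qed.

Lemma dist_mor (X Y Z X' Y' Z' : C) (f : hom X Y) (i : hom Y Z) q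
    (f' : hom X' Y') (i' : hom Y' Z') q' (a : hom X X') (b : hom Y Y') :
  dist (Tri f i q) -> dist (Tri f' i' q') -> b ∘ f = f' ∘ a ->
  exists c, c ∘ i = i' ∘ b /\ smap a ∘ q = q' ∘ c.
Proof.
move=> d d' e; have [c [_ ? ?]] := @tr_mor _ _ dist_tr (Tri f i q) (Tri f' i' q') a b d d' e.
by exists c.
Qed.

Lemma dist_comp0 (X Y Z : C) (f : hom X Y) (i : hom Y Z) q :
  dist (Tri f i q) -> i ∘ f = 0.
Proof.
move=> d; have [//|c [<- _]] := dist_mor (a := idm X) (b := f) (tr_id dist_tr X) d.
by rewrite cmpm0.
Qed.

Lemma dist_is_triangle T : dist T -> is_triangle T.
Proof.
case: T => X Y Z f i q d; have d1 := (tr_rot dist_tr _ _ _).1 d.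
have d2 := (tr_rot dist_tr _ _ _).1 d1.
split; [exact: dist_comp0 d | exact: dist_comp0 d1 |].
by have /eqP := dist_comp0 d2; rewrite cmpNm oppr_eq0 => /eqP.
Qed.

Lemma dist_wcok (X Y Z W : C) (f : hom X Y) (i : hom Y Z) q (e : hom Y W) :
  dist (Tri f i q) -> e ∘ f = 0 -> exists u, e = u ∘ i.
Proof.
move=> d ef; have [|c [ci _]] :=
  dist_mor (a := 0 : hom X zob) (b := e) d (dist_zob_id W).
  by rewrite ef cmp0m.
by exists c; rewrite ci cmp1m.
Qed.

Lemma dist_wker (X Y Z W : C) (f : hom X Y) (i : hom Y Z) q (e : hom W Y) :
  dist (Tri f i q) -> i ∘ e = 0 -> exists u, e = f ∘ u.
Proof.
move=> d ie; have dW := (tr_rot dist_tr _ _ _).1 (tr_id dist_tr W).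
have [|c [_ cE]] := dist_mor (a := e) (b := 0) dW
  ((tr_rot dist_tr _ _ _).1 d).
  by rewrite ie cmp0m.
have [g _ gK] := @smap_bij C W X.
exists (g c); apply: smap_inj; rewrite smapM gK.
by apply: oppr_inj; rewrite -cmpNm -cE smap1 cmpmN cmpm1.
Qed.

(** Weak universality alone: the equation q i = 0 is a separate statement. *)
Definition weak_cokernel (Y Z Z' : C) (i : hom Y Z) (q : hom Z Z') : Prop :=
  forall W (e : hom Z W), e ∘ i = 0 -> exists u, e = u ∘ q.

Lemma dist_weak_cokernel (X Y Z : C) (f : hom X Y) (i : hom Y Z) q :
  dist (Tri f i q) -> weak_cokernel i q.
Proof. by move=> /(tr_rot dist_tr) d W e; apply: dist_wcok d. Qed.

(** u - 1 factors as v q, and q (u - 1) = 0, so u - 1 has square zero. *)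
Lemma cone_end_iso (Y Z V : C) (i : hom Y Z) (q : hom Z V) (u : hom Z Z) :
  weak_cokernel i q -> u ∘ i = i -> q ∘ u = q -> is_iso u.
Proof.
move=> w ui qu; apply: is_iso_unipotent.
have [|v vE] := w _ (u - idm Z); first by rewrite !biprodE ui subrr.
by rewrite {1}vE -cmpA !(cmpDr, cmpmN) qu cmpm1 subrr.
Qed.

(** A five lemma without representable functors: both composites of c and c' are
    unipotent by [cone_end_iso]. *)
Lemma cone_map_iso (Y Z Z' V : C) (i : hom Y Z) (q : hom Z V) (i' : hom Y Z')
    (q' : hom Z' V) (c : hom Z Z') (c' : hom Z' Z) :
  weak_cokernel i q -> weak_cokernel i' q' ->
  c ∘ i = i' -> q = q' ∘ c -> c' ∘ i' = i -> q' = q ∘ c' -> is_iso c.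
Proof.
move=> w w' ci qc ci' qc'.
apply: (@is_iso_two_sided _ _ _ c c').
  by apply: cone_end_iso w _ _; rewrite -?cmpA ?ci // cmpA -qc' -qc.
by apply: cone_end_iso w' _ _; rewrite -?cmpA ?ci' // cmpA -qc -qc'.
Qed.

Lemma cone_unique (X Y Z Z' : C) (f : hom X Y) (i : hom Y Z) q (i' : hom Y Z') q' :
  dist (Tri f i q) -> dist (Tri f i' q') ->
  tri_iso (Tri f i q) (Tri f i' q').
Proof.
move=> d d'.
have [|c [e2 e3]] := dist_mor (a := idm X) (b := idm Y) d d'.
  by rewrite cmpm1 cmp1m.
have [|c' [e2' e3']] := dist_mor (a := idm X) (b := idm Y) d' d.
  by rewrite cmpm1 cmp1m.
move: e2 e3 e2' e3'; rewrite smap1 !cmp1m !cmpm1 => e2 e3 e2' e3'.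
have ciso : is_iso c.
  apply: (cone_map_iso (c' := c') (dist_weak_cokernel d) (dist_weak_cokernel d')) => //.
exists (idm X), (idm Y), c.
by split; [split; rewrite /= ?smap1 ?cmpm1 ?cmp1m | exact: is_iso_id | exact: is_iso_id |].
Qed.


Lemma sum_weak_cokernel (Y Z V Y' Z' V' : C) (i : hom Y Z) (q : hom Z V)
    (i' : hom Y' Z') (q' : hom Z' V') :
  weak_cokernel i q -> weak_cokernel i' q' ->
  weak_cokernel (hom_sum i i') (hom_sum q q').
Proof.
move=> w w' W e ei.
have [|u uE] := w _ (e ∘ in1).
  have := congr1 (fun h => h ∘ in1) ei.
  by biprod.
have [|u' u'E] := w' _ (e ∘ in2).
  have := congr1 (fun h => h ∘ in2) ei.
  by biprod.
exists (of_sum u u'); by apply: of_sum_ext; biprod.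
Qed.

Lemma weak_cokernel_mono (Y Z V V' : C) (i : hom Y Z) (q : hom Z V)
    (m : hom V V') (r : hom V' V) :
  r ∘ m = idm V -> weak_cokernel i q -> weak_cokernel i (m ∘ q).
Proof.
move=> rm w W e /w[u ->]; exists (u ∘ r).
by rewrite -cmpA (cmpA r) rm cmp1m.
Qed.

(** Compare the sum with a distinguished triangle on the sum of the first maps:
    inclusions and projections extend to maps between the cones, and [cone_map_iso]
    applies to the maps that they induce. *)
Lemma dist_sum (T T' : tri C) : dist T -> dist T' -> dist (tri_sum T T').
Proof.
case: T T' => [X Y Z f i q] [X' Y' Z' f' i' q'] d d'.
have [Z2 [i2 [q2 d2]]] := tr_ext dist_tr (hom_sum f f').
have [|c1 [c1i c1q]] := dist_mor (a := in1) (b := in1) d d2.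
  by biprod.
have [|c2 [c2i c2q]] := dist_mor (a := in2) (b := in2) d' d2.
  by biprod.
have [|p1 [p1i p1q]] := dist_mor (a := pr1) (b := pr1) d2 d.
  by biprod.
have [|p2 [p2i p2q]] := dist_mor (a := pr2) (b := pr2) d2 d'.
  by biprod.
set q3 := of_sum (smap in1) (smap in2) ∘ hom_sum q q'.
have q3E : q3 = smap in1 ∘ (q ∘ pr1) + smap in2 ∘ (q' ∘ pr2).
  by rewrite /q3; biprod.
pose c := of_sum c1 c2; pose c' := to_sum p1 p2.
have w3 : weak_cokernel (hom_sum i i') q3.
  apply: (weak_cokernel_mono (r := to_sum (smap pr1) (smap pr2))).
    apply: of_sum_ext; biprod; rewrite -!smapM.
      by rewrite pr1_in1 pr2_in1 smap1 smap0 !biprodE.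
    by rewrite pr1_in2 pr2_in2 smap1 smap0 !biprodE.
  exact: sum_weak_cokernel (dist_weak_cokernel d) (dist_weak_cokernel d').
have ciso : is_iso c.
  apply: (cone_map_iso (c' := c') w3 (dist_weak_cokernel d2)).
  - apply: of_sum_ext; rewrite /c; biprod.
      by rewrite c1i.
    by rewrite c2i.
  - by rewrite q3E /c /of_sum cmpDr !cmpA c1q c2q.
  - by rewrite /c'; biprod; rewrite p1i p2i.
  - rewrite q3E /c'; biprod; rewrite -p1q -p2q !cmpA -!smapM.
    by rewrite -cmpDl -smapD in_pr smap1 cmp1m.
apply: (tr_iso dist_tr _ d2).
have [g [gc cg]] := ciso.
exists (idm _), (idm _), g; split; [|exact: is_iso_id|exact: is_iso_id|by exists c].
have ci : c ∘ hom_sum i i' = i2.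
  apply: of_sum_ext; rewrite /c; biprod.
    by rewrite c1i.
  by rewrite c2i.
have qc : q3 = q2 ∘ c by rewrite q3E /c /of_sum cmpDr !cmpA c1q c2q.
split=> /=; first by rewrite cmpm1 cmp1m.
  by rewrite -ci cmpA gc cmp1m cmpm1.
by rewrite -/q3 qc smap1 cmp1m -cmpA cg cmpm1.
Qed.

End Triangulated.

(** * Triangles of free modules *)

Section Ap.
Variable R : comNzRingType.
Local Notation C := (free_modules_susp R).
Implicit Types X Y Z W : C.

(** Evaluation, named so that the homs of the abstract category can be computed on
    elements by rewriting with [apE]. *)
Definition ap X Y (f : hom X Y) (x : (X : vectType R)) : (Y : vectType R) :=
  fun_of_lfun (f : 'Hom((X : vectType R), (Y : vectType R))) x.

Lemma ap_ext X Y (f g : hom X Y) : ap f =1 ap g -> f = g.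
Proof. by move=> h; apply/lfunP. Qed.

Lemma ap_cmp X Y Z (g : hom Y Z) (f : hom X Y) x : ap (g ∘ f) x = ap g (ap f x).
Proof. by rewrite /ap /= lfunE. Qed.
Lemma ap_id X x : ap (idm X) x = x.
Proof. by rewrite /ap /= lfunE. Qed.
Lemma ap_addm X Y (f g : hom X Y) x : ap (f + g) x = ap f x + ap g x.
Proof. by rewrite /ap /= lfunE. Qed.
Lemma ap_oppm X Y (f : hom X Y) x : ap (- f) x = - ap f x.
Proof. by rewrite /ap /= lfunE. Qed.
Lemma ap_0m X Y x : ap (0 : hom X Y) x = 0.
Proof. by rewrite /ap /= lfunE. Qed.
Lemma ap_in1 X Y x : ap (in1 : hom X (X ⊕ Y)) x = (x, 0).
Proof. by rewrite /ap /= lfunE. Qed.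
Lemma ap_in2 X Y y : ap (in2 : hom Y (X ⊕ Y)) y = (0, y).
Proof. by rewrite /ap /= lfunE. Qed.
Lemma ap_pr1 X Y p : ap (pr1 : hom (X ⊕ Y) X) p = p.1.
Proof. by rewrite /ap /= lfunE. Qed.
Lemma ap_pr2 X Y p : ap (pr2 : hom (X ⊕ Y) Y) p = p.2.
Proof. by rewrite /ap /= lfunE. Qed.
Lemma ap_smap X Y (f : hom X Y) x : ap (smap f) x = ap f x.
Proof. by []. Qed.
Lemma ap_to_sum X Y Z (f : hom X Y) (g : hom X Z) x :
  ap (to_sum f g) x = (ap f x, ap g x).
Proof.
by rewrite /to_sum ap_addm !ap_cmp ap_in1 ap_in2; congr (_, _); rewrite /= ?addr0 ?add0r.
Qed.
Lemma ap_of_sum X Y Z (f : hom X Z) (g : hom Y Z) p :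
  ap (of_sum f g) p = ap f p.1 + ap g p.2.
Proof. by rewrite /of_sum ap_addm !ap_cmp ap_pr1 ap_pr2. Qed.
Lemma ap_hom_sum X Y X' Y' (f : hom X Y) (g : hom X' Y') p :
  ap (hom_sum f g) p = (ap f p.1, ap g p.2).
Proof. by rewrite /hom_sum ap_to_sum !ap_cmp ap_pr1 ap_pr2. Qed.

Lemma apD X Y (f : hom X Y) x y : ap f (x + y) = ap f x + ap f y.
Proof. by rewrite /ap linearD. Qed.
Lemma apN X Y (f : hom X Y) x : ap f (- x) = - ap f x.
Proof. by rewrite /ap linearN. Qed.
Lemma ap0 X Y (f : hom X Y) : ap f 0 = 0.
Proof. by rewrite /ap linear0. Qed.
Lemma apZ X Y (f : hom X Y) a x : ap f (a *: x) = a *: ap f x.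
Proof. by rewrite /ap linearZ. Qed.

Definition scal (a : R) X : hom X X := (a *: \1 : 'End((X : vectType R)))%VF.
Lemma ap_scal a X x : ap (scal a X) x = a *: x.
Proof. by rewrite /ap /scal !lfunE /= lfunE. Qed.

(** The sums come first: unfolding them would match the rules for + and for
    composition. *)
Definition apE := (ap_hom_sum, ap_of_sum, ap_to_sum, ap_scal, ap_cmp, ap_id, ap_in1,
  ap_in2, ap_pr1, ap_pr2, ap_smap, ap_0m, ap_oppm, ap_addm).

Lemma zobE (z : ((zob : C) : vectType R)) : z = 0.
Proof. by apply/rowP => -[]. Qed.

Lemma ap_iso X Y (f : hom X Y) (g : hom Y X) :
  cancel (ap f) (ap g) -> cancel (ap g) (ap f) -> is_iso f.
Proof. by move=> fK gK; exists g; split; apply: ap_ext => x; rewrite !apE. Qed.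

Lemma is_iso_ap X Y (f : hom X Y) : is_iso f ->
  exists g : hom Y X, cancel (ap f) (ap g) /\ cancel (ap g) (ap f).
Proof. by move=> [g [gf fg]]; exists g; split=> x; rewrite -ap_cmp ?gf ?fg ap_id. Qed.

Lemma tri_iso_ap X Y Z (f : hom X Y) (i : hom Y Z) (q : hom Z X)
    X' Y' Z' (f' : hom X' Y') (i' : hom Y' Z') (q' : hom Z' X')
    (a : hom X X') (a' : hom X' X) (b : hom Y Y') (b' : hom Y' Y)
    (c : hom Z Z') (c' : hom Z' Z) :
  cancel (ap a) (ap a') -> cancel (ap a') (ap a) ->
  cancel (ap b) (ap b') -> cancel (ap b') (ap b) ->
  cancel (ap c) (ap c') -> cancel (ap c') (ap c) ->
  (forall x, ap b (ap f x) = ap f' (ap a x)) ->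
  (forall y, ap c (ap i y) = ap i' (ap b y)) ->
  (forall z, ap a (ap q z) = ap q' (ap c z)) ->
  tri_iso (@Tri C X Y Z f i q) (@Tri C X' Y' Z' f' i' q').
Proof.
move=> a1 a2 b1 b2 c1 c2 e1 e2 e3.
exists a, b, c; split; [|exact: ap_iso a1 a2|exact: ap_iso b1 b2|exact: ap_iso c1 c2].
by split; apply: ap_ext => t; rewrite !apE.
Qed.

Section Dist.
Variable dist : tri C -> Prop.
Hypothesis dist_tr : triangulated dist.

Lemma dist_transport X Y Z (f : hom X Y) (i : hom Y Z) (q : hom Z X)
    X' Y' Z' (f' : hom X' Y') (i' : hom Y' Z') (q' : hom Z' X')
    (a : hom X X') (a' : hom X' X) (b : hom Y Y') (b' : hom Y' Y)
    (c : hom Z Z') (c' : hom Z' Z) :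
  dist (@Tri C X Y Z f i q) ->
  cancel (ap a) (ap a') -> cancel (ap a') (ap a) ->
  cancel (ap b) (ap b') -> cancel (ap b') (ap b) ->
  cancel (ap c) (ap c') -> cancel (ap c') (ap c) ->
  (forall x, ap b (ap f x) = ap f' (ap a x)) ->
  (forall y, ap c (ap i y) = ap i' (ap b y)) ->
  (forall z, ap a (ap q z) = ap q' (ap c z)) ->
  dist (@Tri C X' Y' Z' f' i' q').
Proof.
move=> d a1 a2 b1 b2 c1 c2 e1 e2 e3; apply: (tr_iso dist_tr _ d).
exact: tri_iso_ap a1 a2 b1 b2 c1 c2 e1 e2 e3.
Qed.

(** A split short exact sequence, completed by zero, is the sum of the triangles on
    an identity and on the map from the zero object. *)
Lemma dist_split X Y Z (u : hom X Y) (v : hom Y Z) (w : hom Z X)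
    (r : hom Y X) (s : hom Z Y) :
  (forall x, ap r (ap u x) = x) -> (forall z, ap v (ap s z) = z) ->
  (forall y, ap u (ap r y) + ap s (ap v y) = y) -> (forall z, ap w z = 0) ->
  dist (@Tri C X Y Z u v w).
Proof.
move=> ru vs yE w0; have d := dist_sum dist_tr (tr_id dist_tr X) (dist_zob_id dist_tr Z).
have vu x : ap v (ap u x) = 0.
  by have := yE (ap u x); rewrite ru => /(canRL (addKr _))/(congr1 (ap v));
     rewrite vs addNr ap0.
have rs z : ap r (ap s z) = 0.
  by have := yE (ap s z); rewrite vs => /(canRL (addrK _))/(congr1 (ap r));
     rewrite ru subrr ap0.
apply: (dist_transport (a := pr1) (a' := in1) (b := of_sum u s) (b' := to_sum r v)
  (c := pr2) (c' := in2) d) => t; rewrite !apE //=.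
- by case: t => x z; rewrite [z]zobE.
- by case: t => x z; rewrite !apD ru vs rs vu addr0 add0r.
- by case: t => x z; rewrite [x]zobE.
- by rewrite ap0 addr0.
- by rewrite apD vu vs add0r.
- by rewrite w0 addr0.
Qed.


Lemma dist_add2 X Y Z B (f : hom X Y) (i : hom Y Z) (q : hom Z X) :
  dist (@Tri C X Y Z f i q) ->
  dist (@Tri C X (Y ⊕ B) (Z ⊕ B) (in1 ∘ f) (hom_sum i (idm B)) (q ∘ pr1)).
Proof.
move=> d; have := dist_sum dist_tr d (dist_zob_id dist_tr B).
move=> d'; apply: (dist_transport (a := pr1) (a' := in1) (b := idm _) (b' := idm _)
  (c := idm _) (c' := idm _) d') => t; rewrite !apE //=.
- by case: t => x z; rewrite [z]zobE.
- by rewrite addr0.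
Qed.

Lemma dist_rot X Y Z (f : hom X Y) (i : hom Y Z) (q : hom Z X) :
  dist (@Tri C X Y Z f i q) -> dist (@Tri C Y Z X i q (- f)).
Proof. exact: (tr_rot dist_tr _ _ _).1. Qed.

Lemma dist_zero X Z : dist (@Tri C X Z (Z ⊕ X) 0 in1 pr2).
Proof.
apply/(tr_rot dist_tr); rewrite smap0 oppr0.
apply: (dist_split (r := pr1) (s := in2)) => t; rewrite !apE //.
by case: t => x y; congr (_, _); rewrite /= ?addr0 ?add0r.
Qed.

Lemma dist_in1_pr2 X Y : dist (@Tri C X (X ⊕ Y) Y in1 pr2 0).
Proof.
apply: (dist_split (r := pr1) (s := in2)) => t; rewrite !apE //.
by case: t => x y; congr (_, _); rewrite /= ?addr0 ?add0r.
Qed.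

Lemma dist_third X Y Z (f : hom X Y) (i : hom Y Z) (q q' : hom Z X) :
  dist (@Tri C X Y Z f i q) -> ap q =1 ap q' -> dist (@Tri C X Y Z f i q').
Proof. by move=> d /ap_ext <-. Qed.

Section Complex.
Variables (X Y Z : C) (f : hom X Y) (i : hom Y Z) (q : hom Z X).
Hypothesis d : dist (@Tri C X Y Z f i q).

Lemma dist_if x : ap i (ap f x) = 0.
Proof. by have [e _ _] := dist_is_triangle dist_tr d; rewrite -ap_cmp e ap_0m. Qed.
Lemma dist_qi y : ap q (ap i y) = 0.
Proof. by have [_ e _] := dist_is_triangle dist_tr d; rewrite -ap_cmp [X in ap X]e ap_0m. Qed.
Lemma dist_fq z : ap f (ap q z) = 0.
Proof. by have [_ _ e] := dist_is_triangle dist_tr d; rewrite -ap_cmp [X in ap X]e ap_0m. Qed.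

(** Y -> Y + B is the inclusion of a summand, so the third triangle is the sum of
    the first one and of 0 -> B -> B -> 0. *)
Definition oct_add B : octdata C :=
  @OctData C X Y (Y ⊕ B) Z B (Z ⊕ B) f in1 i q pr2 0
    (hom_sum i (idm B)) (q ∘ pr1) in1 pr2.

(** The first additional triangle is split, the second is the sum of a rotation of
    the given triangle and of B -> B -> 0. *)
Lemma oct_add_special B : special_octahedron dist (oct_add B).
Proof.
have dgf := dist_add2 B d; have dt := dist_in1_pr2 Z B.
have dt' : dist (tri_tilde (oct_add B)).
  by apply: (dist_third dt) => t; rewrite !apE ap0.
split.
- split; last by split=> //; exact: dist_in1_pr2.
  split; first by split; apply: (dist_is_triangle dist_tr) => //; apply: dist_in1_pr2.
  by split; apply: ap_ext => t; rewrite !apE ?ap0 ?dist_fq.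
- apply: (dist_split (r := pr1 ∘ pr1) (s := to_sum (in2 ∘ pr2) pr1)) => t; rewrite !apE //=.
    by case: t => c b; congr (_, _); rewrite /= ?ap0 ?add0r ?addr0.
  by case: t => [[y b] c]; congr (_, _, _); rewrite /= ?addr0 ?add0r ?addNKr // addrA addNr add0r.
have d' := dist_sum dist_tr (dist_rot (dist_rot d)) (tr_id dist_tr B).
apply: (dist_transport (a := idm _) (a' := idm _)
   (b := hom_sum (idm X) (- idm B)) (b' := hom_sum (idm X) (- idm B))
   (c := - pr1) (c' := - in1) d') => t; rewrite !apE /= ?opprK //.
- by case: t => x b.
- by case: t => x b.
- by case: t => y z; rewrite [z]zobE; congr (_, _); rewrite /= ?opprK ?oppr0.
- by rewrite addr0.
- by rewrite apN; congr (_, _); rewrite /= addr0.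
Qed.

(** The composite of the first two maps of a triangle vanishes, so the third
    triangle is split, the second is the rotation of the first, and the fourth
    splits as well. *)
Definition oct_rot : octdata C :=
  @OctData C X Y Z Z X (Z ⊕ X) f i i q q (- f) in1 pr2
    (to_sum (idm Z) q) (of_sum q (- idm X)).

(** Both additional triangles are, up to a change of basis of their middle terms,
    sums of a rotation of the given triangle and of a contractible one. *)
Lemma oct_rot_special : special_octahedron dist oct_rot.
Proof.
have dr := dist_rot d; have drr := dist_rot dr.
have dgf : dist (tri_gf oct_rot).
  have -> : tri_gf oct_rot = @Tri C X Z (Z ⊕ X) 0 in1 pr2.
    by rewrite /tri_gf /=; congr Tri; apply: ap_ext => x; rewrite [LHS]ap_cmp dist_if ap_0m.
  exact: dist_zero.
have dt : dist (tri_tilde oct_rot).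
  apply: (dist_split (r := pr1) (s := - in2)) => t; rewrite !apE ?apN ?dist_if //=.
  - by rewrite ap0 oppr0 add0r opprK.
  - by case: t => z x; congr (_, _); rewrite /= ?subr0 // opprD opprK addNKr.
  - by rewrite oppr0.
split.
- split; last by [].
  split; first by split; apply: (dist_is_triangle dist_tr).
  split; apply: ap_ext => t; rewrite !apE ?ap0 ?dist_qi //=.
  + by rewrite oppr0 addr0.
  + by rewrite apD apN dist_fq add0r opprK.
- have d' := dist_sum dist_tr dr (dist_zob_id dist_tr Z).
  apply: (dist_transport (a := pr1) (a' := in1)
    (b := to_sum (of_sum (idm Z) (idm Z)) (- pr1)) (b' := to_sum (- pr2) (of_sum (idm Z) (idm Z)))
    (c := to_sum pr2 (- pr1)) (c' := to_sum (- pr2) pr1) d') => t; rewrite !apE /= ?opprK //.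
  + by case: t => x z; rewrite [z]zobE.
  + by case: t => x z /=; rewrite addrAC subrr add0r.
  + by case: t => x z /=; rewrite addrC addrK.
  + by case: t.
  + by case: t.
  + by rewrite addr0.
  + by congr (_, _); rewrite /= ?apN ?add0r // addrAC subrr add0r.
  + by rewrite apD dist_fq add0r addr0.
have d' := dist_sum dist_tr drr (tr_id dist_tr X).
apply: (dist_transport (a := idm _) (a' := idm _)
  (b := to_sum pr2 (of_sum (- idm X) (idm X))) (b' := to_sum (of_sum (idm X) (- idm X)) pr1)
  (c := - pr1) (c' := - in1) d') => t; rewrite !apE /= ?opprK //.
- by case: t => x y; congr (_, _); rewrite /= opprD opprK addrC addrNK.
- by case: t => x y; congr (_, _); rewrite /= opprB addrNK.
- by case: t => x z; rewrite [z]zobE; congr (_, _); rewrite /= ?opprK ?oppr0.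
- by rewrite opprB addrC.
- by rewrite apD apN opprD opprK addrC addrNK.
- by rewrite dist_qi apN; congr (_, _); rewrite /= addr0.
Qed.

End Complex.

Section EpsTriangle.
Variable eps : R.
Hypotheses (eps_eps : eps * eps = 0) (eps_opp : - eps = eps).
Hypothesis dist_eps : dist (mul_triangle eps).

Let ee (V : lmodType R) (x : V) : eps *: (eps *: x) = 0.
Proof. by rewrite scalerA eps_eps scale0r. Qed.
Let eN (V : lmodType R) (x : V) : - (eps *: x) = eps *: x.
Proof. by rewrite -scaleNr eps_opp. Qed.

Definition eps_tri X : tri C := @Tri C X X X (scal eps X) (scal eps X) (scal eps X).

Lemma eps_tri_iso X Y (a : hom X Y) (a' : hom Y X) :
  cancel (ap a) (ap a') -> cancel (ap a') (ap a) -> dist (eps_tri X) -> dist (eps_tri Y).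
Proof.
move=> aK a'K d.
by apply: (dist_transport (a := a) (a' := a') (b := a) (b' := a') (c := a) (c' := a') d)
  => // x; rewrite !apE apZ.
Qed.

Definition mkhom (X Y : C) (f : {linear (X : vectType R) -> (Y : vectType R)}) : hom X Y :=
  linfun f.
Lemma ap_mkhom X Y (f : {linear (X : vectType R) -> (Y : vectType R)}) : ap (mkhom f) =1 f.
Proof. by move=> x; rewrite /ap /mkhom lfunE. Qed.

Lemma dist_eps_rV n : dist (eps_tri ('rV[R]_n : vectType R)).
Proof.
elim: n => [|n IHn].
  apply: (dist_transport (a := idm _) (a' := idm _) (b := idm _) (b' := idm _)
    (c := idm _) (c' := idm _) (tr_id dist_tr zob)) => t; rewrite !apE //.
  - by rewrite [t]zobE scaler0.
  - by rewrite [t]zobE scaler0.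
  - by rewrite [t]zobE scaler0.
have d := dist_sum dist_tr dist_eps IHn.
pose f (t : R^o * 'rV[R]_n) : 'rV[R]_(1 + n) := row_mx (const_mx t.1) t.2.
have fP : linear f.
  by move=> c x y; apply/rowP => j; rewrite !mxE; case: split => o; rewrite !mxE.
pose g (v : 'rV[R]_(1 + n)) : R^o * 'rV[R]_n := (v 0 0, rsubmx v).
have fK : cancel f g.
  move=> [x v]; rewrite /g /f row_mxKr; congr (_, _).
  by rewrite mxE; case: splitP => [j _|j //]; rewrite mxE.
have gK : cancel g f.
  move=> v; rewrite /g /f -[RHS]hsubmxK; congr row_mx; apply/rowP => j.
  by rewrite !mxE (ord1 j); congr (v _ _); apply/val_inj.
pose U : C := ((R^o * 'rV[R]_n)%type : vectType R).
pose V : C := ('rV[R]_(1 + n) : vectType R).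
pose F : hom U V := @mkhom U V (lin fP).
pose G : hom V U := @mkhom V U (lin (can2_linear (f := lin fP) fK gK)).
apply: (@eps_tri_iso _ _ F G) => [x|x|].
- by rewrite !ap_mkhom /= fK.
- by rewrite !ap_mkhom /= gK.
apply: (dist_transport (a := idm _) (a' := idm _) (b := idm _) (b' := idm _)
    (c := idm _) (c' := idm _) d) => t; rewrite !apE //.
by case: t => x v; congr (_, _); rewrite /= ?addr0 ?add0r.
Qed.

Lemma dist_eps_tri X : dist (eps_tri X).
Proof.
have rK := @v2rK _ (X : vectType R); have vK := @r2vK _ (X : vectType R).
pose V : C := ('rV[R]_(dim (X : vectType R)) : vectType R).
pose F : hom V X := @mkhom V X r2v.
pose G : hom X V := @mkhom X V v2r.
by apply: (@eps_tri_iso _ _ F G) (dist_eps_rV _) => x; rewrite !ap_mkhom; [exact: vK | exact: rK].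
Qed.

(** An inclusion X -> X + Y followed by eps: the third and fourth triangles are sums
    of (eps, eps, eps) and of a triangle 0 -> B -> B -> 0, while the first is split. *)
Definition oct_eps X Y : octdata C :=
  @OctData C X (X ⊕ Y) (X ⊕ Y) Y (X ⊕ Y) (X ⊕ Y) in1 (scal eps _) pr2 0
    (scal eps _) (scal eps _) (hom_sum (scal eps X) (idm Y)) (scal eps X ∘ pr1)
    (in2 ∘ scal eps Y) (hom_sum (idm X) (scal eps Y)).

(** Split, the identity being one of the two entries of each map. *)
Lemma dist_eps_block X :
  dist (@Tri C X (X ⊕ X) X (to_sum (scal eps X) (- idm X))
    (of_sum (idm X) (scal eps X)) 0).
Proof.
apply: (dist_split (r := - pr2) (s := in1)) => t; rewrite !apE ?opprK ?scaler0 ?addr0 //.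
by case: t => a b; congr (_, _); rewrite /= ?opprK ?addr0 // scalerN addrCA addNr addr0.
Qed.

(** The additional triangles are sums of (eps, eps, eps) and of [dist_eps_block]. *)
Lemma oct_eps_special X Y : special_octahedron dist (oct_eps X Y).
Proof.
have dX := dist_eps_tri X; have dY := dist_eps_tri Y; have dXY := dist_eps_tri (X ⊕ Y).
have df : dist (tri_f (oct_eps X Y)) by apply: dist_in1_pr2.
have dg : dist (tri_g (oct_eps X Y)) := dXY.
have dgf : dist (tri_gf (oct_eps X Y)).
  apply: (dist_transport (a := idm _) (a' := idm _) (b := idm _) (b' := idm _)
    (c := idm _) (c' := idm _) (dist_add2 Y dX)) => t; rewrite !apE //.
  by congr (_, _); rewrite /= scaler0.
have dt : dist (tri_tilde (oct_eps X Y)).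
  apply: (dist_transport (a := idm _) (a' := idm _) (b := to_sum pr2 pr1) (b' := to_sum pr2 pr1)
    (c := to_sum pr2 pr1) (c' := to_sum pr2 pr1) (dist_add2 X dY)) => t; rewrite !apE //.
  - by case: t.
  - by case: t.
  - by case: t.
  - by case: t.
split.
- split; last by [].
  split; first by split; apply: (dist_is_triangle dist_tr).
  split; apply: ap_ext => t; rewrite !apE ?scaler0 //.
  + by congr (_, _); rewrite /= ?ee.
  + by congr (_, _); rewrite /= ?ee.
- have d' := dist_sum dist_tr dX (dist_eps_block Y).
  apply: (dist_transport (a := idm _) (a' := idm _)
    (b := to_sum (to_sum pr1 (pr1 ∘ pr2)) (pr2 ∘ pr2))
    (b' := to_sum (pr1 ∘ pr1) (to_sum (pr2 ∘ pr1) pr2))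
    (c := idm _) (c' := idm _) d') => t; rewrite !apE //=.
  + by case: t => x [y z].
  + by case: t => [[x y] z].
  + by congr (_, _); rewrite /= ?addr0 ?add0r.
  + by congr (_, _); rewrite /= ?addr0 ?ee.
have d' := dist_sum dist_tr (dist_eps_block X) dY.
apply: (dist_transport (a := idm _) (a' := idm _)
    (b' := to_sum (to_sum pr1 (pr1 ∘ pr2)) (pr2 ∘ pr2))
    (b := to_sum (pr1 ∘ pr1) (to_sum (pr2 ∘ pr1) pr2))
    (c := idm _) (c' := idm _) d') => t; rewrite !apE //=.
- by case: t => [[x y] z].
- by case: t => x [y z].
- by congr (_, (_, _)); rewrite /= eN.
- by congr (_, _); rewrite /= ?add0r.
- by rewrite add0r.
Qed.

End EpsTriangle.
End Dist.
End Ap.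

(** * The first K-group of distinguished triangles *)

Section GroupFacts.
Local Open Scope grp_scope.
Variable G : group.
Implicit Types x y z : G.

Definition grpE := (gaddA, goppD, goppK, gaddK, gaddNK, gaddrN, gaddN, gadd0, gaddr0, gopp0).

Lemma gcomm0 x y : gcomm x y = 0 -> x + y = y + x.
Proof.
move=> c; have := gaddr0 (y + x); rewrite -c /gcomm => <-.
by rewrite !gaddA !(gaddK, gaddrN, gadd0).
Qed.

Lemma gcomm_conj x y : x + gcomm x y = - y + x + y.
Proof. by rewrite /gcomm !gaddA gaddrN gadd0. Qed.

Lemma gaddIr x y z : x + z = y + z -> x = y.
Proof. by move/(congr1 (fun t => t + - z)); rewrite !gaddK. Qed.

(** The relation given by an automorphism of the triangle (eps, eps, eps): u occurs
    twice on one side and once on the other, so it can be solved for u. *)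
Lemma twisted_double u x x' :
  u + (- x + u + x) = - x' + u + x -> u = - x' + x.
Proof.
rewrite !gaddA => /gaddIr/gaddIr <-.
by rewrite gaddNK.
Qed.

Lemma iso_cancel d d' x x' y y' c c' :
  (forall z, d + z = z + d) -> (forall z, d' + z = z + d') ->
  - x' + x + (- x + (- c' + c) + x) =
    - (d' + (- y' + c' + x')) + (- y' + y) + (d + (- y + c + x)) -> d = d'.
Proof.
move=> dC d'C; rewrite d'C goppD -gaddA [_ + (d + _)]gaddA -dC !grpE => e.
have e' : d + - d' = 0.
  by apply: (@gaddIr _ _ (- x' + - c' + c + x)); rewrite gadd0 !gaddA.
by apply: (@gaddIr _ _ (- d')); rewrite e' gaddrN.
Qed.

Lemma oct_cancel d1 d2 d3 d4 x y z f g h :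
  (forall t, d2 + t = t + d2) -> (forall t, d4 + t = t + d4) ->
  d1 + (- z + g + y) + (d2 + (- y + f + x)) =
    d3 + (- z + h + x) + (- x + (d4 + (- h + g + f)) + x) -> d1 + d2 = d3 + d4.
Proof.
move=> d2C d4C; rewrite !gaddA.
rewrite -(gaddA d1 (- z)) -(gaddA d1 _ y) -(gaddA d1 _ d2) -d2C.
rewrite -(gaddA d3 (- z)) -(gaddA d3 _ x) -(gaddA d3 _ (- x)) -(gaddA d3 _ d4) -d4C.
rewrite !grpE => e; do 4!move/gaddIr: e => e; exact: e.
Qed.

End GroupFacts.

Section KTheory.
Variable R : comNzRingType.
Local Notation C := (free_modules_susp R).
Variable dist : tri C -> Prop.
Hypothesis dist_tr : triangulated dist.
Variables (eps : R) (k : fieldType) (res : {rmorphism R -> k}).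
Hypothesis eps_sqr : eps ^+ 2 = 0.
Hypothesis res_surj : forall y : k, exists x : R, res x = y.
Hypothesis res_ker : forall x : R, (res x == 0) = (x \in principal_ideal eps).
Hypothesis k_char2 : 2%N \in [pchar k].
Hypothesis dist_eps : dist (mul_triangle eps).

Let eps_eps : eps * eps = 0 := eps_eps eps_sqr.
Let eps_opp : - eps = eps := eps_opp eps_sqr res_ker k_char2.

(** The contractible triangle on the zero object is added, and no map replaced. *)
Lemma dist_virtual T : dist T -> virtual dist T.
Proof.
case: T => X Y Z f i q d; split; first exact: (dist_is_triangle dist_tr).
exists (Tri (idm zob) (0 : hom zob zob) 0), X, Y, Z, f, i, q.
split; [exact: contr1 | | by exists f | by exists i | by exists q].
exists pr1, pr1, pr1; split.
- by split; apply: ap_ext => t; rewrite !apE //= addr0.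
all: by apply: (ap_iso (g := in1)) => t; rewrite !apE //; case: t => x z; rewrite [z]zobE.
Qed.

Lemma dist_sharp s T : dist T -> sharp_triangle dist s T.
Proof. by case: s => //=; apply: dist_virtual. Qed.

Section Flavour.
Variable s : flavour.
Local Notation D := (dstar dist s).
Local Notation cl := (tclass (@dstar_rel C dist s)).

Definition ob_cl (X : C) : sq0 D := cl (Gen0 X).
Definition iso_cl (X X' : C) (h : hom X X') (hh : is_iso h) : sq1 D := cl (iso_term dist s hh).
Definition tri_cl T (hT : sharp_triangle dist s T) : sq1 D := cl (tri_term hT).
Definition eps_cl (X : C) : sq1 D := tri_cl (dist_sharp s (dist_eps_tri dist_tr dist_eps X)).

Local Open Scope grp_scope.

Lemma cl_rel i (u v : term C (dgen1 dist s) i) : dstar_rel u v -> cl u = cl v.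
Proof. by move=> r; apply/tclassP/teq_rel. Qed.

Lemma bdry_tri_cl T (hT : sharp_triangle dist s T) :
  bdry D (tri_cl hT) = - ob_cl (tY T) + ob_cl (tC T) + ob_cl (tX T).
Proof. by rewrite presented_bdryE (cl_rel (drel_bdry_tri hT)) !tclassD tclassN. Qed.

Lemma bdry_eps_cl X : bdry D (eps_cl X) = ob_cl X.
Proof. by rewrite bdry_tri_cl gaddN gadd0. Qed.

(** The generators of degree zero are boundaries of classes of (eps, eps, eps). *)
Lemma K0_trivial : trivial_group (K0 dist s).
Proof.
have im i (u : term C (dgen1 dist s) i) :
    match i return term C (dgen1 dist s) i -> Prop with
    | D0 => fun u => im_bdry (cl u : sq0 D) | D1 => fun _ => True end u.
  elim: u => {i} [X|x|[]|[] a IHa b IHb|[] a IHa|a IHa|a IHa b IHb] //=.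
  - by exists (eps_cl X); rewrite bdry_eps_cl.
  - exact: im_bdry0.
  - by rewrite tclassD; apply: im_bdryD.
  - by rewrite tclassN; apply: im_bdryN.
  - by exists (cl a); rewrite presented_bdryE.
elim/clsW; elim/tclassW => u; apply/clsP.
- exact: coset_rel_refl.
- exact: coset_rel_sym.
- exact: coset_rel_trans.
by rewrite /coset_rel gaddr0; apply: im_bdryN (im D0 u).
Qed.

Lemma brk0l (a : sq0 D) : brk 0 a = 0.
Proof. by apply: (@gaddI _ (brk 0 a)); rewrite -brkDl gaddr0 gaddr0. Qed.

(** The bracket with a boundary is a commutator, and that with 0 vanishes. *)
Lemma kernel_central (a b : sq1 D) : bdry D a = 0 -> a + b = b + a.
Proof.
move=> a0; have := brk_bdry a b; rewrite a0 brk0l.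
by move/esym/gcomm0.
Qed.

(** As the generator of X is the boundary of [eps_cl X], its action is conjugation
    by [eps_cl X]. *)
Lemma act_cl (c : term C (dgen1 dist s) D1) (X : C) :
  cl (act_term c (Gen0 X)) = - eps_cl X + cl c + eps_cl X.
Proof.
rewrite tclassD -presented_brkE -presented_bdryE -/(ob_cl X) -bdry_eps_cl brk_bdry.
exact: gcomm_conj.
Qed.

Lemma iso_cl_eps (X X' : C) (h : hom X X') (hh : is_iso h) :
  iso_cl hh = - eps_cl X' + eps_cl X.
Proof.
have := cl_rel (drel_tri_iso (dist_sharp s (dist_eps_tri dist_tr dist_eps X))
  (dist_sharp s (dist_eps_tri dist_tr dist_eps X')) hh hh hh _).
rewrite tclassD act_cl !tclassD tclassN -/(iso_cl hh) => e; apply: twisted_double; apply: e.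
by split; apply: ap_ext => x; rewrite !apE apZ.
Qed.

(** The class that T would have if [eps_cl] extended to a left inverse of the
    boundary map. *)
Definition euler_cl T : sq1 D := - eps_cl (tY T) + eps_cl (tC T) + eps_cl (tX T).
Definition defect T (hT : sharp_triangle dist s T) : sq1 D := tri_cl hT + - euler_cl T.

Lemma bdry_defect T (hT : sharp_triangle dist s T) : bdry D (defect hT) = 0.
Proof.
by rewrite gfunD gfunN !gfunD gfunN !bdry_eps_cl bdry_tri_cl gaddrN.
Qed.

Lemma defectC T (hT : sharp_triangle dist s T) x : defect hT + x = x + defect hT.
Proof. exact/kernel_central/bdry_defect. Qed.

Lemma tri_clE T (hT : sharp_triangle dist s T) : tri_cl hT = defect hT + euler_cl T.
Proof. by rewrite gaddNK. Qed.

Lemma defect_iso T T' (hT : sharp_triangle dist s T) (hT' : sharp_triangle dist s T') :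
  tri_iso T T' -> defect hT = defect hT'.
Proof.
move=> [a [b [c [abc ia ib ic]]]].
have := cl_rel (drel_tri_iso hT hT' ia ib ic abc).
rewrite tclassD act_cl !tclassD tclassN -/(iso_cl ia) -/(iso_cl ib) -/(iso_cl ic) -!/(tri_cl _).
rewrite !iso_cl_eps !tri_clE.
by apply: iso_cancel => z; apply: defectC.
Qed.

(** The Euler classes satisfy the octahedral relation, and defects are central. *)
Lemma defect_oct (O : octdata C) (hf : sharp_triangle dist s (tri_f O))
    (hg : sharp_triangle dist s (tri_g O)) (hgf : sharp_triangle dist s (tri_gf O))
    (ht : sharp_triangle dist s (tri_tilde O)) :
  sharp_octahedron dist s O -> defect hg + defect hf = defect hgf + defect ht.
Proof.
move=> sO; have := cl_rel (drel_oct hf hg hgf ht sO).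
rewrite 2!tclassD act_cl -!/(tri_cl _) !tri_clE.
by apply: oct_cancel => z; apply: defectC.
Qed.

Hypothesis s_dist : s <> Kv.

Lemma special_sharp O : special_octahedron dist O -> sharp_octahedron dist s O.
Proof. by case: s s_dist => //= _ [o _ _]. Qed.

(** The class of T is its Euler class. *)
Definition eulerian T : Prop := exists d : dist T, defect (dist_sharp s d) = 0.

Lemma eulerian_dist T : eulerian T -> dist T.
Proof. by case. Qed.

Lemma eulerian_iso T T' : tri_iso T T' -> eulerian T -> eulerian T'.
Proof.
move=> iso [d d0]; have d' := tr_iso dist_tr iso d.
by exists d'; rewrite -d0; apply/esym/defect_iso.
Qed.

Lemma eulerianP T (d : dist T) : eulerian T -> defect (dist_sharp s d) = 0.
Proof. by move=> [d' <-]; apply/defect_iso/tri_iso_refl. Qed.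

Lemma special_defect O : special_octahedron dist O ->
  exists (df : dist (tri_f O)) (dg : dist (tri_g O)) (dgf : dist (tri_gf O))
    (dt : dist (tri_tilde O)),
  defect (dist_sharp s dg) + defect (dist_sharp s df) =
    defect (dist_sharp s dgf) + defect (dist_sharp s dt).
Proof.
move=> sp; have [[_ [df dg dgf dt]] _ _] := sp.
by exists df, dg, dgf, dt; apply/defect_oct/special_sharp.
Qed.

Lemma eulerian_eps X : eulerian (eps_tri eps X).
Proof.
exists (dist_eps_tri dist_tr dist_eps X); rewrite /defect.
have -> : euler_cl (eps_tri eps X) = eps_cl X.
  by rewrite /euler_cl gaddN gadd0.
exact: gaddrN.
Qed.

Local Open Scope ring_scope.
Definition tri_add X Y Z B (f : hom X Y) (i : hom Y Z) (q : hom Z X) : tri C :=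
  @Tri C X (Y ⊕ B) (Z ⊕ B) (in1 ∘ f) (hom_sum i (idm B)) (q ∘ pr1).
Definition split_tri X Y : tri C := @Tri C X (X ⊕ Y) Y in1 pr2 0.

Lemma oct_add_tilde X Y Z B (f : hom X Y) (i : hom Y Z) (q : hom Z X) :
  tri_iso (tri_tilde (oct_add f i q B)) (split_tri Z B).
Proof.
apply: (tri_iso_ap (a := idm _) (a' := idm _) (b := idm _) (b' := idm _)
  (c := idm _) (c' := idm _)) => t; rewrite !apE ?ap0 //.
Qed.

(** The split triangle on X and B occurs on both sides of the octahedral relation of
    [oct_add] and cancels. *)
Lemma eulerian_add_eps X B : eulerian (tri_add B (scal eps X) (scal eps X) (scal eps X)).
Proof.
have dX := dist_eps_tri dist_tr dist_eps X.
have [df [dg [dgf [dt]]]] := special_defect (oct_add_special dist_tr dX B).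
rewrite (eulerianP df (eulerian_eps X)) gaddr0.
have -> : defect (dist_sharp s dt) = defect (dist_sharp s dg).
  exact/defect_iso/oct_add_tilde.
rewrite -[LHS]gadd0 => /gaddIr e; exists dgf; exact/esym.
Qed.

(** In [oct_eps] the three other triangles are known to be eulerian. *)
Lemma eulerian_split X Y : eulerian (split_tri X Y).
Proof.
have sp := oct_eps_special dist_tr eps_eps eps_opp dist_eps X Y.
have [df [dg [dgf [dt]]]] := special_defect sp.
rewrite (eulerianP dg (eulerian_eps _)) (eulerianP dgf) ?(eulerianP dt) ?gadd0 => [e||].
- by exists df.
- apply: eulerian_iso (eulerian_add_eps Y X).
  apply: (tri_iso_ap (a := idm _) (a' := idm _) (b := to_sum pr2 pr1) (b' := to_sum pr2 pr1)
    (c := to_sum pr2 pr1) (c' := to_sum pr2 pr1)) => t; rewrite !apE //; by case: t.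
apply: eulerian_iso (eulerian_add_eps X Y).
apply: (tri_iso_ap (a := idm _) (a' := idm _) (b := idm _) (b' := idm _)
    (c := idm _) (c' := idm _)) => t; rewrite !apE //.
by congr (_, _); rewrite /= scaler0.
Qed.

Lemma eulerian_add X Y Z B (f : hom X Y) (i : hom Y Z) (q : hom Z X) :
  dist (@Tri C X Y Z f i q) ->
  eulerian (tri_add B f i q) <-> eulerian (@Tri C X Y Z f i q).
Proof.
move=> d; have [df [dg [dgf [dt]]]] := special_defect (oct_add_special dist_tr d B).
rewrite (eulerianP dg (eulerian_split _ _)) (eulerianP dt) ?gadd0 ?gaddr0 => [e|].
  split=> g; first by exists df; rewrite e (eulerianP dgf).
  by exists dgf; rewrite -e (eulerianP df).
by apply: eulerian_iso (eulerian_split Z B); apply: tri_iso_sym; apply: oct_add_tilde.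
Qed.

Lemma eulerian_composite0 X Y Z (f : hom X Y) (i : hom Y Z) (q : hom Z X) :
  dist (@Tri C X Y Z f i q) ->
  eulerian (tri_gf (oct_rot f i q)) <-> eulerian (@Tri C X Z (Z ⊕ X) 0 in1 pr2).
Proof.
move=> d; have iso : tri_iso (tri_gf (oct_rot f i q)) (@Tri C X Z (Z ⊕ X) 0 in1 pr2).
  apply: (tri_iso_ap (a := idm _) (a' := idm _) (b := idm _) (b' := idm _)
    (c := idm _) (c' := idm _)) => t; rewrite !apE //.
  by rewrite (dist_if dist_tr d).
by split; apply: eulerian_iso; last exact: tri_iso_sym.
Qed.

Lemma eulerian_rot_tilde X Y Z (f : hom X Y) (i : hom Y Z) (q : hom Z X) :
  dist (@Tri C X Y Z f i q) -> eulerian (tri_tilde (oct_rot f i q)).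
Proof.
move=> d; apply: eulerian_iso (eulerian_split Z X).
apply: (tri_iso_ap (a := idm _) (a' := idm _) (b := to_sum pr1 (of_sum q (- idm _)))
  (b' := to_sum pr1 (of_sum q (- idm _))) (c := idm _) (c' := idm _)) => t; rewrite !apE //=.
- by case: t => z x; rewrite /= opprB addrCA subrr addr0.
- by case: t => z x; rewrite /= opprB addrCA subrr addr0.
- by rewrite oppr0 addr0.
- by rewrite opprB addrCA subrr addr0.
- by rewrite apN (dist_if dist_tr d) oppr0.
Qed.

(** For X = Z this is the third triangle of [oct_rot] applied to (eps, eps, eps).
    In general both triangles come from X -> 0 -> X by the addition of a summand. *)
Lemma eulerian_zero X Z : eulerian (@Tri C X Z (Z ⊕ X) 0 in1 pr2).
Proof.
have dX := dist_eps_tri dist_tr dist_eps X.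
have gg : eulerian (@Tri C X X X (scal eps X) (scal eps X) (- scal eps X)).
  apply: eulerian_iso (eulerian_eps X).
  apply: (tri_iso_ap (a := idm _) (a' := idm _) (b := idm _) (b' := idm _)
    (c := idm _) (c' := idm _)) => t; rewrite !apE //.
  by rewrite -scaleNr eps_opp.
have gXX : eulerian (@Tri C X X (X ⊕ X) 0 in1 pr2).
  apply/(eulerian_composite0 dX).
  have [df [dg [dgf [dt]]]] := special_defect (oct_rot_special dist_tr dX).
  rewrite (eulerianP dg gg) (eulerianP df (eulerian_eps X)).
  rewrite (eulerianP dt (eulerian_rot_tilde dX)) !gaddr0 => e.
  by exists dgf.
have gX0 : eulerian (@Tri C X zob (zob ⊕ X) 0 in1 pr2).
  apply/(eulerian_add X (dist_zero dist_tr X zob)); apply: eulerian_iso gXX.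
  apply: (tri_iso_ap (a := idm _) (a' := idm _) (b := in2) (b' := pr2)
    (c := to_sum (to_sum 0 pr2) pr1) (c' := to_sum pr2 (pr2 ∘ pr1))) => t; rewrite !apE //=.
  - by case: t => z x; rewrite [z]zobE.
  - by case: t.
  - by case: t => [[z x] y]; rewrite [z]zobE.
have := (eulerian_add Z (dist_zero dist_tr X zob)).2 gX0; apply: eulerian_iso.
apply: (tri_iso_ap (a := idm _) (a' := idm _) (b := pr2) (b' := in2)
    (c' := to_sum (to_sum 0 pr2) pr1) (c := to_sum pr2 (pr2 ∘ pr1))) => t; rewrite !apE //=.
- by case: t => z x; rewrite [z]zobE.
- by case: t => [[z x] y]; rewrite [z]zobE.
- by case: t.
Qed.

(** In [oct_rot] the third and fourth triangles split, so the defects of a triangle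
    and of its rotation are opposite. *)
Lemma eulerian_rot X Y Z (f : hom X Y) (i : hom Y Z) (q : hom Z X) :
  eulerian (@Tri C X Y Z f i q) -> eulerian (@Tri C Y Z X i q (- f)).
Proof.
move=> g; have d := eulerian_dist g.
have [df [dg [dgf [dt]]]] := special_defect (oct_rot_special dist_tr d).
rewrite (eulerianP df g) (eulerianP dt (eulerian_rot_tilde d)) (eulerianP dgf) ?gaddr0 => [e|].
  by exists dg.
exact/(eulerian_composite0 d)/eulerian_zero.
Qed.

Definition eulerian_hom X Y (f : hom X Y) : Prop :=
  exists Z (i : hom Y Z) (q : hom Z X), eulerian (@Tri C X Y Z f i q).

Lemma eulerian_hom_iso X Y X' Y' (f : hom X Y) (f' : hom X' Y')
    (a : hom X X') (a' : hom X' X) (b : hom Y Y') (b' : hom Y' Y) :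
  cancel (ap a) (ap a') -> cancel (ap a') (ap a) ->
  cancel (ap b) (ap b') -> cancel (ap b') (ap b) ->
  (forall x, ap b (ap f x) = ap f' (ap a x)) -> eulerian_hom f -> eulerian_hom f'.
Proof.
move=> aK a'K bK b'K e [Z [i [q g]]]; exists Z, (i ∘ b'), (a ∘ q).
apply: eulerian_iso g; apply: (tri_iso_ap (c := idm _) (c' := idm _) aK a'K bK b'K) => // t;
  by rewrite !apE ?bK.
Qed.

Lemma eulerian_hom_eps X : eulerian_hom (scal eps X).
Proof. by exists X, (scal eps X), (scal eps X); apply: eulerian_eps. Qed.

Lemma eulerian_hom_in1 X Y B (f : hom X Y) :
  eulerian_hom f -> eulerian_hom (in1 ∘ f : hom X (Y ⊕ B)).
Proof.
move=> [Z [i [q g]]]; exists (Z ⊕ B), (hom_sum i (idm B)), (q ∘ pr1).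
exact/(eulerian_add B (eulerian_dist g)).
Qed.

(** The summand B is added to the rotated triangle, whose third term is the source
    of f; two more rotations bring this term back to the first place. *)
Lemma eulerian_hom_pr1 X Y B (f : hom X Y) :
  eulerian_hom f -> eulerian_hom (f ∘ pr1 : hom (X ⊕ B) Y).
Proof.
move=> [Z [i [q /eulerian_rot g]]].
have /eulerian_rot/eulerian_rot g' := (eulerian_add B (eulerian_dist g)).2 g.
apply: (@eulerian_hom_iso _ _ _ _ (- f ∘ pr1) _ (idm _) (idm _) (- idm _) (- idm _))
  => [t|t|t|t|t|].
- by rewrite !apE.
- by rewrite !apE.
- by rewrite !apE opprK.
- by rewrite !apE opprK.
- by rewrite !apE opprK.
by eexists; eexists; eexists; exact: g'.
Qed.

Lemma eulerian_hom_sum X Y A (f : hom X Y) : eulerian_hom f -> eulerian_hom (hom_sum f (idm A)).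
Proof.
move=> [Z [i [q /eulerian_rot/eulerian_rot g]]].
have /eulerian_rot g' := (eulerian_add A (eulerian_dist g)).2 g.
apply: (@eulerian_hom_iso _ _ _ _ (hom_sum (- f) (idm A)) _ (hom_sum (- idm _) (idm _))
  (hom_sum (- idm _) (idm _)) (idm _) (idm _)) => [t|t|t|t|t|].
- by rewrite !apE opprK; case: t.
- by rewrite !apE opprK; case: t.
- by rewrite !apE.
- by rewrite !apE.
- by rewrite !apE apN.
by eexists; eexists; eexists; exact: g'.
Qed.

Definition rV n : C := ('rV[R]_n : vectType R).

Definition mx_hom m n (F : 'M[R]_(m, n)) : hom (rV m) (rV n) :=
  @mkhom R (rV m) (rV n) (mulmxr F).

Lemma ap_mx_hom m n (F : 'M[R]_(m, n)) x : ap (mx_hom F) x = x *m F.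
Proof. exact: ap_mkhom. Qed.

Lemma mx_homK n (L L' : 'M[R]_n) : L *m L' = 1%:M -> cancel (ap (mx_hom L)) (ap (mx_hom L')).
Proof. by move=> LL' x; rewrite !ap_mx_hom -mulmxA LL' mulmx1. Qed.

Lemma eulerian_mx_hom m n (F : 'M[R]_(m, n)) : eulerian_hom (mx_hom F).
Proof.
apply: (@smith_ind R eps k res eps_sqr res_surj res_ker
  (fun m n F => eulerian_hom (mx_hom F))) => {m n F} [|r s1 m n].
  move=> m' n' L L' U U' F [LL' L'L] [UU' U'U] g.
  apply: (@eulerian_hom_iso _ _ _ _ (mx_hom F) _ (mx_hom L') (mx_hom L)
    (mx_hom U) (mx_hom U') _ _ _ _ _ g);
   try exact: mx_homK.
  by move=> x; rewrite !ap_mx_hom !mulmxA -(mulmxA x L') L'L mulmx1.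
have := eulerian_hom_sum (rV r)
  (eulerian_hom_pr1 (rV m) (eulerian_hom_in1 (rV n) (eulerian_hom_eps (rV s1)))).
pose a p q (t : 'rV[R]_p * 'rV[R]_q * 'rV[R]_r) := row_mx t.2 (row_mx t.1.1 t.1.2).
have aP p q : linear (@a p q).
  by move=> c x y; rewrite /a /= -!add_row_mx !scale_row_mx add_row_mx.
pose a' p q (v : 'rV[R]_(r + (p + q))) : 'rV[R]_p * 'rV[R]_q * 'rV[R]_r :=
  (lsubmx (rsubmx v), rsubmx (rsubmx v), lsubmx v).
have aK p q : cancel (@a p q) (@a' p q).
  by move=> [[x y] z]; rewrite /a' /a !(row_mxKl, row_mxKr).
have a'K p q : cancel (@a' p q) (@a p q) by move=> v; rewrite /a' /a !hsubmxK.
pose A p q : hom (rV p ⊕ rV q ⊕ rV r) (rV (r + (p + q))) :=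
  @mkhom R (rV p ⊕ rV q ⊕ rV r) (rV (r + (p + q))) (lin (aP p q)).
pose A' p q : hom (rV (r + (p + q))) (rV p ⊕ rV q ⊕ rV r) :=
  @mkhom R (rV (r + (p + q))) (rV p ⊕ rV q ⊕ rV r)
    (lin (can2_linear (f := lin (aP p q)) (aK p q) (a'K p q))).
apply: (eulerian_hom_iso (a := A s1 m) (a' := A' s1 m) (b := A s1 n) (b' := A' s1 n))
  => [t|t|t|t|t].
- by rewrite !ap_mkhom /= aK.
- by rewrite !ap_mkhom /= a'K.
- by rewrite !ap_mkhom /= aK.
- by rewrite !ap_mkhom /= a'K.
rewrite ap_mx_hom [ap (hom_sum _ _) t]ap_hom_sum !apE !ap_mkhom /= /a /=.
rewrite mul_row_block mulmx1 !mulmx0 addr0 add0r.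
rewrite -scalemxAr pid_mx_block mul_row_block !mulmx0 mulmx1 !addr0 scale_row_mx scaler0.
by [].
Qed.

Lemma eulerian_hom_all X Y (f : hom X Y) : eulerian_hom f.
Proof.
pose r2 (W : C) : hom (rV (dim (W : vectType R))) W := @mkhom R (rV (dim (W : vectType R))) W r2v.
pose v2 (W : C) : hom W (rV (dim (W : vectType R))) := @mkhom R W (rV (dim (W : vectType R))) v2r.
have rK W : cancel (ap (r2 W)) (ap (v2 W)) by move=> x; rewrite !ap_mkhom; apply: r2vK.
have vK W : cancel (ap (v2 W)) (ap (r2 W)) by move=> x; rewrite !ap_mkhom; apply: v2rK.
pose g : 'rV[R]_(dim (X : vectType R)) -> 'rV[R]_(dim (Y : vectType R)) :=
  ap (v2 Y ∘ f ∘ r2 X).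
have gP : linear g by move=> c x y; rewrite /g apD apZ.
apply: eulerian_hom_iso (eulerian_mx_hom (lin1_mx (lin gP))); first exact: rK.
- exact: vK.
- exact: rK.
- exact: vK.
by move=> x; rewrite ap_mx_hom mul_rV_lin1 /= /g !ap_cmp vK.
Qed.

(** The class of maps with an eulerian cone contains eps and is stable under the
    operations of the Smith normal form. *)
Lemma dist_eulerian T : dist T -> eulerian T.
Proof.
case: T => X Y Z f i q d; have [Z' [i' [q' g]]] := eulerian_hom_all f.
exact: eulerian_iso (cone_unique dist_tr (eulerian_dist g) d) g.
Qed.

Lemma sharp_dist T : sharp_triangle dist s T -> dist T.
Proof. by case: s s_dist. Qed.

Local Open Scope grp_scope.

Lemma tri_cl_euler_cl T (hT : sharp_triangle dist s T) : tri_cl hT = euler_cl T.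
Proof.
have d := sharp_dist hT.
rewrite tri_clE (defect_iso hT (dist_sharp s d) (tri_iso_refl T)).
by rewrite (eulerianP d (dist_eulerian d)) gadd0.
Qed.

(** The group of degree one over itself.  The morphism to it that extends [eps_cl]
    is the identity in degree one, and thereby a left inverse of the boundary. *)
Definition commutator_sqmod : sqmod.
Proof.
refine (@SQMod (sq1 D) (sq1 D) (@GHom (sq1 D) (sq1 D) id (fun _ _ => erefl))
  (fun a b => brk (bdry D a) (bdry D b)) _ _ _ _ _) => [a b c|a b c|a b|a b|a b].
- by rewrite gfunD brkDl.
- by rewrite gfunD brkDr.
- exact: brk_anti.
- exact: brk_bdry.
- exact: brk_bdry.
Defined.

Local Notation ev :=
  (@eval_term C (dgen1 dist s) commutator_sqmod eps_cl (fun x => cl (Gen1 x))).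

(** The morphism is the identity in degree one, and the boundary undoes it in
    degree zero. *)
Lemma ev_cl i (u : term C (dgen1 dist s) i) :
  match i return term C (dgen1 dist s) i -> sq commutator_sqmod i -> Prop with
  | D0 => fun u e => bdry D e = cl u | D1 => fun u e => e = cl u end u (ev u).
Proof.
elim: u => {i} [X|x|[]|[] a IHa b IHb|[] a IHa|a IHa|a IHa b IHb] /=.
- exact: bdry_eps_cl.
- by [].
- exact: (gfun0 (bdry D)).
- by [].
- by rewrite tclassD -IHa -IHb; apply: (gfunD (bdry D)).
- by rewrite tclassD -IHa -IHb.
- by rewrite tclassN -IHa; apply: (gfunN (bdry D)).
- by rewrite tclassN -IHa.
- by rewrite IHa; apply: presented_bdryE.
- by have := presented_brkE (@dstar_rel C dist s) a b; rewrite -IHa -IHb => <-.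
Qed.

Lemma eps_cl_zob : eps_cl zob = 0.
Proof.
have d : dist (Tri (idm zob) (0 : hom zob zob) 0) := tr_id dist_tr zob.
apply: etrans (cl_rel (drel_tri1 (dist_sharp s d))).
by rewrite -/(tri_cl _) tri_cl_euler_cl /euler_cl gaddN gadd0.
Qed.

(** In degree one, where the morphism is the identity, the relations hold already.
    The two families of relations on boundaries say that isomorphisms and
    triangles have the expected classes. *)
Lemma ev_rel i (u v : term C (dgen1 dist s) i) : dstar_rel u v -> ev u = ev v.
Proof.
move=> r; have := cl_rel r.
have D1case (a b : term C (dgen1 dist s) D1) : cl a = cl b -> ev a = ev b.
  by move=> e; rewrite (ev_cl a) (ev_cl b) e.
case: r => //; try by move=> *; apply: D1case.
- by move=> X X' h hh _; apply: iso_cl_eps.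
- by move=> T hT _; apply: tri_cl_euler_cl.
- by move=> _; apply: eps_cl_zob.
Qed.

Lemma K1_trivial : trivial_group (K1 dist s).
Proof.
case=> x; elim/tclassW: x => u u0; apply: sval_inj => /=.
have /tclassP/(eval_term_eq ev_rel)/= := etrans (esym (presented_bdryE _ u)) u0.
by rewrite -(ev_cl u).
Qed.

End Flavour.
End KTheory.

(** * Square classes *)

Section SquareClasses.
Variable k : fieldType.
Local Notation Q := (units_mod_squares k).
Let qcl (u : units_group k) : Q := cls (coset_rel (squares k)) u.

(** To be total, it sends 0 to the class of 1. *)
Definition sqclass (m : k) : Q := qcl (insubd (Units (unitr1 k)) m).

Lemma qclP (u v : units_group k) : qcl u = qcl v <-> is_square (- u + v)%grp.
Proof. by apply: clsP; [exact: coset_rel_refl|exact: coset_rel_sym|exact: coset_rel_trans]. Qed.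

Lemma qclD (u v : units_group k) : (qcl u + qcl v = qcl (u + v))%grp.
Proof.
by apply: quot_addE; [exact: coset_rel_refl|exact: coset_rel_sym|exact: coset_rel_trans|
  exact: coset_rel_add].
Qed.

Lemma sqclassM (m m' : k) : m != 0 -> m' != 0 -> sqclass (m * m') = (sqclass m + sqclass m')%grp.
Proof.
move=> m0 m'0; rewrite qclD; congr qcl; apply: val_inj.
by rewrite /= !insubdK // ?unitfE ?mulf_neq0.
Qed.

Lemma sqclass_sq (c : k) : c != 0 -> sqclass (c ^+ 2) = 0%grp.
Proof.
move=> c0; apply/esym/qclP; rewrite gopp0 gadd0.
exists (insubd (Units (unitr1 k)) c); apply: val_inj.
by rewrite /= !insubdK // ?unitfE ?expf_neq0.
Qed.

Lemma sqclass1 : sqclass 1 = 0%grp.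
Proof. by rewrite -[1](expr1n k 2) sqclass_sq ?oner_neq0. Qed.

Lemma sqclassC (x y : Q) : (x + y = y + x)%grp.
Proof. by elim/clsW: x => x; elim/clsW: y => y; rewrite -!/(qcl _) !qclD unitsC. Qed.

Lemma sqclass_dbl (x : Q) : (x + x = 0)%grp.
Proof.
elim/clsW: x => x; rewrite -/(qcl _) qclD; apply/esym/qclP.
by rewrite gopp0 gadd0; exists x.
Qed.

Lemma sqclass_surj (x : Q) : exists m, m != 0 /\ x = sqclass m.
Proof.
elim/clsW: x => x; exists (val x); split; first by rewrite -unitfE (valP x).
by congr qcl; apply: val_inj; rewrite insubdK // (valP x).
Qed.

(** The square classes in degree one and the trivial group in degree zero, so that a
    morphism to it is an additive function of triangles that kills isomorphisms. *)
Definition sqclass_sqmod : sqmod.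
Proof.
pose U := @Group unit (fun _ _ => tt) tt id (fun _ _ _ => erefl)
  (fun x => match x with tt => erefl end) (fun x => match x with tt => erefl end)
  (fun _ => erefl) (fun _ => erefl).
refine (@SQMod U Q (@GHom Q U (fun _ => tt) (fun _ _ => erefl)) (fun _ _ => 0%grp) _ _ _ _ _)
  => [a b c|a b c|a b|a b|x y].
- by rewrite gadd0.
- by rewrite gadd0.
- by rewrite gadd0.
- by [].
- by rewrite /gcomm -gaddA (sqclassC y x) gaddA gaddNK gaddN.
Defined.

End SquareClasses.

(** * The determinant of a virtual triangle *)

Section Virtual.
Variable R : comNzRingType.
Local Notation C := (free_modules_susp R).
Variable dist : tri C -> Prop.
Hypothesis dist_tr : triangulated dist.
Variables (eps : R) (k : fieldType) (res : {rmorphism R -> k}).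
Hypotheses (eps_neq0 : eps != 0) (eps_sqr : eps ^+ 2 = 0).
Hypothesis res_surj : forall y : k, exists x : R, res x = y.
Hypothesis res_ker : forall x : R, (res x == 0) = (x \in principal_ideal eps).
Hypothesis k_char2 : 2%N \in [pchar k].

(** The triangle as an ungraded differential module. *)
Definition total_diff (T : tri C)
    (t : ((tX T : vectType R) * (tY T : vectType R) * (tC T : vectType R))%type) :
    ((tX T : vectType R) * (tY T : vectType R) * (tC T : vectType R))%type :=
  (ap (tq T) t.2, ap (tf T) t.1.1, ap (ti T) t.1.2).

Fact total_diff_linear T : linear (@total_diff T).
Proof. by move=> c x y; congr (_, _, _); rewrite /= apD apZ. Qed.

Definition exact_at (X Y Z : C) (f : hom X Y) (i : hom Y Z) : Prop :=
  forall y, ap i y = 0 -> exists x, y = ap f x.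

Lemma dist_exact_at (X Y Z : C) (f : hom X Y) (i : hom Y Z) q :
  dist (@Tri C X Y Z f i q) -> exact_at f i.
Proof.
move=> d y iy; pose gy (r : R^o) : (Y : vectType R) := r *: y.
have gP : linear gy by move=> c u v; rewrite /gy scalerDl scalerA.
pose Ro : C := (R^o : vectType R).
pose g : hom Ro Y := @mkhom R Ro Y (lin gP).
have [|u gu] := dist_wker dist_tr (e := g) d.
  by apply: ap_ext => r; rewrite ap_cmp ap_mkhom /= /gy apZ iy scaler0 ap_0m.
exists (ap u (1 : R^o)); rewrite -ap_cmp -gu ap_mkhom /= /gy scale1r.
by [].
Qed.

(** Exactness at each of the three terms involves only two consecutive maps, and
    each pair of them belongs to a distinguished triangle in which the other map
    has been replaced. *)
Lemma virtual_exact (T : tri C) : virtual dist T -> exact_dm (@total_diff T).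
Proof.
case: T => X Y Z f i q [tr [K [X' [Y' [Z' [f' [i' [q' [_ iso [f'' d1] [i'' d2] [q'' d3]]]]]]]]]].
have ex1 : exact_at f' i' := dist_exact_at d3.
have ex2 : exact_at i' q' := dist_exact_at (dist_rot dist_tr d1).
have ex3 : exact_at q' (- f') := dist_exact_at (dist_rot dist_tr (dist_rot dist_tr d2)).
have [a [b [c [[e1 e2 e3] ia ib ic]]]] := iso.
have [a' [aK a'K]] := is_iso_ap ia; have [b' [bK b'K]] := is_iso_ap ib.
have [c' [cK c'K]] := is_iso_ap ic.
have E1 x : ap b (ap (tf (tri_sum (Tri f i q) K)) x) = ap f' (ap a x).
  by rewrite -!ap_cmp e1.
have E2 x : ap c (ap (ti (tri_sum (Tri f i q) K)) x) = ap i' (ap b x).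
  by rewrite -!ap_cmp e2.
have E3 x : ap a (ap (tq (tri_sum (Tri f i q) K)) x) = ap q' (ap c x).
  by rewrite -!ap_cmp -e3.
have [t1 t2 t3] := tr.
split=> [[[x y] z]|[[x y] z]]; rewrite /total_diff /=.
  by congr (_, _, _); rewrite -ap_cmp ?t1 ?[X in ap X _]t2 ?[X in ap X _]t3 ap_0m.
case=> qz fx iy.
have [|y0] := ex1 (ap b (y, 0)).
  by rewrite -E2 /= ap_hom_sum /= iy ap0; apply: ap0.
rewrite -(a'K y0) -E1 => /(can_inj bK); case: (ap a' y0) => x1 k1.
rewrite /= ap_hom_sum => -[-> _].
have [|z0] := ex2 (ap c (z, 0)).
  rewrite -E3 /= ap_cmp ap_of_sum ap_hom_sum /= [ap q z]qz !ap0 addr0; apply: ap0.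
rewrite -(b'K z0) -E2 => /(can_inj cK); case: (ap b' z0) => y2 k2.
rewrite /= ap_hom_sum => -[-> _].
have [|x0] := ex3 (ap a (x, 0)).
  rewrite ap_oppm -E1 /= ap_hom_sum /= fx ap0.
  by apply/eqP; rewrite oppr_eq0; apply/eqP; apply: ap0.
rewrite -(c'K x0) -E3 => /(can_inj aK); case: (ap c' x0) => z3 k3.
rewrite /= ap_cmp ap_of_sum ap_hom_sum /= !ap_smap ap_in1 ap_in2 => -[-> _].
by exists (x1, y2, z3); congr (_, _, _); rewrite /= addr0.
Qed.

Local Notation hdet := (has_hdet eps res).

Lemma virtual_hdet (T : tri C) : virtual dist T -> exists m, hdet (@total_diff T) m.
Proof.
move=> /virtual_exact ex.
pose V : vectType R := ((tX T : vectType R) * (tY T : vectType R) * (tC T : vectType R))%type.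
have iso : dm_iso (@total_diff T : V -> V) (fun v => v2r (total_diff (r2v v : V)) : 'rV[R]_(dim V)).
  exists (v2r : {linear V -> 'rV[R]_(dim V)}), r2v; split=> [x|x|x].
  - exact: v2rK.
  - exact: r2vK.
  - by congr (v2r (total_diff _)); apply/esym/v2rK.
have dP : linear (fun v => v2r (total_diff (r2v v : V)) : 'rV[R]_(dim V)).
  by move=> c x y; rewrite linearP total_diff_linear linearP.
have [m v] := exact_hdet eps_sqr res_surj res_ker (d := lin dP) (exact_dm_iso iso ex).
by exists m; apply: hdet_iso iso v.
Qed.

Lemma total_diff_iso (T T' : tri C) : tri_iso T T' -> dm_iso (@total_diff T) (@total_diff T').
Proof.
move=> [a [b [c [[e1 e2 e3] ia ib ic]]]].
have [a' [aK a'K]] := is_iso_ap ia; have [b' [bK b'K]] := is_iso_ap ib.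
have [c' [cK c'K]] := is_iso_ap ic.
pose g (t : (tX T : vectType R) * (tY T : vectType R) * (tC T : vectType R)) :
  ((tX T' : vectType R) * (tY T' : vectType R) * (tC T' : vectType R)) :=
  (ap a t.1.1, ap b t.1.2, ap c t.2).
have gP : linear g by move=> r x y; congr (_, _, _); rewrite /= apD apZ.
exists (lin gP), (fun t => (ap a' t.1.1, ap b' t.1.2, ap c' t.2)).
split=> [[[x y] z]|[[x y] z]|[[x y] z]]; rewrite /= /g /total_diff /=.
- by rewrite aK bK cK.
- by rewrite a'K b'K c'K.
- congr (_, _, _); first by rewrite -(ap_smap a) -!ap_cmp e3.
    by rewrite -!ap_cmp e1.
  by rewrite -!ap_cmp e2.
Qed.

Lemma add_disk_swap (U U' V : lmodType R) (e : V -> V) :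
  dm_iso (@add_disk R U _ (@add_disk R U' V e)) (@add_disk R U' _ (@add_disk R U V e)).
Proof.
pose g (t : U * U * (U' * U' * V)) : U' * U' * (U * U * V) := (t.2.1, (t.1, t.2.2)).
have gP : linear g by [].
exists (lin gP), (fun t => (t.2.1, (t.1, t.2.2))).
by split=> [[[u w] [[u' w'] v]]|[[u w] [[u' w'] v]]|].
Qed.

(** Adding the missing disk to either side makes the modules isomorphic. *)
Lemma add_disk_hdet_uniq (U U' V : lmodType R) (e : V -> V) m m' :
  hdet (@add_disk R U V e) m -> hdet (@add_disk R U' V e) m' -> m = m'.
Proof.
move=> v1 v2; have v := hdet_add_disk U' v1; have v' := hdet_add_disk U v2.
by apply: (hdet_uniq eps_neq0 eps_sqr res_surj res_ker v); apply: hdet_iso (add_disk_swap _ _ _) v'.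
Qed.

Section VirtualOctahedron.
Variable O : octdata C.
Hypothesis Odiag : octahedral_diagram O.
Local Notation X := (oX O : vectType R).
Local Notation Y := (oY O : vectType R).
Local Notation Z := (oZ O : vectType R).
Local Notation F := (oF O : vectType R).
Local Notation G := (oG O : vectType R).
Local Notation H := (oH O : vectType R).

(** The total differential of the first triangle in the definition of a special
    octahedron. *)
Definition special_dm (t : (Y * F) * (Z * H)) : (Y * F) * (Z * H) :=
  (ap (o_f O) (ap (oqh O) t.2.2), - ap (oif O) t.1.1,
   (ap (o_g O) t.1.1, ap (ogbar O) t.1.2 + ap (oih O) t.2.1)).

Let tl (T : tri C) := lin (@total_diff_linear T).
Fact opp_linear (V W : lmodType R) (f : {linear V -> W}) : linear (fun x => - f x).
Proof. by move=> c x y; rewrite linearP opprD scalerN. Qed.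
Let Nl (T : tri C) := lin (opp_linear (tl T)).

Let totN (T : tri C) t : total_diff (- t) = - @total_diff T t.
Proof. exact: (linearN (tl T)). Qed.

Let tri0 (T : tri C) t : is_triangle T -> total_diff (@total_diff T t) = 0.
Proof.
case=> t1 t2 t3; case: t => [[x y] z]; congr (_, _, _); rewrite /= -ap_cmp.
- by rewrite t2 ap_0m.
- by have -> : tf T ∘ tq T = 0 by []; rewrite ap_0m.
- by rewrite t1 ap_0m.
Qed.

Definition oct_map_f (t : X * Y * F) : X * Z * H := (t.1.1, ap (o_g O) t.1.2, ap (ogbar O) t.2).
Fact oct_map_f_linear : linear oct_map_f.
Proof. by move=> c x y; congr (_, _, _); rewrite /= apD apZ. Qed.

Lemma oct_map_f_chain t :
  oct_map_f (- total_diff (T := tri_f O) t) + total_diff (T := tri_gf O) (oct_map_f t) = 0.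
Proof.
have [_ [e1 e2 e3 e4]] := Odiag; case: t => [[x y] z].
congr (_, _, _); rewrite /= ?apN -?ap_cmp -?e2 ?e1 ?addNr //.
Qed.

Definition oct_map_g (t : Y * Z * G) : F * H * G := (ap (oif O) t.1.1, ap (oih O) t.1.2, t.2).
Fact oct_map_g_linear : linear oct_map_g.
Proof. by move=> c x y; congr (_, _, _); rewrite /= apD apZ. Qed.

Lemma oct_map_g_chain t :
  oct_map_g (total_diff (T := tri_g O) t) - total_diff (T := tri_tilde O) (oct_map_g t) = 0.
Proof.
have [_ [e1 e2 e3 e4]] := Odiag; case: t => [[x y] z].
congr (_, _, _); rewrite /= -?ap_cmp -?e3 ?e1 ?subrr //.
Qed.

Let Odist : [/\ is_triangle (tri_f O), is_triangle (tri_g O), is_triangle (tri_gf O)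
  & is_triangle (tri_tilde O)] := Odiag.1.

Let cone_f := lin (cone_linear (Nl (tri_f O)) (tl (tri_gf O)) (lin oct_map_f_linear)).
Let cone_g := lin (cone_linear (tl (tri_g O)) (Nl (tri_tilde O)) (lin oct_map_g_linear)).

(** The cone of T_f -> T_gf, with the sign on T_f, contains the identity of X as a
    pivot; its Schur complement replaces the arrow H -> X by f q_gf : H -> Y. *)
Lemma cone_f_split : dm_iso (@add_disk R X _ special_dm) cone_f.
Proof.
have [tf tg tgf tt] := Odist.
have aP : linear (fun x : X => ((x, 0, 0), 0) : (X * Y * F) * (X * Z * H)).
  by move=> c x y; congr (_, _, _, _); rewrite /= scaler0 addr0.
have bP : linear (fun t : (X * Y * F) * (X * Z * H) => t.2.1.1) by [].
have jP : linear (fun v : (Y * F) * (Z * H) =>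
    ((0, v.1.1, v.1.2), (0, v.2.1, v.2.2)) : (X * Y * F) * (X * Z * H)).
  by move=> c x y; congr ((_, _, _), (_, _, _)); rewrite /= scaler0 addr0.
have pP : linear (fun t : (X * Y * F) * (X * Z * H) =>
    ((t.1.1.2, t.1.2), (t.2.1.2, t.2.2)) : (Y * F) * (Z * H)) by [].
apply: dm_iso_sym.
have -> : special_dm = schur cone_f (lin aP) (lin bP) (lin jP) (lin pP).
  apply/funext => -[[y F'] [z h]].
  congr ((_, _), (_, _)); rewrite /= ?ap0 ?addr0 ?subr0 ?add0r ?apN ?opprK //.
  by rewrite [X in _ + X]ap0 addr0.
apply: split_off.
- move=> t; apply: cone_sq => [x|x|x].
  + by rewrite /= totN opprK tri0.
  + exact: tri0.
  + exact: oct_map_f_chain.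
- by move=> x; rewrite /= !ap0 addr0.
- by [].
- by [].
- by [].
- by case=> [[? ?] [? ?]].
case=> [[[x y] z] [[x' z'] h]] /= ->; exists x.
by congr ((_, _, _), (_, _, _)); rewrite /= ?addr0 ?add0r.
Qed.

(** The cone of T_g -> T~, with the sign on T~, contains the identity of G as a
    pivot.  The coordinate on F is negated so as to match the signs of the other
    cone. *)
Lemma cone_g_split : dm_iso (@add_disk R G _ special_dm) cone_g.
Proof.
have [tf tg tgf tt] := Odist; have [_ [e1 e2 e3 e4]] := Odiag.
have aP : linear (fun x : G => ((0, 0, x), 0) : (Y * Z * G) * (F * H * G)).
  by move=> c x y; congr (_, _, _, _); rewrite /= scaler0 addr0.
have bP : linear (fun t : (Y * Z * G) * (F * H * G) => t.2.2) by [].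
have jP : linear (fun v : (Y * F) * (Z * H) =>
    ((v.1.1, v.2.1, 0), (- v.1.2, v.2.2, 0)) : (Y * Z * G) * (F * H * G)).
  by move=> c x y; congr ((_, _, _), (_, _, _)); rewrite /= ?scaler0 ?addr0 // opprD scalerN.
have pP : linear (fun t : (Y * Z * G) * (F * H * G) =>
    ((t.1.1.1, - t.2.1.1), (t.1.1.2, t.2.1.2)) : (Y * F) * (Z * H)).
  by move=> c x y; congr ((_, _), (_, _)); rewrite /= ?opprD ?scalerN.
apply: dm_iso_sym.
have -> : special_dm = schur cone_g (lin aP) (lin bP) (lin jP) (lin pP).
  apply/funext => -[[y F'] [z h]].
  congr ((_, _), (_, _)); rewrite /= ?ap0 ?addr0 ?subr0 ?add0r ?apN ?opprK //.
  - by rewrite -[RHS]ap_cmp e4 ap_cmp.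
  - by rewrite [X in _ - X]ap0 subr0.
  - by rewrite addrC.
apply: split_off.
- move=> t; apply: cone_sq => [x|x|x].
  + exact: tri0.
  + by rewrite /= totN opprK tri0.
  + exact: oct_map_g_chain.
- by move=> x; rewrite /= !ap0 oppr0 addr0.
- by [].
- by [].
- by move=> x; rewrite /= oppr0.
- by case=> [[y x] [z h]]; rewrite /= opprK.
case=> [[[y z] x] [[x' h] x'']] /= ->; exists x.
by congr ((_, _, _), (_, _, _)); rewrite /= ?opprK ?addr0 ?add0r.
Qed.

(** Up to squares the determinants of both cones are that of [special_dm], so
    mf mgf and mg mt agree; square classes have order at most 2. *)
Lemma octahedron_hdet mf mg mgf mt :
  hdet (@total_diff (tri_f O)) mf -> hdet (@total_diff (tri_g O)) mg ->
  hdet (@total_diff (tri_gf O)) mgf -> hdet (@total_diff (tri_tilde O)) mt ->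
  (sqclass mg + sqclass mf = sqclass mgf + sqclass mt)%grp.
Proof.
move=> vf vg vgf vt.
have [c [m [c0 mc /(hdet_iso cone_f_split) v]]] := hdet_cone eps_neq0 eps_sqr res_surj res_ker
  k_char2 (d1 := Nl (tri_f O)) (d2 := tl (tri_gf O)) (f := lin oct_map_f_linear) oct_map_f_chain
  (hdet_opp k_char2 vf) vgf.
have [c' [m' [c'0 mc' /(hdet_iso cone_g_split) v']]] := hdet_cone eps_neq0 eps_sqr res_surj res_ker
  k_char2 (d1 := tl (tri_g O)) (d2 := Nl (tri_tilde O)) (f := lin oct_map_g_linear) oct_map_g_chain
  vg (hdet_opp k_char2 vt).
have mm := add_disk_hdet_uniq v v'; subst m'.
have [m0 _] := v; have [mf0 _] := vf; have [mg0 _] := vg; have [mgf0 _] := vgf.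
have [mt0 _] := vt.
have e x : x != 0 -> sqclass (m * x ^+ 2) = sqclass m.
  by move=> x0; rewrite sqclassM ?expf_neq0 // sqclass_sq // gaddr0.
have e1 : (sqclass mf + sqclass mgf = sqclass m)%grp by rewrite -sqclassM // -mc e.
have e2 : (sqclass mg + sqclass mt = sqclass m)%grp by rewrite -sqclassM // -mc' e.
(* In a group of exponent 2, adding x twice leaves the middle term. *)
have flip x y : (x + y + x = y :> units_mod_squares k)%grp.
  by rewrite (sqclassC x y) -gaddA sqclass_dbl gaddr0.
by apply: (@gaddI _ (sqclass mt)); rewrite gaddA (sqclassC (sqclass mt)) e2 -e1 gaddA !flip.
Qed.

End VirtualOctahedron.

Definition tri_class (T : tri C) (vT : virtual dist T) : units_mod_squares k :=
  sqclass (sval (cid (virtual_hdet vT))).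

Lemma tri_classE (T : tri C) (vT : virtual dist T) m :
  hdet (@total_diff T) m -> tri_class vT = sqclass m.
Proof.
rewrite /tri_class; case: cid => m' v' v /=; congr sqclass.
exact: hdet_uniq eps_neq0 eps_sqr res_surj res_ker _ _ _ _ v' v.
Qed.

Lemma contractible_hdet (T U : lmodType R) (d : T -> T) :
  dm_iso d (@add_disk R U 'rV[R]_0 id) -> hdet d 1.
Proof.
move=> iso; split; first exact: oner_neq0.
exists U, 0%N, 0; split; last by rewrite det_mx00 rmorph1.
have -> : @normal_form R eps U 0%N 0 = @add_disk R U 'rV[R]_0 id; last exact: iso.
by apply/funext => -[[u w] v]; congr (_, _, _); apply/rowP => -[].
Qed.

Definition class0 (X : C) : sq0 (sqclass_sqmod k) := 0%grp.

Definition class1 (x : dgen1 dist Kv) : sq1 (sqclass_sqmod k) :=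
  match x with
  | GenIso _ _ _ _ => 0%grp
  | GenTri T hT => tri_class hT
  end.

(** The total differential of a split triangle is a disk. *)
Lemma split_class (X Y Z : C) (f : hom X Y) (i : hom Y Z) (q : hom Z X) (r : hom Y X)
    (s : hom Z Y) (hT : virtual dist (@Tri C X Y Z f i q)) :
  (forall x, ap r (ap f x) = x) -> (forall z, ap i (ap s z) = z) ->
  (forall y, ap f (ap r y) + ap s (ap i y) = y) -> (forall z, ap q z = 0) ->
  tri_class hT = 0%grp.
Proof.
move=> rf is_ yE q0; rewrite -sqclass1; apply: tri_classE.
apply: (@contractible_hdet _ ((X : vectType R) * (Z : vectType R))%type).
pose g (t : (X : vectType R) * (Y : vectType R) * (Z : vectType R)) :
    ((X : vectType R) * (Z : vectType R)) * ((X : vectType R) * (Z : vectType R)) * 'rV[R]_0 :=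
  ((t.1.1, ap i t.1.2), (ap r t.1.2, t.2), 0).
have gP : linear g.
  by move=> c x y; congr ((_, _), (_, _), _); rewrite /= ?apD ?apZ ?scaler0 ?addr0.
have if0 x : ap i (ap f x) = 0.
  by have := yE (ap f x); rewrite rf => /(canRL (addKr _))/(congr1 (ap i));
     rewrite is_ addNr ap0.
have rs0 z : ap r (ap s z) = 0.
  by have := yE (ap s z); rewrite is_ => /(canRL (addrK _))/(congr1 (ap r));
     rewrite rf subrr ap0.
exists (lin gP), (fun t => (t.1.1.1, ap f t.1.2.1 + ap s t.1.1.2, t.1.2.2)).
split=> [[[x y] z]|[[[x y] [x' y']] z]|[[x y] z]]; rewrite /= /g /=.
- by rewrite yE.
- by rewrite !apD if0 is_ rf rs0 add0r addr0; congr (_, _, _); apply/rowP => -[].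
by congr ((_, _), (_, _), _); rewrite /= ?q0 ?if0 ?rf.
Qed.

Lemma class_rel i (u v : term C (dgen1 dist Kv) i) :
  dstar_rel u v -> eval_term class0 class1 u = eval_term class0 class1 v.
Proof.
have D0eq (x y : sq0 (sqclass_sqmod k)) : x = y by case: x; case: y.
case.
- by move=> *; apply: D0eq.
- by move=> *; apply: D0eq.
- exact: D0eq.
- by move=> *.
- move=> X hT; apply: (split_class (r := idm X) (s := 0)) => t; rewrite !apE ?addr0 //.
  by rewrite [t]zobE.
- move=> X hT; apply: (split_class (r := 0) (s := idm X)) => t; rewrite !apE ?ap0 ?add0r //.
  by rewrite [t]zobE.
- by move=> *; apply/esym/gadd0.
- move=> T T' hT hT' a b c ha hb hc abc.
  change ((0 + (0 + 0) = - tri_class hT' + 0 + tri_class hT)%grp).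
  have [m' v'] := virtual_hdet hT'.
  have iso : dm_iso (@total_diff T) (@total_diff T') by apply: total_diff_iso; exists a, b, c.
  rewrite (tri_classE hT' v') (tri_classE hT (hdet_iso iso v')).
  by rewrite !gadd0 gaddr0 gaddN.
- move=> O hf hg hgf ht [diag _].
  change ((tri_class hg + tri_class hf = tri_class hgf + (tri_class ht + 0))%grp).
  have [mf vf] := virtual_hdet hf; have [mg vg] := virtual_hdet hg.
  have [mgf vgf] := virtual_hdet hgf; have [mt vt] := virtual_hdet ht.
  rewrite (tri_classE _ vf) (tri_classE _ vg) (tri_classE _ vgf) (tri_classE _ vt) gaddr0.
  exact: octahedron_hdet diag _ _ _ _ vf vg vgf vt.
- move=> X Y h1 h2; change ((0 = - tri_class h2 + tri_class h1)%grp).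
  rewrite (split_class (r := pr1) (s := in2)) ?(split_class (r := pr2) (s := in1)) ?gopp0 ?gadd0 //;
    move=> t; rewrite !apE //; case: t => x y; congr (_, _); rewrite /= ?addr0 ?add0r //.
Qed.

(** * The surjection onto the square classes *)

Definition mul_tri (w : R) : tri C :=
  @Tri C (R^o : vectType R) (R^o : vectType R) (R^o : vectType R)
    (scal eps _) (scal eps _) (scal (w * eps) _).

Hypothesis dist_eps : dist (mul_triangle eps).

(** Scaling one map by the inverse of w turns (eps, eps, w eps) into a triangle that
    is isomorphic to (eps, eps, eps). *)
Lemma mul_tri_virtual w : res w != 0 -> virtual dist (mul_tri w).
Proof.
move=> /(res_neq0_inv eps_sqr res_surj res_ker)[w' ww'].
have ee := eps_eps eps_sqr; have w'w : w' * w = 1 by rewrite mulrC.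
have cK (X : C) : cancel (ap (scal w' X)) (ap (scal w X)).
  by move=> x; rewrite !ap_scal scalerA ww' scale1r.
have cK' (X : C) : cancel (ap (scal w X)) (ap (scal w' X)).
  by move=> x; rewrite !ap_scal scalerA w'w scale1r.
have idK (X : C) : cancel (ap (idm X)) (ap (idm X)) by move=> x; rewrite !apE.
split.
  split; apply: ap_ext => x; rewrite !apE scalerA ?ee ?scale0r //.
    by rewrite -mulrA ee mulr0 scale0r.
  by rewrite mulrCA ee mulr0 scale0r.
exists (Tri (idm zob) (0 : hom zob zob) 0).
exists (R^o : vectType R), (R^o : vectType R), (R^o : vectType R).
exists (scal eps _), (scal eps _), (scal (w * eps) _); split.
- exact: contr1.
- apply: (tri_iso_ap (a := pr1) (a' := in1) (b := pr1) (b' := in1)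
    (c := pr1) (c' := in1)) => t; rewrite !apE //=.
  + by case: t => x z; rewrite [z]zobE.
  + by case: t => x z; rewrite [z]zobE.
  + by case: t => x z; rewrite [z]zobE.
  + by rewrite addr0.
- exists (scal (w' * eps) _).
  apply: (dist_transport dist_tr (a := idm _) (a' := idm _) (b := scal w' _) (b' := scal w _)
    (c := scal w' _) (c' := scal w _) dist_eps) => // t; rewrite !apE ?scalerA //.
  + by rewrite mulrC.
  + by rewrite -mulrA mulrCA ww' mulr1.
- exists (scal (w' * eps) _).
  apply: (dist_transport dist_tr (a := idm _) (a' := idm _) (b := idm _) (b' := idm _)
    (c := scal w' _) (c' := scal w _) dist_eps) => // t; rewrite !apE ?scalerA //.
  by rewrite -mulrA mulrCA ww' mulr1.
by exists (scal eps _); exact: dist_eps.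
Qed.

(** The total differential of (eps, eps, w eps) divided by eps, in the row-vector
    convention: it permutes the three terms cyclically, with the factor w from the
    last to the first. *)
Definition cyclic_mx (w : R) : 'M[R]_3 :=
  \matrix_(i, j) ((i.+1 == j)%N%:R + w *+ ((i == 2 :> nat) && (j == 0 :> nat))).

Lemma det_cyclic w : \det (cyclic_mx w) = w.
Proof.
rewrite (expand_det_col _ ord0) !big_ord_recl big_ord0 /cofactor !mxE /=.
rewrite !mulr0n !addr0 !mul0r !add0r mulr1n.
rewrite (expand_det_row _ ord0) !big_ord_recl big_ord0 /cofactor !mxE /= !det_mx11 !mxE /=.
by rewrite !mulr0n !addr0 mul0r addr0 expr0 !mulr1 -signr_odd /= expr0 mulr1.
Qed.

Lemma mul_tri_hdet w : res w != 0 -> hdet (@total_diff (mul_tri w)) (res w).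
Proof.
move=> w0; split=> //; exists 'rV[R]_0, 3, (cyclic_mx w); split; last by rewrite det_cyclic.
pose g (t : R^o * R^o * R^o) : 'rV[R]_0 * 'rV[R]_0 * 'rV[R]_3 :=
  (0, 0, \row_i nth 0 [:: t.1.1; t.1.2; t.2] i).
have gP : linear g.
  move=> c x y; congr (_, _, _); rewrite /= ?scaler0 ?addr0 //.
  by apply/rowP => -[[|[|[|]]] //= l]; rewrite !mxE.
exists (lin gP), (fun t : 'rV[R]_0 * 'rV[R]_0 * 'rV[R]_3 =>
  (t.2 0 0, t.2 0 1, t.2 0 2%:R)); split.
- by move=> [[x y] z]; rewrite /= !mxE.
- move=> [[u v] t]; congr (_, _, _); try by apply/rowP => -[].
  by apply/rowP => -[[|[|[|]]] //= l]; rewrite !mxE /=; congr (t _ _); apply/val_inj.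
- move=> [[x y] z]; congr (_, _, _) => //=.
  apply/rowP => i; rewrite !mxE !big_ord_recl big_ord0 !mxE /=.
  case: i => [[|[|[|]]] //= l].
  + rewrite ap_scal !(mulr0n, mulr1n, addr0, add0r, mulr0, mulr1).
    by rewrite [LHS]mulrAC mulrC (mulrC w).
  + by rewrite ap_scal !(mulr0n, mulr1n, addr0, add0r, mulr0, mulr1).
  + by rewrite ap_scal !(mulr0n, mulr1n, addr0, add0r, mulr0, mulr1).
Qed.

(** The class of (eps, eps, w eps) minus that of (eps, eps, eps) has boundary zero,
    and is sent to the square class of w. *)
Lemma K1_virtual : exists phi : ghom (K1 dist Kv) (units_mod_squares k),
  forall y : units_mod_squares k, exists x : K1 dist Kv, phi x = y.
Proof.
have [f [[f0 f1 fb fk] _]] := presented_universal class_rel.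
pose g (x : K1 dist Kv) : units_mod_squares k := f D1 (sval x).
have gD x y : g (x + y)%grp = (g x + g y)%grp by apply: (gfunD (f D1)).
exists (GHom gD) => y; have [m [m0 ->]] := sqclass_surj y.
have [w wm] := res_surj m; rewrite -wm in m0 *.
have v1 : virtual dist (mul_tri 1) by apply: mul_tri_virtual; rewrite rmorph1 oner_neq0.
have vw : virtual dist (mul_tri w) by apply: mul_tri_virtual.
pose t1 := tri_cl (s := Kv) v1; pose tw := tri_cl (s := Kv) vw.
have k0 : bdry (dstar dist Kv) (tw + - t1)%grp = 0%grp.
  by rewrite gfunD gfunN !bdry_tri_cl gaddrN.
exists (exist (fun x : sq1 (dstar dist Kv) => bdry _ x = 0%grp) _ k0 : K1 dist Kv).
rewrite /= /g /= gfunD gfunN.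
have -> : f D1 tw = tri_class vw by apply: f1.
have -> : f D1 t1 = tri_class v1 by apply: f1.
have r1 : res 1 != 0 by rewrite rmorph1 oner_neq0.
rewrite (tri_classE _ (mul_tri_hdet m0)) (tri_classE _ (mul_tri_hdet r1)) rmorph1 sqclass1.
by rewrite gopp0 gaddr0.
Qed.

End Virtual.

Theorem theorem2p5p1 (R : comNzRingType) (eps : R)
    (R_local : local_with_maximal_ideal (principal_ideal eps))
    (eps_neq0 : eps != 0) (eps_sqr : eps ^+ 2 = 0)
    (k : fieldType) (res : {rmorphism R -> k})
    (res_surj : forall y : k, exists x : R, res x = y)
    (res_ker : forall x : R, (res x == 0) = (x \in principal_ideal eps))
    (k_char2 : 2%N \in [pchar k])
    (dist : tri (free_modules_susp R) -> Prop)
    (dist_triangulated : triangulated dist)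
    (dist_eps : dist (mul_triangle eps)) :
  [/\ trivial_group (K0 dist Kb), trivial_group (K0 dist Kd),
      trivial_group (K0 dist Kv), trivial_group (K1 dist Kb)
    & trivial_group (K1 dist Kd)]
  /\ exists phi : ghom (K1 dist Kv) (units_mod_squares k),
       forall y : units_mod_squares k, exists x : K1 dist Kv, phi x = y.
Proof.
have K1' s : s <> Kv -> trivial_group (K1 dist s).
  exact: (K1_trivial dist_triangulated eps_sqr res_surj res_ker k_char2 dist_eps).
have K0' s : trivial_group (K0 dist s).
  exact: (@K0_trivial _ _ dist_triangulated _ dist_eps s).
split; first by split=> //; apply: K1'.
exact: (K1_virtual dist_triangulated eps_neq0 eps_sqr res_surj res_ker k_char2 dist_eps).
Qed.
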